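(* Let $T$ be a Tadmor--Ritt operator on a complex Banach space $X$, and let $\theta=\arccos\frac{1}{C(T)}$. Let $m\in\{0,1,2,\dots\}$, $r\in(0,1)$ and $\eta\in(\theta,\frac{\pi}{2})$, and put $\tau_m(z)=z^m$. Then there is a constant $c(T,m,r,\eta)$ with $$c(T,m,r,\eta)\le \frac{C_\eta(T)}{2\pi}\,\mathcal{C}(r,m,\eta)$$ such that for all $f\in H^\infty(\Omega_{\eta,r})$, $$\|(f\cdot\tau_m)(T)\|\le c(T,m,r,\eta)\cdot\|f\|_{\infty,\Omega_{\eta,r}}.$$
   Context: $X$ is a (nonzero) complex Banach space; operators are bounded and linear; $R(z,T)=(zI-T)^{-1}$ for $z$ in the resolvent set; $\mathbb{D}$ is the open unit disc; $B_r(z_0)$ is the open disc with centre $z_0$ and radius $r$. An operator $T$ on $X$ is a Tadmor--Ritt operator if $\sigma(T)\subset\overline{\mathbb{D}}$ and $C(T):=\sup_{|z|>1}\|(z-1)R(z,T)\|<\infty$. For $\eta\in(0,\frac{\pi}{2}]$, $\mathcal{B}_\eta$ denotes the interior of the convex hull of $\{1\}\cup B_{\sin\eta}(0)$ (so $\mathcal{B}_{\pi/2}=\mathbb{D}$). It is known that, with $\theta=\arccos\frac1{C(T)}$, one has $\sigma(T)\subset\overline{\mathcal{B}_\theta}$ (where $\overline{\mathcal B_0}:=[0,1]$) and, for all $\eta\in(\theta,\frac{\pi}{2}]$, $C_\eta(T):=\sup_{z\in\mathbb{C}\setminus\overline{\mathcal{B}_\eta}}\|(z-1)R(z,T)\|<\infty$.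 For $0<r<1$, $\Omega_{\eta,r}:=\mathcal{B}_\eta\cup B_r(1)$. For open $\Omega\subset\mathbb{C}$, $H^\infty(\Omega)$ is the space of bounded holomorphic functions on $\Omega$ with norm $\|f\|_{\infty,\Omega}=\sup_{z\in\Omega}|f(z)|$. For $g$ holomorphic on a bounded simply connected open $\Omega\supset\overline{\mathcal{B}_\theta}$, $g(T)=\frac{1}{2\pi i}\int_\Gamma g(z)R(z,T)\,dz$, where $\Gamma$ is a rectifiable, positively oriented, simple contour inside $\Omega$ encircling $\overline{\mathcal{B}_\theta}$. Finally, with $\mathrm{Ei}(s)=\int_s^\infty\frac{e^{-x}}{x}\,dx$ for $s>0$, $$\mathcal{C}(r,m,\eta):=4(\sin\eta)^{m+1}\log\tfrac{4}{\cos\eta}+4\,\mathrm{Ei}\!\left(r\tfrac{m+1}{2}\cos\eta\right)+2\pi(1+r)^m .$$ *)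

(* Defs.v *)
From Stdlib Require Import Reals ClassicalEpsilon.
From Coquelicot Require Import Coquelicot.
From mathcomp Require seq.
Open Scope R_scope.

(** Operators on [X] are functions [X -> X];
    Coquelicot's [is_linear] means linear and bounded. *)

Definition opnorm {X : NormedModule C_AbsRing} (S : X -> X) : R :=
  real (Lub_Rbar (fun y => exists x : X, norm x <= 1 /\ y = norm (S x))).

Definition is_resolvent {X : NormedModule C_AbsRing} (T : X -> X) (z : C)
    (S : X -> X) : Prop :=
  is_linear S /\
  (forall x : X, S (minus (scal z x) (T x)) = x) /\
  (forall x : X, minus (scal z (S x)) (T (S x)) = x).

Definition spectrum {X : NormedModule C_AbsRing} (T : X -> X) (z : C) : Prop :=
  ~ exists S : X -> X, is_resolvent T z S.

(** Arbitrary when [z] is in the spectrum of [T]. *)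
Definition resolvent {X : NormedModule C_AbsRing} (z : C) (T : X -> X) :
    X -> X :=
  epsilon (inhabits (fun x : X => x)) (is_resolvent T z).

Definition sup_resolvent {X : NormedModule C_AbsRing} (T : X -> X)
    (D : C -> Prop) : Rbar :=
  Lub_Rbar (fun y => exists z : C, D z /\
    y = opnorm (fun x : X => scal (z - 1)%C (resolvent z T x))).

Definition C_TR {X : NormedModule C_AbsRing} (T : X -> X) : Rbar :=
  sup_resolvent T (fun z => 1 < Cmod z).

Definition Tadmor_Ritt {X : NormedModule C_AbsRing} (T : X -> X) : Prop :=
  is_linear T /\
  (forall z : C, spectrum T z -> Cmod z <= 1) /\
  is_finite (C_TR T).

Definition theta {X : NormedModule C_AbsRing} (T : X -> X) : R :=
  acos (1 / real (C_TR T)).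

Definition disc (c : C) (r : R) (z : C) : Prop := Cmod (z - c)%C < r.

Definition convex_set (A : C -> Prop) : Prop :=
  forall (z w : C) (t : R), A z -> A w -> 0 <= t <= 1 ->
    A (RtoC (1 - t) * z + RtoC t * w)%C.

Definition convex_hull (A : C -> Prop) (z : C) : Prop :=
  forall K : C -> Prop, convex_set K -> (forall w, A w -> K w) -> K z.

Definition closure (A : C -> Prop) (z : C) : Prop :=
  forall eps : posreal, exists w : C, A w /\ disc z eps w.

(** [locally z A] says that [z] is an interior point of [A]. *)
Definition B (eta : R) (z : C) : Prop :=
  locally z (convex_hull (fun w => w = RtoC 1 \/ disc (RtoC 0) (sin eta) w)).

(** By convention the closed set of angle [0] is the segment [[0,1]]. *)
Definition closedB (eta : R) (z : C) : Prop :=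
  (eta = 0 /\ exists t : R, 0 <= t <= 1 /\ z = RtoC t) \/
  (eta <> 0 /\ closure (B eta) z).

Definition Omega (eta r : R) (z : C) : Prop := B eta z \/ disc (RtoC 1) r z.

Definition C_eta {X : NormedModule C_AbsRing} (eta : R) (T : X -> X) : Rbar :=
  sup_resolvent T (fun z => ~ closedB eta z).

Definition Hinfty (Om : C -> Prop) (f : C -> C) : Prop :=
  (forall z : C, Om z -> ex_derive f z) /\
  exists M : R, forall z : C, Om z -> Cmod (f z) <= M.

Definition supnorm (Om : C -> Prop) (f : C -> C) : R :=
  real (Lub_Rbar (fun y => exists z : C, Om z /\ y = Cmod (f z))).

(** A curve is the restriction of [g : R -> C] to [[0,1]]; integrals along
    rectifiable curves are Riemann-Stieltjes integrals.  The sum below is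
    Coquelicot's [Riemann_sum] with the increments of [g] in place of those
    of the parameter. *)

Definition RS_sum {V : ModuleSpace C_Ring} (F : C -> V) (g : R -> C)
    (ptd : @SF_seq R) : V :=
  seq.foldr plus zero
    (seq.pairmap
       (fun x y : R * R => scal (g (fst y) - g (fst x))%C (F (g (snd y))))
       (SF_h ptd, 0) (SF_t ptd)).

Definition is_contour_integral (F : C -> C) (g : R -> C) (l : C) : Prop :=
  filterlim (RS_sum F g) (Riemann_fine 0 1) (locally l).

(** Convergence in operator norm. *)
Definition is_op_contour_integral {X : NormedModule C_AbsRing}
    (F : C -> X -> X) (g : R -> C) (S : X -> X) : Prop :=
  is_linear S /\
  filterlim
    (fun ptd => opnorm (fun x : X =>
       minus (RS_sum (fun z => F z x) g ptd) (S x)))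
    (Riemann_fine 0 1) (locally 0).

Definition rectifiable (g : R -> C) : Prop :=
  exists M : R, forall (n : nat) (t : nat -> R),
    0 <= t 0%nat -> t (S n) <= 1 ->
    (forall i : nat, (i <= n)%nat -> t i <= t (S i)) ->
    sum_f_R0 (fun i => Cmod (g (t (S i)) - g (t i))%C) n <= M.

Definition simple_closed_curve (g : R -> C) : Prop :=
  continuous_on (fun t => 0 <= t <= 1) g /\
  g 0 = g 1 /\
  (forall s t : R, 0 <= s < 1 -> 0 <= t < 1 -> g s = g t -> s = t).

(** The last clause (winding number one around each point of [K]) expresses
    both the positive orientation and that [K] is encircled. *)
Definition encircling_contour (Om K : C -> Prop) (g : R -> C) : Prop :=
  simple_closed_curve g /\
  rectifiable g /\
  (forall t : R, 0 <= t <= 1 -> Om (g t) /\ ~ K (g t)) /\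
  (forall w : C, K w ->
     is_contour_integral (fun z => (/ (z - w))%C) g (2 * PI * Ci)%C).

(** [holo_calc Gamma f T] is the operator [f(T)] computed along [Gamma]. *)
Definition holo_calc {X : NormedModule C_AbsRing} (Gamma : R -> C)
    (f : C -> C) (T : X -> X) : X -> X :=
  let I := epsilon (inhabits (fun x : X => x))
    (is_op_contour_integral
       (fun z x => scal (f z) (resolvent z T x)) Gamma) in
  fun x => scal (/ (2 * PI * Ci))%C (I x).

Definition Ei (s : R) : R :=
  RInt_gen (fun x => exp (- x) / x) (at_point s) (Rbar_locally p_infty).

Definition calC (r : R) (m : nat) (eta : R) : R :=
  4 * sin eta ^ (m + 1) * ln (4 / cos eta)
  + 4 * Ei (r * ((INR m + 1) / 2) * cos eta)
  + 2 * PI * (1 + r) ^ m.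

Definition tau (m : nat) (z : C) : C := (z ^ m)%C.

(* Main.v *)
(** Since [1/C(T)] is the cosine of [theta], a Neumann series about points of
    modulus at least one bounds [(z - 1) R(z,T)] outside every convex set of
    angle larger than [theta].  The integral over [Gamma] may therefore be moved
    to the boundary of [Omega], contracted slightly towards the interior point
    [1 - r/2].  There [|z|^m |R(z,T) x| <= C_eta |z|^m / |z - 1| |x|] up to a small
    error, and the integral of [|z|^m / |z - 1|] is split over the large arc
    (giving the logarithm), the two tangent segments (giving [Ei]) and the arc of
    the circle of radius [r] about [1] (giving [2 pi (1 + r)^m]).

    The contour is moved without the Jordan curve theorem.  Holomorphic
    functions on a starlike domain have a primitive [P] (Goursat), so
    integration by parts turns [F R] into [P R^2]; the values of [P] on [Gamma]
    are recovered from those on the other contour by Cauchy's formula,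
    and the inner integral of [R(z)^2 / (w - z)] over [Gamma] is evaluated with the
    resolvent identity.  Winding numbers are constant along paths because
    [w |-> int dz / (z - w)] has increments quadratic in the step after removal of
    an exact differential; the same argument applied to [(z - l T)^-1], for [l]
    from [0] to [1], gives the integral of the resolvent itself. *)

(* Integration by parts buys one degree of regularity. Cauchy's formula over the new contour needs
   [(P w - P z) / (w - z)] to be differentiable at [w = z]; for a primitive [P] this follows from
   differentiability of [F] alone, whereas for [F] itself it would be a theorem on removable
   singularities. An exchange of two contour integrals is avoided as well: the integral over the new
   contour is kept as a Riemann sum, which passes under the integral over [Gamma], and only
   uniformity of its error in the other variable is needed. This is why a curve is represented by
   its quadrature rules, with meshes that depend on a modulus of continuity and not on the
   integrand. Two gaps must be kept open. [Gamma] avoids the closed set of angle [theta], off which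
   no uniform resolvent bound is at hand, so a slightly larger convex set of parameter [s0] is
   inserted between that set and [Gamma]. All these convex sets share the corner 1; the new contour
   keeps away from [s0] because its distance from 1 stays comparable to [r]. *)
Require Import Defs.
From Stdlib Require Import Reals Arith Lra Lia List Classical ClassicalEpsilon FunctionalExtensionality.
From Coquelicot Require Import Coquelicot.
Open Scope R_scope.

(** * Linear identities in a complex vector space *)

(** Reflection of vector identities: the vectors become numbered atoms, and equality of coefficients
    in [C], which [ring] and [field] can settle, is sufficient. *)
Inductive lin_expr : Type :=
| LVar (n : nat)
| LZero
| LPlus (a b : lin_expr)
| LMinus (a b : lin_expr)
| LOpp (a : lin_expr)
| LScal (c : C) (a : lin_expr).

Section LinearExpressions.
Context {V : ModuleSpace C_Ring}.

Fixpoint lin_eval (env : list V) (e : lin_expr) : V :=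
  match e with
  | LVar n => nth n env zero
  | LZero => zero
  | LPlus a b => plus (lin_eval env a) (lin_eval env b)
  | LMinus a b => minus (lin_eval env a) (lin_eval env b)
  | LOpp a => opp (lin_eval env a)
  | LScal c a => scal c (lin_eval env a)
  end.

Fixpoint lin_coef (e : lin_expr) (n : nat) : C :=
  match e with
  | LVar m => if Nat.eqb m n then RtoC 1 else RtoC 0
  | LZero => RtoC 0
  | LPlus a b => (lin_coef a n + lin_coef b n)%C
  | LMinus a b => (lin_coef a n - lin_coef b n)%C
  | LOpp a => (- lin_coef a n)%C
  | LScal c a => (c * lin_coef a n)%C
  end.

Fixpoint lin_comb (env : list V) (f : nat -> C) (k : nat) : V :=
  match env with
  | nil => zero
  | v :: env' => plus (scal (f k) v) (lin_comb env' f (S k))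
  end.

Lemma lin_comb_ext (env : list V) (f g : nat -> C) (k : nat) :
  (forall n, f n = g n) -> lin_comb env f k = lin_comb env g k.
Proof.
  intros H; revert k; induction env as [|v env IH]; intros k; simpl; [easy|].
  now rewrite H, IH.
Qed.

Lemma lin_comb_zero (env : list V) (k : nat) :
  lin_comb env (fun _ => RtoC 0) k = zero.
Proof.
  revert k; induction env as [|v env IH]; intros k; simpl; [easy|].
  rewrite IH, plus_zero_r. apply (scal_zero_l v).
Qed.

Lemma lin_comb_plus (env : list V) (f g : nat -> C) (k : nat) :
  lin_comb env (fun n => (f n + g n)%C) k
  = plus (lin_comb env f k) (lin_comb env g k).
Proof.
  revert k; induction env as [|v env IH]; intros k; simpl.
  - now rewrite plus_zero_l.
  - rewrite IH.
    replace (scal (f k + g k)%C v) with (plus (scal (f k) v) (scal (g k) v))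
      by (symmetry; apply (scal_distr_r (f k) (g k) v)).
    rewrite <- !plus_assoc. f_equal. rewrite !plus_assoc. f_equal.
    apply plus_comm.
Qed.

Lemma lin_comb_scal (env : list V) (f : nat -> C) (c : C) (k : nat) :
  lin_comb env (fun n => (c * f n)%C) k = scal c (lin_comb env f k).
Proof.
  revert k; induction env as [|v env IH]; intros k; simpl.
  - symmetry; apply (scal_zero_r c).
  - rewrite IH, (scal_distr_l c). f_equal. symmetry. apply (scal_assoc c).
Qed.

Lemma lin_comb_opp (env : list V) (f : nat -> C) (k : nat) :
  lin_comb env (fun n => (- f n)%C) k = opp (lin_comb env f k).
Proof.
  revert k; induction env as [|v env IH]; intros k; simpl.
  - symmetry; exact (@opp_zero (ModuleSpace.AbelianGroup C_Ring V)).
  - rewrite IH, (@opp_plus (ModuleSpace.AbelianGroup C_Ring V)). f_equal. apply (scal_opp_l (f k) v).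
Qed.

Lemma lin_comb_var (env : list V) (n k : nat) :
  lin_comb env (fun m => if Nat.eqb (n + k) m then RtoC 1 else RtoC 0) k
  = nth n env zero.
Proof.
  revert n k; induction env as [|v env IH]; intros n k; cbn [lin_comb].
  - now destruct n.
  - destruct n as [|n]; cbn [nth Nat.add].
    + rewrite Nat.eqb_refl.
      replace (scal (RtoC 1) v) with v by (symmetry; apply (scal_one v)).
      rewrite <- (plus_zero_r v) at 2. f_equal.
      rewrite <- (lin_comb_zero env (S k)).
      assert (H : forall j, (k < j)%nat ->
        lin_comb env (fun m => if Nat.eqb k m then RtoC 1 else RtoC 0) j
        = lin_comb env (fun _ => RtoC 0) j).
      { clear IH. induction env as [|w env IH]; intros j Hj; simpl; [easy|].
        destruct (Nat.eqb_spec k j); [lia|]. rewrite IH by lia. easy. }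
      apply H; lia.
    + destruct (Nat.eqb_spec (S (n + k)) k); [lia|].
      rewrite <- (IH n (S k)).
      replace (scal (RtoC 0) v) with (@zero (ModuleSpace.AbelianMonoid C_Ring V))
        by (symmetry; apply (scal_zero_l v)).
      rewrite plus_zero_l. apply lin_comb_ext. intros m.
      now replace (n + S k)%nat with (S (n + k)) by lia.
Qed.

Lemma lin_eval_comb (env : list V) (e : lin_expr) :
  lin_eval env e = lin_comb env (lin_coef e) 0.
Proof.
  induction e as [n| |a IHa b IHb|a IHa b IHb|a IHa|c a IHa]; simpl.
  - rewrite <- (lin_comb_var env n 0). apply lin_comb_ext. intros m.
    now rewrite Nat.add_0_r.
  - symmetry; apply lin_comb_zero.
  - rewrite IHa, IHb. symmetry; apply lin_comb_plus.
  - unfold Cminus, minus. rewrite IHa, IHb, <- lin_comb_opp.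
    symmetry; apply lin_comb_plus.
  - rewrite IHa. symmetry; apply lin_comb_opp.
  - rewrite IHa. symmetry; apply lin_comb_scal.
Qed.

Fixpoint coef_eq (N : nat) (a b : lin_expr) : Prop :=
  match N with
  | O => True
  | S n => lin_coef a n = lin_coef b n /\ coef_eq n a b
  end.

Lemma lin_eval_eq (env : list V) (a b : lin_expr) :
  coef_eq (length env) a b -> lin_eval env a = lin_eval env b.
Proof.
  intros H. rewrite !lin_eval_comb.
  assert (H' : forall n, (n < length env)%nat -> lin_coef a n = lin_coef b n).
  { revert H. generalize (length env) as N. induction N as [|N IH]; simpl.
    - intros; lia.
    - intros [H1 H2] n Hn.
      destruct (Nat.eq_dec n N) as [->|]; [easy|]. apply IH; [easy|lia]. }
  clear H.
  assert (H : forall k env', (k + length env' <= length env)%nat ->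
    lin_comb env' (lin_coef a) k = lin_comb env' (lin_coef b) k).
  { intros k env'; revert k; induction env' as [|v env' IH]; intros k Hk; simpl in *.
    - easy.
    - rewrite H' by lia. f_equal. apply IH; lia. }
  apply H; lia.
Qed.
End LinearExpressions.

Ltac lin_mem x l :=
  match l with
  | nil => constr:(false)
  | x :: _ => constr:(true)
  | _ :: ?l' => lin_mem x l'
  end.
Ltac lin_add x l :=
  let b := lin_mem x l in
  match b with true => l | false => constr:(x :: l) end.
Ltac lin_pos x l :=
  match l with
  | x :: _ => constr:(O)
  | _ :: ?l' => let n := lin_pos x l' in constr:(S n)
  end.
Ltac lin_atoms t l :=
  match t with
  | plus ?a ?b => let l1 := lin_atoms a l in lin_atoms b l1
  | minus ?a ?b => let l1 := lin_atoms a l in lin_atoms b l1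
  | opp ?a => lin_atoms a l
  | zero => l
  | scal ?c ?a => lin_atoms a l
  | _ => lin_add t l
  end.
Ltac lin_reify t l :=
  match t with
  | plus ?a ?b =>
      let x := lin_reify a l in let y := lin_reify b l in constr:(LPlus x y)
  | minus ?a ?b =>
      let x := lin_reify a l in let y := lin_reify b l in constr:(LMinus x y)
  | opp ?a => let x := lin_reify a l in constr:(LOpp x)
  | zero => constr:(LZero)
  | scal ?c ?a => let x := lin_reify a l in constr:(LScal c x)
  | _ => let n := lin_pos t l in constr:(LVar n)
  end.

(** Reduces an identity between linear combinations of vectors to the
    identities between the coefficients of each vector. *)
Ltac lin_coefs :=
  match goal with
  | |- @eq ?T ?a ?b =>
      let l := lin_atoms a (@nil T) in
      let l := lin_atoms b l in
      let x := lin_reify a l in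
      let y := lin_reify b l in
      refine (lin_eval_eq l x y _);
      cbv [coef_eq length lin_coef Nat.eqb];
      repeat (split; [|]); try exact I
  end.
Ltac lin_ring := lin_coefs; ring.
Ltac lin_field := lin_coefs; field.

(** * Norms and continuity moduli *)

Section Norms.
Context {V : NormedModule C_AbsRing}.

(** The norm axiom is only an inequality; applied once more, with the scalar [/ c], it gives the
    converse. *)
Lemma norm_scal_C (c : C) (x : V) : norm (scal c x) = Cmod c * norm x.
Proof.
  apply Rle_antisym; [apply (norm_scal c x)|].
  destruct (Ceq_dec c 0) as [->|Hc].
  - rewrite Cmod_0, Rmult_0_l. apply norm_ge_0.
  - assert (Hc' : 0 < Cmod c) by now apply Cmod_gt_0.
    assert (Hx : norm x <= / Cmod c * norm (scal c x)).
    { replace x with (scal (/ c)%C (scal c x)) at 1 by (lin_field; easy).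
      rewrite <- Cmod_inv by easy. apply (norm_scal (/ c)%C (scal c x)). }
    apply Rmult_le_compat_l with (r := Cmod c) in Hx; [|lra].
    rewrite <- Rmult_assoc, Rinv_r, Rmult_1_l in Hx; lra.
Qed.

Lemma norm_plus_le (x y : V) : norm (plus x y) <= norm x + norm y.
Proof. exact (norm_triangle x y). Qed.

Lemma norm_minus_sym (x y : V) : norm (minus x y) = norm (minus y x).
Proof.
  replace (minus x y) with (opp (minus y x)) by lin_ring. apply norm_opp.
Qed.

Lemma norm_minus_triangle (y x z : V) :
  norm (minus x z) <= norm (minus x y) + norm (minus y z).
Proof.
  replace (minus x z) with (plus (minus x y) (minus y z)) by lin_ring.
  apply norm_plus_le.
Qed.

Lemma norm_le_minus (x y : V) : norm x <= norm y + norm (minus x y).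
Proof.
  replace x with (plus y (minus x y)) at 1 by lin_ring. apply norm_plus_le.
Qed.

Lemma norm_minus_le (x y : V) : norm (minus x y) <= norm x + norm y.
Proof.
  unfold minus. rewrite <- (norm_opp y). apply norm_plus_le.
Qed.

Lemma norm_minus_eq_0 (x y : V) : norm (minus x y) <= 0 -> x = y.
Proof.
  intros H. assert (H0 : minus x y = zero).
  { apply norm_eq_zero. apply Rle_antisym; [easy|apply norm_ge_0]. }
  replace x with (plus (minus x y) y) by lin_ring. rewrite H0. lin_ring.
Qed.

Lemma norm_minus_small (x y : V) :
  (forall eps, 0 < eps -> norm (minus x y) <= eps) -> x = y.
Proof.
  intros H. apply norm_minus_eq_0. apply le_epsilon. intros eps He.
  rewrite Rplus_0_l. now apply H.
Qed.
End Norms.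

Lemma Cmod_minus_sym (a b : C) : Cmod (a - b) = Cmod (b - a).
Proof. apply (norm_minus_sym (V := C_NormedModule)). Qed.

Lemma Cmod_minus_triangle (b a c : C) :
  Cmod (a - c) <= Cmod (a - b) + Cmod (b - c).
Proof. apply (norm_minus_triangle (V := C_NormedModule)). Qed.

(** Completeness by sequences and norms, free of filters and balls. As a hypothesis on a
    [NormedModule] it lets the same lemmas serve both [X] and [C]. *)
Definition norm_complete (V : NormedModule C_AbsRing) : Prop :=
  forall u : nat -> V,
    (forall eps, 0 < eps -> exists N, forall n m, (N <= n)%nat -> (N <= m)%nat ->
       norm (minus (u n) (u m)) <= eps) ->
    exists v, forall eps, 0 < eps -> exists N, forall n, (N <= n)%nat ->
      norm (minus (u n) v) <= eps.

Lemma complete_norm_complete (X : CompleteNormedModule C_AbsRing) :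
  norm_complete X.
Proof.
  intros u Hu.
  set (F := fun P : X -> Prop => eventually (fun n => P (u n))).
  assert (HF : ProperFilter F) by exact (filtermap_proper_filter _ _ u eventually eventually_filter).
  assert (HC : cauchy F).
  { intros eps. destruct (Hu (eps / 2)) as [N HN].
    { assert (H := cond_pos eps). lra. }
    exists (u N), N. intros n Hn. apply (norm_compat1 (V := X)).
    eapply Rle_lt_trans; [apply (HN n N Hn (le_n _))|].
    assert (H := cond_pos eps). lra. }
  exists (lim F). intros eps He.
  assert (Hf := norm_factor_gt_0 (V := X)).
  assert (He' : 0 < eps / norm_factor (V := X)) by now apply Rdiv_lt_0_compat.
  destruct (complete_cauchy F HF HC (mkposreal _ He')) as [N HN].
  exists N. intros n Hn.
  apply Rlt_le. eapply Rlt_le_trans; [apply (norm_compat2 (V := X)), HN, Hn|].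
  simpl. right. field. lra.
Qed.

Lemma norm_complete_C : norm_complete C_NormedModule.
Proof. exact (complete_norm_complete C_CompleteNormedModule). Qed.

(** * Rectifiable chains *)

Section QuadratureSums.
Context {V : NormedModule C_AbsRing}.

Fixpoint qsum (N : list (C * C)) (h : C -> V) : V :=
  match N with
  | nil => zero
  | p :: N' => plus (scal (fst p) (h (snd p))) (qsum N' h)
  end.
End QuadratureSums.

(** The Riemann sum of [k] with respect to arc length [|dz|]; for [k = 1] on a curve it is the
    length of an inscribed polygon. *)
Fixpoint qvar (N : list (C * C)) (k : C -> R) : R :=
  match N with
  | nil => 0
  | p :: N' => Cmod (fst p) * k (snd p) + qvar N' k
  end.

Section QuadratureSumLemmas.
Context {V : NormedModule C_AbsRing}.
Implicit Types (N : list (C * C)) (h k : C -> V).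

Lemma qsum_app N N' h : qsum (N ++ N') h = plus (qsum N h) (qsum N' h).
Proof.
  induction N as [|p N IH]; simpl; [lin_ring|]. rewrite IH. lin_ring.
Qed.

Lemma qsum_minus N h k :
  qsum N (fun z => minus (h z) (k z)) = minus (qsum N h) (qsum N k).
Proof. induction N as [|p N IH]; simpl; [lin_ring|]. rewrite IH. lin_ring. Qed.

Lemma qsum_scal N (c : C) h :
  qsum N (fun z => scal c (h z)) = scal c (qsum N h).
Proof. induction N as [|p N IH]; simpl; [lin_ring|]. rewrite IH. lin_ring. Qed.

Lemma qsum_ext N h k :
  (forall w z, In (w, z) N -> h z = k z) -> qsum N h = qsum N k.
Proof.
  induction N as [|[w z] N IH]; simpl; intros H; [easy|].
  rewrite IH by (intros; eapply H; right; eassumption).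
  now rewrite (H w z) by now left.
Qed.

Lemma qvar_app N N' (k : C -> R) : qvar (N ++ N') k = qvar N k + qvar N' k.
Proof. induction N as [|p N IH]; simpl; [lra|]. rewrite IH. lra. Qed.

Lemma qvar_le N (k k' : C -> R) :
  (forall w z, In (w, z) N -> k z <= k' z) -> qvar N k <= qvar N k'.
Proof.
  induction N as [|[w z] N IH]; simpl; intros H; [lra|].
  apply Rplus_le_compat.
  - apply Rmult_le_compat_l; [apply Cmod_ge_0|]. apply (H w); now left.
  - apply IH. intros; eapply H; right; eassumption.
Qed.

Lemma qvar_plus N (k k' : C -> R) :
  qvar N (fun z => k z + k' z) = qvar N k + qvar N k'.
Proof. induction N as [|p N IH]; simpl; [lra|]. rewrite IH. lra. Qed.

Lemma qvar_scal N c (k : C -> R) : qvar N (fun z => c * k z) = c * qvar N k.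
Proof. induction N as [|p N IH]; simpl; [lra|]. rewrite IH. lra. Qed.

Lemma qvar_const N c : qvar N (fun _ => c) = c * qvar N (fun _ => 1).
Proof. rewrite <- qvar_scal. induction N; simpl; lra. Qed.

Lemma norm_qsum N h : norm (qsum N h) <= qvar N (fun z => norm (h z)).
Proof.
  induction N as [|p N IH]; simpl; [rewrite norm_zero; lra|].
  eapply Rle_trans; [apply norm_plus_le|].
  rewrite norm_scal_C. lra.
Qed.
End QuadratureSumLemmas.

(** [rho] and [eps] are fixed numbers and not a limit, so that a mesh chosen from [rho] alone serves
    a whole family of integrands, with values in any space. *)
Definition near_constant {V : NormedModule C_AbsRing} (I : C -> Prop)
    (rho eps : R) (h : C -> V) : Prop :=
  forall w w', I w -> I w' -> Cmod (w' - w) < rho ->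
    norm (minus (h w') (h w)) <= eps.

Definition near_derivative {V : NormedModule C_AbsRing} (I : C -> Prop)
    (rho eps : R) (P p : C -> V) : Prop :=
  forall a b z, I a -> I b -> I z -> Cmod (b - a) < rho ->
    Cmod (z - a) < rho -> Cmod (z - b) < rho ->
    norm (minus (minus (P b) (P a)) (scal (b - a)%C (p z)))
      <= eps * Cmod (b - a).

(** A chain is described by its Riemann-Stieltjes sums: [nodes K d N] says
    that the list [N] of pairs (weight, node) is the quadrature rule given by
    a tagged subdivision of mesh less than [d].  The fields [nodes_osc],
    [nodes_ftc] and [img_lebesgue] are, respectively, the Cauchy criterion for
    Riemann sums, the fundamental theorem of calculus, and the compactness of
    the image. *)
Record chain : Type := {
  nodes : R -> list (C * C) -> Prop;
  img : C -> Prop;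
  bdry : list (C * C);
  len : R;
  nodes_ex : forall d, 0 < d -> exists N, nodes d N;
  nodes_mono : forall d d' N, d <= d' -> nodes d N -> nodes d' N;
  nodes_img : forall d N w z, nodes d N -> In (w, z) N -> img z;
  nodes_len : forall d N, nodes d N -> qvar N (fun _ => 1) <= len;
  nodes_osc : forall rho, 0 < rho -> exists d, 0 < d /\
    forall N N', nodes d N -> nodes d N' ->
    forall (V : NormedModule C_AbsRing) (h : C -> V) eps,
      near_constant img rho eps h ->
      norm (minus (qsum N h) (qsum N' h)) <= eps * len;
  nodes_ftc : forall rho, 0 < rho -> exists d, 0 < d /\
    forall N, nodes d N ->
    forall (V : NormedModule C_AbsRing) (P p : C -> V) eps,
      0 <= eps -> near_derivative img rho eps P p ->
      norm (minus (qsum bdry P) (qsum N p)) <= eps * len;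
  img_lebesgue : forall d : C -> R, (forall z, img z -> 0 < d z) ->
    exists rho, 0 < rho /\
      forall w, img w -> exists z, img z /\ Cmod (w - z) < d z /\ rho <= d z
}.

(** * Rectifiable curves as chains *)

Fixpoint fine (d a : R) (l : list (R * R)) (b : R) : Prop :=
  match l with
  | nil => a = b
  | (y, xi) :: l' => a <= xi <= y /\ y - a < d /\ fine d y l' b
  end.

Fixpoint knots (g : R -> C) (a : R) (l : list (R * R)) : list (C * C) :=
  match l with
  | nil => nil
  | (y, xi) :: l' => ((g y - g a)%C, g xi) :: knots g y l'
  end.

Lemma fine_le d a l b : fine d a l b -> a <= b.
Proof.
  revert a; induction l as [|[y xi] l IH]; simpl; intros a H; [lra|].
  destruct H as (H1 & H2 & H3). apply IH in H3. lra.
Qed.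

Lemma fine_mono d d' a l b : d <= d' -> fine d a l b -> fine d' a l b.
Proof.
  intros Hd; revert a; induction l as [|[y xi] l IH]; simpl; intros a H; [easy|].
  destruct H as (H1 & H2 & H3). repeat split; try lra. now apply IH.
Qed.

Lemma fine_ex d a b : 0 < d -> a <= b -> exists l, fine d a l b.
Proof.
  intros Hd Hab.
  destruct (nfloor_ex ((b - a) / (d / 2))) as [n [_ Hn]].
  { apply Rdiv_le_0_compat; lra. }
  assert (Hn' : b - a < INR (S n) * (d / 2)).
  { rewrite S_INR. apply Rmult_lt_compat_r with (r := d / 2) in Hn; [|lra].
    unfold Rdiv at 1 in Hn. rewrite Rmult_assoc, Rinv_l in Hn by lra. lra. }
  clear Hn. revert a Hab Hn'. generalize (S n) as m. clear n.
  induction m as [|m IH]; intros a Hab Hn.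
  - simpl in Hn. lra.
  - rewrite S_INR in Hn.
    destruct (Rle_dec (b - a) (d / 2)) as [H|H].
    + exists ((b, a) :: nil). simpl. lra.
    + destruct (IH (a + d / 2)) as [l Hl]; [lra|lra|].
      exists ((a + d / 2, a) :: l). simpl. repeat split; try lra. easy.
Qed.

Section Curves.
Variables (g : R -> C) (v : R -> R).
Hypothesis g_var : forall a b, 0 <= a -> a <= b -> b <= 1 ->
  Cmod (g b - g a) <= v b - v a.

Lemma qvar_knots d a l b (k : C -> R) (phi : R -> R) :
  (forall x y xi, 0 <= x -> y <= 1 -> x <= xi <= y -> y - x < d ->
     Cmod (g y - g x) * k (g xi) <= phi y - phi x) ->
  0 <= a -> b <= 1 -> fine d a l b ->
  qvar (knots g a l) k <= phi b - phi a.
Proof.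
  intros H; revert a; induction l as [|[y xi] l IH]; simpl; intros a Ha Hb Hl.
  - subst; lra.
  - destruct Hl as (H1 & H2 & H3). assert (Hy := fine_le _ _ _ _ H3).
    assert (H4 := IH y ltac:(lra) Hb H3).
    assert (H5 := H a y xi Ha ltac:(lra) H1 H2). lra.
Qed.

Lemma knots_In d a l b w z :
  0 <= a -> b <= 1 -> fine d a l b -> In (w, z) (knots g a l) ->
  exists t, 0 <= t <= 1 /\ z = g t.
Proof.
  revert a; induction l as [|[y xi] l IH]; simpl; intros a Ha Hb Hl HI; [easy|].
  destruct Hl as (H1 & H2 & H3). assert (Hy := fine_le _ _ _ _ H3).
  destruct HI as [HI|HI].
  - injection HI as _ HI. exists xi. split; [lra|easy].
  - apply (IH y); [lra|easy..].
Qed.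

(** Telescoping of a cellwise estimate. With [Phi] a primitive along the curve it gives the
    fundamental theorem of calculus; with [Phi] a partial sum over another subdivision it gives the
    Cauchy criterion. *)
Lemma knots_compare {V : NormedModule C_AbsRing} d a l b (h : C -> V)
    (Phi : R -> V) (phi : R -> R) :
  (forall x y xi, 0 <= x -> y <= 1 -> x <= xi <= y -> y - x < d ->
     norm (minus (scal (g y - g x)%C (h (g xi))) (minus (Phi y) (Phi x)))
       <= phi y - phi x) ->
  0 <= a -> b <= 1 -> fine d a l b ->
  norm (minus (qsum (knots g a l) h) (minus (Phi b) (Phi a))) <= phi b - phi a.
Proof.
  intros H; revert a; induction l as [|[y xi] l IH]; simpl; intros a Ha Hb Hl.
  - subst. replace (minus _ _) with (@zero V) by lin_ring. rewrite norm_zero; lra.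
  - destruct Hl as (H1 & H2 & H3). assert (Hy := fine_le _ _ _ _ H3).
    assert (H4 := IH y ltac:(lra) Hb H3).
    assert (H5 := H a y xi Ha ltac:(lra) H1 H2).
    replace (minus _ _) with
      (plus (minus (scal (g y - g a)%C (h (g xi))) (minus (Phi y) (Phi a)))
            (minus (qsum (knots g y l) h) (minus (Phi b) (Phi y)))) by lin_ring.
    eapply Rle_trans; [apply norm_plus_le|]. lra.
Qed.

Definition clip (x y t : R) : R := Rmax x (Rmin y t).

Lemma clip_range x y t : x <= y -> x <= clip x y t <= y.
Proof.
  intros H. unfold clip. split; [apply Rmax_l|].
  apply Rmax_lub; [easy|apply Rmin_l].
Qed.

Lemma clip_le x y s t : s <= t -> clip x y s <= clip x y t.
Proof.
  intros H. unfold clip. apply Rle_max_compat_l.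
  unfold Rmin. destruct (Rle_dec y s), (Rle_dec y t); lra.
Qed.

Lemma clip_left x y t : x <= y -> t <= x -> clip x y t = x.
Proof.
  intros; unfold clip. rewrite Rmin_right by lra. now rewrite Rmax_left by lra.
Qed.

Lemma clip_right x y t : x <= y -> y <= t -> clip x y t = y.
Proof.
  intros; unfold clip. rewrite Rmin_left by lra. now rewrite Rmax_right by lra.
Qed.

Lemma clip_mid x y t : x <= t <= y -> clip x y t = t.
Proof.
  intros; unfold clip. rewrite Rmin_right by lra. now rewrite Rmax_right by lra.
Qed.

(** The Riemann-Stieltjes sum restricted to the part of the curve with
    parameters at most [t]. *)
Fixpoint partial_knots (a : R) (l : list (R * R)) (t : R) : list (C * C) :=
  match l with
  | nil => nil
  | (y, xi) :: l' =>
      ((g (clip a y t) - g a)%C, g xi) :: partial_knots y l' t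
  end.

Lemma partial_knots_start {V : NormedModule C_AbsRing} d a l b (h : C -> V) t :
  fine d a l b -> t <= a -> qsum (partial_knots a l t) h = zero.
Proof.
  revert a; induction l as [|[y xi] l IH]; simpl; intros a Hl Ht; [easy|].
  destruct Hl as (H1 & H2 & H3).
  rewrite (IH y) by (easy || lra). rewrite clip_left by lra. lin_ring.
Qed.

Lemma partial_knots_end d a l b t :
  fine d a l b -> b <= t -> partial_knots a l t = knots g a l.
Proof.
  revert a; induction l as [|[y xi] l IH]; simpl; intros a Hl Ht; [easy|].
  destruct Hl as (H1 & H2 & H3). assert (Hy := fine_le _ _ _ _ H3).
  rewrite (IH y) by (easy || lra). now rewrite clip_right by lra.
Qed.

Lemma clip_split_g a y b t : a <= y -> y <= b ->
  g (clip a b t) = (g (clip a y t) + g (clip y b t) - g y)%C.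
Proof.
  intros H1 H2. destruct (Rle_dec t y) as [H|H].
  - rewrite (clip_left y b t) by lra.
    assert (Hc : clip a b t = clip a y t).
    { unfold clip. now rewrite !Rmin_right by lra. }
    rewrite Hc. ring.
  - rewrite (clip_right a y t) by lra.
    assert (Hc : clip a b t = clip y b t).
    { unfold clip, Rmin. destruct (Rle_dec b t); rewrite !Rmax_right by lra; easy. }
    rewrite Hc. ring.
Qed.

Lemma clip_split_v a y b t : a <= y -> y <= b ->
  v (clip a b t) = v (clip a y t) + v (clip y b t) - v y.
Proof.
  intros H1 H2. destruct (Rle_dec t y) as [H|H].
  - rewrite (clip_left y b t) by lra.
    assert (Hc : clip a b t = clip a y t).
    { unfold clip. now rewrite !Rmin_right by lra. }
    rewrite Hc. ring.
  - rewrite (clip_right a y t) by lra.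
    assert (Hc : clip a b t = clip y b t).
    { unfold clip, Rmin. destruct (Rle_dec b t); rewrite !Rmax_right by lra; easy. }
    rewrite Hc. ring.
Qed.

(** Only cells that meet [[x, y]] contribute to the increment of the partial sum. Their tags lie
    within [2 * d] of [xi], so replacing each value of [h] by the one at [xi] costs at most [eps]
    times the variation. *)
Lemma partial_knots_increment {V : NormedModule C_AbsRing} d a l b (h : C -> V)
    eps x y xi :
  (forall s t, 0 <= s <= 1 -> 0 <= t <= 1 -> Rabs (s - t) < 2 * d ->
     norm (minus (h (g s)) (h (g t))) <= eps) ->
  0 <= a -> b <= 1 -> fine d a l b ->
  0 <= x -> y <= 1 -> x <= xi <= y -> y - x < d ->
  norm (minus (scal (g (clip a b y) - g (clip a b x))%C (h (g xi)))
     (minus (qsum (partial_knots a l y) h) (qsum (partial_knots a l x) h)))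
    <= eps * (v (clip a b y) - v (clip a b x)).
Proof.
  intros Hosc Ha Hb Hl Hx Hy Hxi Hd. revert a Ha Hl.
  induction l as [|[u zeta] l IH]; intros a Ha Hl.
  - simpl in Hl. subst. simpl.
    assert (Hc : forall t, clip b b t = b).
    { intros t. destruct (clip_range b b t); lra. }
    rewrite !Hc. replace (minus _ _) with (@zero V) by lin_ring.
    rewrite norm_zero; lra.
  - cbn [fine] in Hl. destruct Hl as (H1 & H2 & H3).
    assert (Hu := fine_le _ _ _ _ H3).
    assert (H4 := IH u ltac:(lra) H3). cbn [partial_knots qsum fst snd].
    rewrite !(clip_split_g a u b), !(clip_split_v a u b) by lra.
    set (A := g (clip u b y)) in *. set (B := g (clip u b x)) in *.
    assert (H5 : norm (scal (g (clip a u y) - g (clip a u x))%C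
                   (minus (h (g xi)) (h (g zeta))))
                 <= eps * (v (clip a u y) - v (clip a u x))).
    { destruct (clip_range a u x) as [R1 R2]; [lra|].
      destruct (clip_range a u y) as [R3 R4]; [lra|].
      assert (R5 : clip a u x <= clip a u y) by (apply clip_le; lra).
      destruct (Req_dec (clip a u x) (clip a u y)) as [He|He].
      - rewrite He. replace (scal _ _) with (@zero V) by lin_ring.
        rewrite norm_zero. lra.
      - assert (Ho : a <= y /\ x <= u).
        { split; apply Rnot_lt_le; intros Hlt; apply He.
          - rewrite !clip_left by lra; easy.
          - rewrite !clip_right by lra; easy. }
        rewrite norm_scal_C, Rmult_comm.
        apply Rmult_le_compat; [apply norm_ge_0|apply Cmod_ge_0| |].
        + apply Hosc; [lra|lra|]. apply Rabs_def1; lra.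
        + apply g_var; lra. }
    replace (minus _ _) with
      (plus (scal (g (clip a u y) - g (clip a u x))%C
                   (minus (h (g xi)) (h (g zeta))))
        (minus (scal (A - B)%C (h (g xi)))
          (minus (qsum (partial_knots u l y) h) (qsum (partial_knots u l x) h))))
      by lin_ring.
    eapply Rle_trans; [apply norm_plus_le|]. lra.
Qed.

(** No common refinement is formed: the partial sums over [l'] act as the antiderivative against
    which the sum over [l] is measured. *)
Lemma knots_osc {V : NormedModule C_AbsRing} d l l' (h : C -> V) eps :
  (forall s t, 0 <= s <= 1 -> 0 <= t <= 1 -> Rabs (s - t) < 2 * d ->
     norm (minus (h (g s)) (h (g t))) <= eps) ->
  fine d 0 l 1 -> fine d 0 l' 1 ->
  norm (minus (qsum (knots g 0 l) h) (qsum (knots g 0 l') h))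
    <= eps * (v 1 - v 0).
Proof.
  intros Hosc Hl Hl'.
  replace (qsum (knots g 0 l') h) with
    (minus (qsum (partial_knots 0 l' 1) h) (qsum (partial_knots 0 l' 0) h)).
  2:{ rewrite (partial_knots_start d 0 l' 1 h 0) by (easy || lra).
      rewrite (partial_knots_end d 0 l' 1) by (easy || lra). lin_ring. }
  replace (eps * (v 1 - v 0)) with (eps * v 1 - eps * v 0) by ring.
  apply (knots_compare d 0 l 1 h (fun t => qsum (partial_knots 0 l' t) h)
           (fun t => eps * v t)); [|lra|lra|easy].
  intros x y xi Hx Hy Hxi Hd.
  assert (H := partial_knots_increment d 0 l' 1 h eps x y xi Hosc
    ltac:(lra) ltac:(lra) Hl' Hx Hy Hxi Hd).
  rewrite !(clip_mid 0 1) in H by lra. lra.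
Qed.

Hypothesis g_cont : forall t, 0 <= t <= 1 -> forall eps, 0 < eps ->
  exists d, 0 < d /\
    forall s, 0 <= s <= 1 -> Rabs (s - t) < d -> Cmod (g s - g t) < eps.

Lemma lebesgue_01 (d : R -> R) : (forall t, 0 <= t <= 1 -> 0 < d t) ->
  exists rho, 0 < rho /\ forall s, 0 <= s <= 1 ->
    exists t, 0 <= t <= 1 /\ Rabs (s - t) < d t /\ rho <= d t.
Proof.
  intros Hd.
  (* The gauge gets the value 1 outside [[0,1]], because [compactness_value_1d] asks for a positive
     gauge on the whole line. *)
  assert (Hd' : forall t, 0 < if Rle_dec 0 t then if Rle_dec t 1 then d t else 1 else 1).
  { intros t. destruct (Rle_dec 0 t), (Rle_dec t 1); try lra. now apply Hd. }
  destruct (compactness_value_1d 0 1 (fun t => mkposreal _ (Hd' t))) as [rho Hrho].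
  exists rho. split; [apply cond_pos|]. intros s Hs.
  destruct (NNPP _ (Hrho s Hs)) as (t & Ht & H1 & H2). simpl in H1, H2.
  exists t. destruct (Rle_dec 0 t), (Rle_dec t 1); try lra.
Qed.

Lemma curve_unif_cont eps : 0 < eps -> exists d, 0 < d /\
  forall s t, 0 <= s <= 1 -> 0 <= t <= 1 -> Rabs (s - t) < d ->
    Cmod (g s - g t) < eps.
Proof.
  intros He.
  assert (HC : forall t, exists d, 0 < d /\ (0 <= t <= 1 ->
    forall s, 0 <= s <= 1 -> Rabs (s - t) < d -> Cmod (g s - g t) < eps / 2)).
  { intros t. destruct (classic (0 <= t <= 1)) as [Ht|Ht].
    - destruct (g_cont t Ht (eps / 2)) as (d & H1 & H2); [lra|].
      exists d. now split.
    - exists 1. split; [lra|easy]. }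
  destruct (choice _ HC) as [d Hd].
  destruct (lebesgue_01 (fun t => d t / 2)) as (rho & H1 & H2).
  { intros t _. destruct (Hd t); lra. }
  exists rho. split; [easy|]. intros s t Hs Ht Hst.
  destruct (H2 t Ht) as (u & Hu & H3 & H4). destruct (Hd u) as [H5 H6].
  eapply Rle_lt_trans; [apply (Cmod_minus_triangle (g u))|].
  assert (H7 : Cmod (g s - g u) < eps / 2).
  { apply H6; [easy..|]. replace (s - u) with ((s - t) + (t - u)) by ring.
    eapply Rle_lt_trans; [apply Rabs_triang|]. lra. }
  assert (H8 : Cmod (g t - g u) < eps / 2).
  { apply H6; [easy..|]. lra. }
  rewrite Cmod_minus_sym in H8. lra.
Qed.

(** The endpoints carry the weights 1 and -1, so that [qsum] over [bdry] is the increment of a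
    primitive. The definition is transparent, since later proofs unfold [nodes], [img] and
    [bdry]. *)
Definition curve : chain.
Proof.
  unshelve refine {|
    nodes := fun d N => exists l, fine d 0 l 1 /\ N = knots g 0 l;
    img := fun z => exists t, 0 <= t <= 1 /\ z = g t;
    bdry := (RtoC 1, g 1) :: (RtoC (-1), g 0) :: nil;
    len := v 1 - v 0 |}.
  - intros d Hd. destruct (fine_ex d 0 1) as [l Hl]; [easy|lra|].
    now exists (knots g 0 l), l.
  - intros d d' N Hd (l & Hl & ->). exists l. split; [|easy].
    now apply fine_mono with d.
  - intros d N w z (l & Hl & ->) HI. apply (knots_In d 0 l 1 w); (lra || easy).
  - intros d N (l & Hl & ->).
    apply qvar_knots with d; [|lra|lra|easy].
    intros x y xi Hx Hy Hxi Hd. rewrite Rmult_1_r. apply g_var; lra.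
  - intros rho Hrho. destruct (curve_unif_cont rho Hrho) as (d & Hd & H).
    exists (d / 2). split; [lra|].
    intros N N' (l & Hl & ->) (l' & Hl' & ->) V h eps Hh.
    apply (knots_osc (d / 2) l l' h eps); [|easy..].
    intros s t Hs Ht Hst. apply Hh; [now exists t|now exists s|].
    apply H; [easy..|lra].
  - intros rho Hrho. destruct (curve_unif_cont rho Hrho) as (d & Hd & H).
    exists d. split; [easy|].
    intros N (l & Hl & ->) V P p eps He HP.
    replace (qsum _ P) with (minus (P (g 1)) (P (g 0)))
      by (simpl; lin_coefs; ring).
    rewrite norm_minus_sym.
    replace (eps * (v 1 - v 0)) with (eps * v 1 - eps * v 0) by ring.
    apply (knots_compare d 0 l 1 p (fun t => P (g t)) (fun t => eps * v t));
      [|lra|lra|easy].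
    intros x y xi Hx Hy Hxi Hxy. rewrite (norm_minus_sym (V := V)).
    eapply Rle_trans; [apply HP|].
    + exists x; split; [lra|easy].
    + exists y; split; [lra|easy].
    + exists xi; split; [lra|easy].
    + apply H; try lra. apply Rabs_def1; lra.
    + apply H; try lra. apply Rabs_def1; lra.
    + apply H; try lra. apply Rabs_def1; lra.
    + rewrite <- Rmult_minus_distr_l. apply Rmult_le_compat_l; [easy|].
      apply g_var; lra.
  - intros d Hd.
    assert (HC : forall t, exists e, 0 < e /\ (0 <= t <= 1 ->
      forall s, 0 <= s <= 1 -> Rabs (s - t) < e -> Cmod (g s - g t) < d (g t))).
    { intros t. destruct (classic (0 <= t <= 1)) as [Ht|Ht].
      - destruct (g_cont t Ht (d (g t))) as (e & H1 & H2).
        { apply Hd. now exists t. }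
        exists e. now split.
      - exists 1. split; [lra|easy]. }
    destruct (choice _ HC) as [e He].
    destruct (lebesgue_01 (fun t => Rmin (e t) (d (g t)))) as (rho & H1 & H2).
    { intros t Ht. apply Rmin_glb_lt; [apply He|]. apply Hd. now exists t. }
    exists rho. split; [easy|]. intros w (s & Hs & ->).
    destruct (H2 s Hs) as (t & Ht & H3 & H4).
    exists (g t). split; [now exists t|]. split.
    + apply He; [easy..|]. eapply Rlt_le_trans; [apply H3|apply Rmin_l].
    + eapply Rle_trans; [apply H4|apply Rmin_r].
Defined.
End Curves.

(** * Operations on chains *)

Lemma near_constant_mono {V : NormedModule C_AbsRing} (I J : C -> Prop)
    rho rho' eps (h : C -> V) :
  (forall z, J z -> I z) -> rho' <= rho ->
  near_constant I rho eps h -> near_constant J rho' eps h.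
Proof. intros HI Hr H w w' Hw Hw' Hd. apply H; auto; lra. Qed.

Lemma near_derivative_mono {V : NormedModule C_AbsRing} (I J : C -> Prop)
    rho rho' eps (P p : C -> V) :
  (forall z, J z -> I z) -> rho' <= rho ->
  near_derivative I rho eps P p -> near_derivative J rho' eps P p.
Proof. intros HI Hr H a b z Ha Hb Hz H1 H2 H3. apply H; auto; lra. Qed.

(** A formal sum: the pieces need not join up. Joining is expressed afterwards by cancellation in
    [bdry]. *)
Definition chain_app (K L : chain) : chain.
Proof.
  unshelve refine {|
    nodes := fun d N => exists N1 N2,
      nodes K d N1 /\ nodes L d N2 /\ N = N1 ++ N2;
    img := fun z => img K z \/ img L z;
    bdry := bdry K ++ bdry L;
    len := len K + len L |}.
  - intros d Hd. destruct (nodes_ex K d Hd) as [N1 H1].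
    destruct (nodes_ex L d Hd) as [N2 H2]. now exists (N1 ++ N2), N1, N2.
  - intros d d' N Hd (N1 & N2 & H1 & H2 & ->). exists N1, N2.
    repeat split; eapply nodes_mono; eassumption.
  - intros d N w z (N1 & N2 & H1 & H2 & ->) HI.
    apply in_app_or in HI. destruct HI as [HI|HI].
    + left; eapply nodes_img; eassumption.
    + right; eapply nodes_img; eassumption.
  - intros d N (N1 & N2 & H1 & H2 & ->). rewrite qvar_app.
    apply Rplus_le_compat; eapply nodes_len; eassumption.
  - intros rho Hrho. destruct (nodes_osc K rho Hrho) as (d1 & Hd1 & H1).
    destruct (nodes_osc L rho Hrho) as (d2 & Hd2 & H2).
    exists (Rmin d1 d2). split; [now apply Rmin_glb_lt|].
    intros N N' (N1 & N2 & A1 & A2 & ->) (N1' & N2' & B1 & B2 & ->) V h eps Hh.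
    rewrite !qsum_app.
    replace (minus _ _) with (plus (minus (qsum N1 h) (qsum N1' h))
      (minus (qsum N2 h) (qsum N2' h))) by lin_ring.
    eapply Rle_trans; [apply norm_plus_le|]. rewrite Rmult_plus_distr_l.
    apply Rplus_le_compat.
    + apply H1; try (eapply nodes_mono; [apply Rmin_l|eassumption]).
      eapply near_constant_mono; [|apply Rle_refl|exact Hh]. now left.
    + apply H2; try (eapply nodes_mono; [apply Rmin_r|eassumption]).
      eapply near_constant_mono; [|apply Rle_refl|exact Hh]. now right.
  - intros rho Hrho. destruct (nodes_ftc K rho Hrho) as (d1 & Hd1 & H1).
    destruct (nodes_ftc L rho Hrho) as (d2 & Hd2 & H2).
    exists (Rmin d1 d2). split; [now apply Rmin_glb_lt|].
    intros N (N1 & N2 & A1 & A2 & ->) V P p eps He Hp.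
    rewrite !qsum_app.
    replace (minus _ _) with (plus (minus (qsum (bdry K) P) (qsum N1 p))
      (minus (qsum (bdry L) P) (qsum N2 p))) by lin_ring.
    eapply Rle_trans; [apply norm_plus_le|]. rewrite Rmult_plus_distr_l.
    apply Rplus_le_compat.
    + apply H1; [eapply nodes_mono; [apply Rmin_l|eassumption]|easy|].
      eapply near_derivative_mono; [|apply Rle_refl|exact Hp]. now left.
    + apply H2; [eapply nodes_mono; [apply Rmin_r|eassumption]|easy|].
      eapply near_derivative_mono; [|apply Rle_refl|exact Hp]. now right.
  - intros d Hd.
    destruct (img_lebesgue K d) as (r1 & Hr1 & H1); [auto|].
    destruct (img_lebesgue L d) as (r2 & Hr2 & H2); [auto|].
    exists (Rmin r1 r2). split; [now apply Rmin_glb_lt|].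
    intros w [Hw|Hw].
    + destruct (H1 w Hw) as (z & A1 & A2 & A3). exists z.
      repeat split; [now left|easy|]. eapply Rle_trans; [apply Rmin_l|easy].
    + destruct (H2 w Hw) as (z & A1 & A2 & A3). exists z.
      repeat split; [now right|easy|]. eapply Rle_trans; [apply Rmin_r|easy].
Defined.

Definition dilate (c : C) (s : R) (z : C) : C := (c + s * (z - c))%C.

Lemma dilate_minus c s z w : (dilate c s z - dilate c s w = s * (z - w))%C.
Proof. unfold dilate. ring. Qed.

Lemma Cmod_dilate c s z w : 0 <= s ->
  Cmod (dilate c s z - dilate c s w) = s * Cmod (z - w).
Proof.
  intros Hs. rewrite dilate_minus, Cmod_mult, Cmod_R, Rabs_pos_eq; easy.
Qed.

Definition dilate_nodes (c : C) (s : R) (N : list (C * C)) : list (C * C) :=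
  map (fun p => ((s * fst p)%C, dilate c s (snd p))) N.

Lemma qsum_dilate {V : NormedModule C_AbsRing} c s N (h : C -> V) :
  qsum (dilate_nodes c s N) h
  = qsum N (fun z => scal (RtoC s) (h (dilate c s z))).
Proof.
  induction N as [|p N IH]; simpl; [easy|]. rewrite IH. lin_ring.
Qed.

Lemma qvar_dilate c s N (k : C -> R) : 0 <= s ->
  qvar (dilate_nodes c s N) k = s * qvar N (fun z => k (dilate c s z)).
Proof.
  intros Hs. induction N as [|p N IH]; simpl; [lra|]. rewrite IH.
  rewrite Cmod_mult, Cmod_R, Rabs_pos_eq by easy. ring.
Qed.

Definition chain_dilate (c : C) (s : R) (Hs : 0 < s) (K : chain) : chain.
Proof.
  unshelve refine {|
    nodes := fun d N => exists N', nodes K d N' /\ N = dilate_nodes c s N';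
    img := fun z => exists w, img K w /\ z = dilate c s w;
    bdry := map (fun p => (fst p, dilate c s (snd p))) (bdry K);
    len := s * len K |}.
  - intros d Hd. destruct (nodes_ex K d Hd) as [N H].
    now exists (dilate_nodes c s N), N.
  - intros d d' N Hd (N' & H & ->). exists N'. split; [|easy].
    eapply nodes_mono; eassumption.
  - intros d N w z (N' & H & ->) HI. unfold dilate_nodes in HI.
    apply in_map_iff in HI. destruct HI as ([w' z'] & H1 & H2).
    injection H1 as <- <-. exists z'. split; [|easy].
    eapply nodes_img; eassumption.
  - intros d N (N' & H & ->). rewrite qvar_dilate by lra.
    apply Rmult_le_compat_l; [lra|]. eapply nodes_len; eassumption.
  - intros rho Hrho. destruct (nodes_osc K (rho / s)) as (d & Hd & H).
    { apply Rdiv_lt_0_compat; lra. }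
    exists d. split; [easy|].
    intros N N' (N1 & H1 & ->) (N1' & H1' & ->) V h eps Hh.
    rewrite !qsum_dilate.
    replace (eps * (s * len K)) with ((s * eps) * len K) by ring.
    apply H; [easy..|].
    intros w w' Hw Hw' Hd'.
    replace (minus _ _) with
      (scal (RtoC s) (minus (h (dilate c s w')) (h (dilate c s w))))
      by (simpl; lin_ring).
    rewrite norm_scal_C, Cmod_R, Rabs_pos_eq by lra.
    apply Rmult_le_compat_l; [lra|]. apply Hh; [now exists w|now exists w'|].
    rewrite Cmod_dilate by lra. apply Rmult_lt_compat_l with (r := s) in Hd'; [|lra].
    replace (s * (rho / s)) with rho in Hd' by (field; lra). easy.
  - intros rho Hrho. destruct (nodes_ftc K (rho / s)) as (d & Hd & H).
    { apply Rdiv_lt_0_compat; lra. }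
    exists d. split; [easy|].
    intros N (N1 & H1 & ->) V P p eps He Hp.
    rewrite !qsum_dilate.
    replace (qsum _ P) with (qsum (bdry K) (fun z => P (dilate c s z))).
    2:{ generalize (bdry K). intros B. induction B as [|q B IH]; simpl; [easy|].
        now rewrite IH. }
    replace (eps * (s * len K)) with ((s * eps) * len K) by ring.
    apply H; [easy|apply Rmult_le_pos; lra|].
    assert (Hsc : forall x y, Cmod (y - x) < rho / s ->
      Cmod (dilate c s y - dilate c s x) < rho).
    { intros x y Hxy. rewrite Cmod_dilate by lra.
      apply Rmult_lt_compat_l with (r := s) in Hxy; [|lra].
      replace (s * (rho / s)) with rho in Hxy by (field; lra). easy. }
    intros a b z Ha Hb Hz Hab Hza Hzb.
    replace (scal (b - a)%C _) with
      (scal (dilate c s b - dilate c s a)%C (p (dilate c s z))).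
    2:{ rewrite dilate_minus. lin_ring. }
    eapply Rle_trans.
    + apply Hp; first [now apply Hsc | now exists a | now exists b | now exists z].
    + rewrite Cmod_dilate by lra. lra.
  - intros d Hd.
    destruct (img_lebesgue K (fun z => d (dilate c s z) / s)) as (r & Hr & H).
    { intros z Hz. apply Rdiv_lt_0_compat; [|easy]. apply Hd. now exists z. }
    exists (s * r). split; [now apply Rmult_lt_0_compat|].
    intros w (w' & Hw & ->). destruct (H w' Hw) as (z & H1 & H2 & H3).
    exists (dilate c s z). split; [now exists z|]. split.
    + rewrite Cmod_dilate by lra.
      apply Rmult_lt_compat_l with (r := s) in H2; [|lra].
      replace (s * (d (dilate c s z) / s)) with (d (dilate c s z)) in H2
        by (field; lra). easy.
    + apply Rmult_le_compat_l with (r := s) in H3; [|lra].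
      replace (s * (d (dilate c s z) / s)) with (d (dilate c s z)) in H3
        by (field; lra). easy.
Defined.

(** * Integrals along chains *)

Definition cint {V : NormedModule C_AbsRing} (K : chain) (h : C -> V) (v : V) :
    Prop :=
  forall eps, 0 < eps -> exists d, 0 < d /\
    forall N, nodes K d N -> norm (minus (qsum N h) v) <= eps.

Definition cont_on {V : NormedModule C_AbsRing} (I : C -> Prop) (h : C -> V) :
    Prop :=
  forall w, I w -> forall eps, 0 < eps -> exists d, 0 < d /\
    forall w', I w' -> Cmod (w' - w) < d -> norm (minus (h w') (h w)) <= eps.

(** Strict differentiability, with the derivative read at a third point [w] as a tag requires. It
    includes continuity of [p] at [z], and compactness turns it into [near_derivative]. *)
Definition strict_deriv {V : NormedModule C_AbsRing} (P p : C -> V) (z : C) :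
    Prop :=
  forall eps, 0 < eps -> exists d, 0 < d /\
    forall a b w, Cmod (a - z) < d -> Cmod (b - z) < d -> Cmod (w - z) < d ->
      norm (minus (minus (P b) (P a)) (scal (b - a)%C (p w)))
        <= eps * Cmod (b - a).

(** The boundary vanishes as a formal sum of points; testing it against all functions into all
    spaces replaces a free abelian group. *)
Definition closed_chain (K : chain) : Prop :=
  forall (V : NormedModule C_AbsRing) (P : C -> V), qsum (bdry K) P = zero.

Lemma len_ge_0 (K : chain) : 0 <= len K.
Proof.
  destruct (nodes_ex K 1 Rlt_0_1) as [N HN].
  eapply Rle_trans; [|eapply nodes_len; exact HN].
  clear HN. induction N as [|p N IH]; simpl; [lra|].
  assert (H := Cmod_ge_0 (fst p)). lra.
Qed.

Section ChainIntegrals.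
Context {V : NormedModule C_AbsRing}.
Implicit Types (K L : chain) (h k : C -> V) (v : V).

Lemma cint_unique K h v (w : V) : cint K h v -> cint K h w -> v = w.
Proof.
  intros Hv Hw. apply norm_minus_small. intros eps He.
  destruct (Hv (eps / 2)) as (d1 & Hd1 & H1); [lra|].
  destruct (Hw (eps / 2)) as (d2 & Hd2 & H2); [lra|].
  destruct (nodes_ex K (Rmin d1 d2)) as [N HN]; [now apply Rmin_glb_lt|].
  assert (A1 := H1 N (nodes_mono K _ _ N (Rmin_l _ _) HN)).
  assert (A2 := H2 N (nodes_mono K _ _ N (Rmin_r _ _) HN)).
  eapply Rle_trans; [apply (norm_minus_triangle (qsum N h))|].
  rewrite (norm_minus_sym v). lra.
Qed.

Lemma cint_ext K h k v : (forall z, img K z -> h z = k z) ->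
  cint K h v -> cint K k v.
Proof.
  intros Hhk H eps He. destruct (H eps He) as (d & Hd & H1).
  exists d. split; [easy|]. intros N HN.
  rewrite <- (qsum_ext N h k); [now apply H1|].
  intros a z Hz. apply Hhk. eapply nodes_img; eassumption.
Qed.

Lemma cint_minus K h k v (w : V) : cint K h v -> cint K k w ->
  cint K (fun z => minus (h z) (k z)) (minus v w).
Proof.
  intros Hv Hw eps He.
  destruct (Hv (eps / 2)) as (d1 & Hd1 & H1); [lra|].
  destruct (Hw (eps / 2)) as (d2 & Hd2 & H2); [lra|].
  exists (Rmin d1 d2). split; [now apply Rmin_glb_lt|]. intros N HN.
  assert (A1 := H1 N (nodes_mono K _ _ N (Rmin_l _ _) HN)).
  assert (A2 := H2 N (nodes_mono K _ _ N (Rmin_r _ _) HN)).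
  rewrite qsum_minus.
  replace (minus _ _) with
    (minus (minus (qsum N h) v) (minus (qsum N k) w)) by lin_ring.
  eapply Rle_trans; [apply norm_minus_le|]. lra.
Qed.

Lemma cint_scal K h v (c : C) : cint K h v ->
  cint K (fun z => scal c (h z)) (scal c v).
Proof.
  intros Hv eps He. assert (Hc := Cmod_ge_0 c).
  destruct (Hv (eps / (Cmod c + 1))) as (d & Hd & H).
  { apply Rdiv_lt_0_compat; lra. }
  exists d. split; [easy|]. intros N HN. rewrite qsum_scal.
  replace (minus _ _) with (scal c (minus (qsum N h) v)) by lin_ring.
  rewrite norm_scal_C. specialize (H N HN).
  apply Rle_trans with (Cmod c * (eps / (Cmod c + 1))).
  - now apply Rmult_le_compat_l.
  - unfold Rdiv. rewrite (Rmult_comm eps), <- Rmult_assoc.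
    rewrite <- (Rmult_1_l eps) at 2. apply Rmult_le_compat_r; [lra|].
    apply Rmult_le_reg_r with (Cmod c + 1); [lra|].
    rewrite Rmult_assoc, Rinv_l; lra.
Qed.

Lemma cint_plus K h k v (w : V) : cint K h v -> cint K k w ->
  cint K (fun z => plus (h z) (k z)) (plus v w).
Proof.
  intros Hv Hw. apply cint_ext with
    (fun z => minus (h z) (scal (RtoC (-1)) (k z))).
  { intros z _. lin_ring. }
  replace (plus v w) with (minus v (scal (RtoC (-1)) w)) by lin_ring.
  apply cint_minus; [easy|]. now apply cint_scal.
Qed.

Lemma cint_zero K : cint K (fun _ => @zero V) zero.
Proof.
  intros eps He. exists 1. split; [lra|]. intros N _.
  replace (qsum N _) with (@zero V).
  - replace (minus _ _) with (@zero V) by lin_ring. rewrite norm_zero; lra.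
  - induction N as [|p N IH]; simpl; [easy|]. rewrite <- IH. lin_ring.
Qed.

(** The substitute for Fubini's theorem: one of the two integrals is a finite sum. *)
Lemma cint_qsum K (M : list (C * C)) (h : C -> C -> V) (v : C -> V) :
  (forall a b : C, In (a, b) M -> cint K (h b) (v b)) ->
  cint K (fun z => qsum M (fun b : C => h b z)) (qsum M v).
Proof.
  induction M as [|[a b] M IH]; simpl; intros H; [apply cint_zero|].
  apply cint_plus.
  - apply cint_scal. apply (H a). now left.
  - apply IH. intros; eapply H; right; eassumption.
Qed.

Lemma cint_norm K h v B : 0 <= B -> (forall z, img K z -> norm (h z) <= B) ->
  cint K h v -> norm v <= B * len K.
Proof.
  intros HB Hh Hv. apply le_epsilon. intros eps He.
  destruct (Hv eps He) as (d & Hd & H). destruct (nodes_ex K d Hd) as [N HN].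
  specialize (H N HN). rewrite norm_minus_sym in H.
  eapply Rle_trans; [apply (norm_le_minus v (qsum N h))|].
  apply Rplus_le_compat; [|easy].
  eapply Rle_trans; [apply norm_qsum|].
  apply Rle_trans with (qvar N (fun _ => B)).
  - apply qvar_le. intros w z Hz. apply Hh. eapply nodes_img; eassumption.
  - rewrite qvar_const. apply Rmult_le_compat_l; [easy|].
    eapply nodes_len; eassumption.
Qed.

Lemma cont_on_unif K h : cont_on (img K) h -> forall eps, 0 < eps ->
  exists rho, 0 < rho /\ near_constant (img K) rho eps h.
Proof.
  intros Hh eps He.
  assert (HC : forall w, exists d, 0 < d /\ (img K w ->
    forall w', img K w' -> Cmod (w' - w) < d ->
      norm (minus (h w') (h w)) <= eps / 2)).
  { intros w. destruct (classic (img K w)) as [Hw|Hw].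
    - destruct (Hh w Hw (eps / 2)) as (d & H1 & H2); [lra|]. exists d. now split.
    - exists 1. split; [lra|easy]. }
  destruct (choice _ HC) as [d Hd].
  destruct (img_lebesgue K (fun w => d w / 2)) as (rho & Hrho & H).
  { intros w _. destruct (Hd w); lra. }
  exists rho. split; [easy|]. intros w w' Hw Hw' Hww.
  destruct (H w Hw) as (z & Hz & H1 & H2). destruct (Hd z) as [H3 H4].
  eapply Rle_trans; [apply (norm_minus_triangle (h z))|].
  assert (A1 : norm (minus (h w') (h z)) <= eps / 2).
  { apply H4; [easy..|].
    eapply Rle_lt_trans; [apply (Cmod_minus_triangle w)|]. lra. }
  assert (A2 : norm (minus (h w) (h z)) <= eps / 2).
  { apply H4; [easy..|]. lra. }
  rewrite (norm_minus_sym (h z)). lra.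
Qed.

Lemma strict_deriv_unif K (P p : C -> V) :
  (forall z, img K z -> strict_deriv P p z) -> forall eps, 0 < eps ->
  exists rho, 0 < rho /\ near_derivative (img K) rho eps P p.
Proof.
  intros HP eps He.
  assert (HC : forall z, exists d, 0 < d /\ (img K z ->
    forall a b w, Cmod (a - z) < d -> Cmod (b - z) < d -> Cmod (w - z) < d ->
      norm (minus (minus (P b) (P a)) (scal (b - a)%C (p w)))
        <= eps * Cmod (b - a))).
  { intros z. destruct (classic (img K z)) as [Hz|Hz].
    - destruct (HP z Hz eps He) as (d & H1 & H2). exists d. now split.
    - exists 1. split; [lra|easy]. }
  destruct (choice _ HC) as [d Hd].
  destruct (img_lebesgue K (fun w => d w / 2)) as (rho & Hrho & H).
  { intros w _. destruct (Hd w); lra. }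
  exists rho. split; [easy|]. intros a b w Ha Hb Hw H1 H2 H3.
  destruct (H a Ha) as (z & Hz & H4 & H5). destruct (Hd z) as [H6 H7].
  apply H7; [easy|lra| |].
  - eapply Rle_lt_trans; [apply (Cmod_minus_triangle a)|]. lra.
  - eapply Rle_lt_trans; [apply (Cmod_minus_triangle a)|]. lra.
Qed.

(** Division by [A + 1] instead of [A] admits [A = 0]. *)
Lemma le_scaled_eps (A eps : R) : 0 <= A -> 0 < eps ->
  0 < eps / (A + 1) /\ eps / (A + 1) * A <= eps.
Proof.
  intros HA He. split; [apply Rdiv_lt_0_compat; lra|].
  apply Rle_trans with (eps / (A + 1) * (A + 1)).
  - apply Rmult_le_compat_l; [|lra]. left. apply Rdiv_lt_0_compat; lra.
  - right. field. lra.
Qed.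

Lemma cint_ftc K (P p : C -> V) :
  (forall z, img K z -> strict_deriv P p z) -> cint K p (qsum (bdry K) P).
Proof.
  intros HP eps He. destruct (le_scaled_eps (len K) eps) as [E1 E2];
    [apply len_ge_0|easy|].
  destruct (strict_deriv_unif K P p HP _ E1) as (rho & Hrho & H).
  destruct (nodes_ftc K rho Hrho) as (d & Hd & H1).
  exists d. split; [easy|]. intros N HN. rewrite norm_minus_sym.
  eapply Rle_trans; [|exact E2]. apply H1; [easy|lra|easy].
Qed.

Lemma cint_closed K (P p : C -> V) : closed_chain K ->
  (forall z, img K z -> strict_deriv P p z) -> cint K p zero.
Proof. intros HK HP. rewrite <- (HK V P). now apply cint_ftc. Qed.

Lemma cint_app K L h v (w : V) : cint K h v -> cint L h w ->
  cint (chain_app K L) h (plus v w).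
Proof.
  intros Hv Hw eps He.
  destruct (Hv (eps / 2)) as (d1 & Hd1 & H1); [lra|].
  destruct (Hw (eps / 2)) as (d2 & Hd2 & H2); [lra|].
  exists (Rmin d1 d2). split; [now apply Rmin_glb_lt|].
  intros N (N1 & N2 & HN1 & HN2 & ->).
  assert (A1 := H1 N1 (nodes_mono K _ _ N1 (Rmin_l _ _) HN1)).
  assert (A2 := H2 N2 (nodes_mono L _ _ N2 (Rmin_r _ _) HN2)).
  rewrite qsum_app.
  replace (minus _ _) with
    (plus (minus (qsum N1 h) v) (minus (qsum N2 h) w)) by lin_ring.
  eapply Rle_trans; [apply norm_plus_le|]. lra.
Qed.

Lemma cint_dilate c s Hs K h v :
  cint K (fun z => scal (RtoC s) (h (dilate c s z))) v ->
  cint (chain_dilate c s Hs K) h v.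
Proof.
  intros Hv eps He. destruct (Hv eps He) as (d & Hd & H).
  exists d. split; [easy|]. intros N (N' & HN' & ->). rewrite qsum_dilate.
  now apply H.
Qed.

(** The Cauchy criterion with the second subdivision sent to the limit. The mesh [d] precedes the
    integrand, which makes the error uniform over families. *)
Lemma cint_uniform K rho : 0 < rho -> exists d, 0 < d /\
  forall N, nodes K d N -> forall h v eps, near_constant (img K) rho eps h ->
    cint K h v -> norm (minus (qsum N h) v) <= eps * len K.
Proof.
  intros Hrho. destruct (nodes_osc K rho Hrho) as (d & Hd & H).
  exists d. split; [easy|]. intros N HN h v eps Hh Hv.
  apply le_epsilon. intros e He. destruct (Hv e He) as (d' & Hd' & H').
  destruct (nodes_ex K (Rmin d d')) as [N' HN']; [now apply Rmin_glb_lt|].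
  assert (A1 := H N N' HN (nodes_mono K _ _ N' (Rmin_l _ _) HN') V h eps Hh).
  assert (A2 := H' N' (nodes_mono K _ _ N' (Rmin_r _ _) HN')).
  eapply Rle_trans; [apply (norm_minus_triangle (qsum N' h))|]. lra.
Qed.

End ChainIntegrals.

Lemma closed_chain_dilate c s Hs K : closed_chain K ->
  closed_chain (chain_dilate c s Hs K).
Proof.
  intros H V P. simpl. rewrite <- (H V (fun z => P (dilate c s z))).
  generalize (bdry K). intros B. induction B as [|q B IH]; simpl; [easy|].
  now rewrite IH.
Qed.

Lemma inv_S_small (d : R) : 0 < d -> exists N, forall n, (N <= n)%nat -> / INR (S n) <= d.
Proof.
  intros Hd. destruct (nfloor_ex (/ d)) as [N [_ HN]].
  { left. now apply Rinv_0_lt_compat. }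
  exists N. intros n Hn. rewrite <- (Rinv_inv d).
  apply Rinv_le_contravar; [now apply Rinv_0_lt_compat|].
  rewrite S_INR. apply le_INR in Hn. lra.
Qed.

Lemma cint_ex {V : NormedModule C_AbsRing} K (h : C -> V) :
  norm_complete V -> cont_on (img K) h -> exists v, cint K h v.
Proof.
  intros HV Hh.
  destruct (choice (fun n N => nodes K (/ INR (S n)) N)) as [N HN].
  { intros n. apply nodes_ex. apply Rinv_0_lt_compat, lt_0_INR. lia. }
  assert (HC : forall eps, 0 < eps -> exists d, 0 < d /\ forall M M',
    nodes K d M -> nodes K d M' -> norm (minus (qsum M h) (qsum M' h)) <= eps).
  { intros eps He. destruct (le_scaled_eps (len K) eps) as [E1 E2];
      [apply len_ge_0|easy|].
    destruct (cont_on_unif K h Hh _ E1) as (rho & Hrho & H).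
    destruct (nodes_osc K rho Hrho) as (d & Hd & H1).
    exists d. split; [easy|]. intros M M' HM HM'.
    eapply Rle_trans; [apply (H1 M M' HM HM' V h _ H)|exact E2]. }
  destruct (HV (fun n => qsum (N n) h)) as [v Hv].
  - intros eps He. destruct (HC eps He) as (d & Hd & H).
    destruct (inv_S_small d Hd) as [n0 Hn0]. exists n0. intros n m Hn Hm.
    apply H; (eapply nodes_mono; [apply Hn0|apply HN]); easy.
  - exists v. intros eps He. destruct (HC (eps / 2)) as (d & Hd & H); [lra|].
    exists d. split; [easy|]. intros M HM.
    destruct (Hv (eps / 2)) as [n0 Hn0]; [lra|].
    destruct (inv_S_small d Hd) as [n1 Hn1].
    set (n := Nat.max n0 n1).
    eapply Rle_trans; [apply (norm_minus_triangle (qsum (N n) h))|].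
    assert (A1 : norm (minus (qsum M h) (qsum (N n) h)) <= eps / 2).
    { apply H; [easy|]. eapply nodes_mono; [|apply HN]. apply Hn1. unfold n; lia. }
    assert (A2 : norm (minus (qsum (N n) h) v) <= eps / 2).
    { apply Hn0. unfold n; lia. }
    lra.
Qed.

(** * Winding numbers *)

(** Over [m] equal steps the increments add up to at most [m * (B / m ^ 2) = B / m], which is
    arbitrarily small. *)
Lemma constant_of_quadratic {V : NormedModule C_AbsRing} (a : R -> V) B :
  (forall s t, 0 <= s <= 1 -> 0 <= t <= 1 ->
     norm (minus (a s) (a t)) <= B * (s - t) ^ 2) -> a 0 = a 1.
Proof.
  intros H. apply norm_minus_small. intros eps He.
  assert (HB : 0 <= B).
  { assert (H1 := H 1 0 ltac:(lra) ltac:(lra)).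
    replace (B * (1 - 0) ^ 2) with B in H1 by ring.
    assert (H2 := norm_ge_0 (minus (a 1) (a 0))). lra. }
  destruct (nfloor_ex (B / eps)) as [n [_ Hn]]; [now apply Rdiv_le_0_compat|].
  set (m := S n). assert (Hm : 0 < INR m) by (apply lt_0_INR; unfold m; lia).
  assert (Hk : forall k, (k <= m)%nat ->
    norm (minus (a 0) (a (INR k / INR m))) <= INR k * (B / INR m ^ 2)).
  { induction k as [|k IH]; intros Hkm.
    - replace (INR 0 / INR m) with 0 by (change (INR 0) with 0; unfold Rdiv; ring).
      replace (minus _ _) with (@zero V) by lin_ring. rewrite norm_zero. change (INR 0) with 0; lra.
    - eapply Rle_trans; [apply (norm_minus_triangle (a (INR k / INR m)))|].
      rewrite S_INR, Rmult_plus_distr_r, Rmult_1_l.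
      assert (Hb : forall j, (j <= m)%nat -> 0 <= INR j / INR m <= 1).
      { intros j Hj. assert (A := pos_INR j). apply le_INR in Hj. split.
        - now apply Rdiv_le_0_compat.
        - apply Rmult_le_reg_r with (INR m); [easy|].
          unfold Rdiv. rewrite Rmult_assoc, Rinv_l; lra. }
      apply Rplus_le_compat; [apply IH; lia|].
      eapply Rle_trans; [apply H|].
      + apply Hb; lia.
      + rewrite <- S_INR. apply Hb; lia.
      + right. field. lra. }
  specialize (Hk m (le_n _)). replace (INR m / INR m) with 1 in Hk by (field; lra).
  eapply Rle_trans; [exact Hk|].
  replace (INR m * (B / INR m ^ 2)) with (B / INR m) by (field; lra).
  apply Rmult_le_reg_r with (INR m); [easy|].
  unfold Rdiv. rewrite Rmult_assoc, Rinv_l by lra.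
  apply Rmult_le_reg_r with (/ eps); [now apply Rinv_0_lt_compat|].
  replace (eps * INR m * / eps) with (INR m) by (field; lra).
  unfold m. rewrite S_INR. unfold Rdiv in Hn. lra.
Qed.

(** Resolvents satisfy the hypothesis, and so does multiplication by
    [/ (z - w)]. *)
Lemma strict_deriv_pseudo_resolvent {X : NormedModule C_AbsRing}
    (r : C -> X -> X) (z : C) (d M : R) (x : X) :
  0 < d -> 0 <= M ->
  (forall a b y, Cmod (a - z) < d -> Cmod (b - z) < d ->
     minus (r a y) (r b y) = scal (b - a)%C (r a (r b y))) ->
  (forall a y y', r a (minus y y') = minus (r a y) (r a y')) ->
  (forall a y, Cmod (a - z) < d -> norm (r a y) <= M * norm y) ->
  strict_deriv (fun a => r a x) (fun a => opp (r a (r a x))) z.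
Proof.
  intros Hd HM Hr Hlin Hb eps He.
  set (Q := 4 * M ^ 3 * norm x).
  assert (HQ : 0 <= Q).
  { unfold Q. apply Rmult_le_pos; [|apply norm_ge_0].
    assert (H := pow_le M 3 HM). lra. }
  destruct (le_scaled_eps Q eps HQ He) as [E1 E2].
  exists (Rmin d (eps / (Q + 1))). split; [now apply Rmin_glb_lt|].
  intros a b w Ha Hb' Hw.
  assert (Ha1 := Rlt_le_trans _ _ _ Ha (Rmin_l _ _)).
  assert (Hb1 := Rlt_le_trans _ _ _ Hb' (Rmin_l _ _)).
  assert (Hw1 := Rlt_le_trans _ _ _ Hw (Rmin_l _ _)).
  assert (Ha2 := Rlt_le_trans _ _ _ Ha (Rmin_r _ _)).
  assert (Hb2 := Rlt_le_trans _ _ _ Hb' (Rmin_r _ _)).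
  assert (Hw2 := Rlt_le_trans _ _ _ Hw (Rmin_r _ _)).
  set (e := eps / (Q + 1)) in *.
  (* After [b - a] is factored out there remains [r w (r w x) - r b (r a x)]; it is split at
     [r w (r a x)], and each half is of third order in [r] with a small scalar in front. This gives
     the factor 4 in [Q]. *)
  replace (minus (minus (r b x) (r a x)) (scal (b - a)%C (opp (r w (r w x)))))
    with (scal (b - a)%C (plus (r w (scal (a - w)%C (r w (r a x))))
            (scal (b - w)%C (r w (r b (r a x)))))).
  2:{ rewrite <- (Hr w a x) by easy. rewrite <- (Hr w b (r a x)) by easy.
      rewrite (Hr b a x) by easy. rewrite Hlin. lin_ring. }
  rewrite norm_scal_C, Rmult_comm. apply Rmult_le_compat_r; [apply Cmod_ge_0|].
  assert (H3 : forall u, Cmod (u - z) < d -> Cmod (u - z) < e ->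
    Cmod (u - w) <= 2 * e).
  { intros u _ Hu. eapply Rle_trans; [apply (Cmod_minus_triangle z)|].
    rewrite (Cmod_minus_sym z). lra. }
  assert (Hx := norm_ge_0 x).
  assert (N1 : norm (r a x) <= M * norm x) by now apply Hb.
  assert (N2 : norm (r w (r a x)) <= M * (M * norm x)).
  { eapply Rle_trans; [now apply Hb|]. now apply Rmult_le_compat_l. }
  assert (N3 : norm (r b (r a x)) <= M * (M * norm x)).
  { eapply Rle_trans; [now apply Hb|]. now apply Rmult_le_compat_l. }
  assert (N4 : norm (r w (r b (r a x))) <= M * (M * (M * norm x))).
  { eapply Rle_trans; [now apply Hb|]. now apply Rmult_le_compat_l. }
  eapply Rle_trans; [apply norm_plus_le|].
  assert (S1 : norm (r w (scal (a - w)%C (r w (r a x))))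
    <= M * (2 * e * (M * (M * norm x)))).
  { eapply Rle_trans; [now apply Hb|]. apply Rmult_le_compat_l; [easy|].
    rewrite norm_scal_C. apply Rmult_le_compat; try easy.
    - apply Cmod_ge_0.
    - apply norm_ge_0.
    - now apply H3. }
  assert (S2 : norm (scal (b - w)%C (r w (r b (r a x))))
    <= 2 * e * (M * (M * (M * norm x)))).
  { rewrite norm_scal_C. apply Rmult_le_compat; try easy.
    - apply Cmod_ge_0.
    - apply norm_ge_0.
    - now apply H3. }
  eapply Rle_trans; [apply Rplus_le_compat; eassumption|].
  eapply Rle_trans; [|exact E2]. right. unfold Q. ring.
Qed.

Lemma Cmod_pos_neq (z : C) : 0 < Cmod z -> z <> 0.
Proof. intros H ->. rewrite Cmod_0 in H. lra. Qed.

Lemma strict_deriv_inv (w z : C) : z <> w ->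
  strict_deriv (V := C_NormedModule)
    (fun a => (/ (a - w))%C) (fun a => (- (/ (a - w) * / (a - w)))%C) z.
Proof.
  intros Hz.
  assert (Hzw : 0 < Cmod (z - w)).
  { apply Cmod_gt_0. intros H. apply Hz. replace z with ((z - w) + w)%C by ring.
    rewrite H. ring. }
  set (m := Cmod (z - w) / 2).
  assert (Hm : forall a, Cmod (a - z) < m -> m < Cmod (a - w)).
  { intros a Ha. unfold m in *. assert (H := Cmod_minus_triangle a z w).
    rewrite (Cmod_minus_sym z a) in H. lra. }
  assert (H := strict_deriv_pseudo_resolvent (X := C_NormedModule)
    (fun a y => (/ (a - w) * y)%C) z m (/ m) (RtoC 1)).
  assert (H' : strict_deriv (V := C_NormedModule)
    (fun a => (/ (a - w) * 1)%C) (fun a => (- (/ (a - w) * (/ (a - w) * 1)))%C) z).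
  { apply H.
    - unfold m; lra.
    - left. apply Rinv_0_lt_compat. unfold m; lra.
    - intros a b y Ha Hb. apply Hm in Ha. apply Hm in Hb.
      change ((/ (a - w) * y - / (b - w) * y)%C
        = ((b - a) * (/ (a - w) * (/ (b - w) * y)))%C).
      field. split; apply Cmod_pos_neq; unfold m in *; lra.
    - intros a y y'. change ((/ (a - w) * (y - y'))%C
        = (/ (a - w) * y - / (a - w) * y')%C). ring.
    - intros a y Ha. apply Hm in Ha.
      change (Cmod (/ (a - w) * y) <= / m * Cmod y).
      rewrite Cmod_mult, Cmod_inv by (apply Cmod_pos_neq; unfold m in *; lra).
      apply Rmult_le_compat_r; [apply Cmod_ge_0|].
      apply Rinv_le_contravar; unfold m in *; lra. }
  intros eps He. destruct (H' eps He) as (d & Hd & H1).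
  exists d. split; [easy|]. intros a b u Ha Hb Hu.
  specialize (H1 a b u Ha Hb Hu). rewrite !Cmult_1_r in H1. exact H1.
Qed.

Lemma strict_deriv_cont {V : NormedModule C_AbsRing} (P p : C -> V)
    (I : C -> Prop) :
  (forall z, I z -> strict_deriv P p z) -> cont_on I P.
Proof.
  intros H w Hw eps He. destruct (H w Hw 1 Rlt_0_1) as (d & Hd & H1).
  assert (Hp := norm_ge_0 (p w)).
  destruct (le_scaled_eps (1 + norm (p w)) eps) as [E1 E2]; [lra|easy|].
  exists (Rmin d (eps / (1 + norm (p w) + 1))). split; [now apply Rmin_glb_lt|].
  intros w' _ Hww.
  assert (A1 := Rlt_le_trans _ _ _ Hww (Rmin_l _ _)).
  assert (A2 := Rlt_le_trans _ _ _ Hww (Rmin_r _ _)).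
  assert (H0 : Cmod (w - w) < d).
  { replace (w - w)%C with (RtoC 0) by ring. now rewrite Cmod_0. }
  specialize (H1 w w' w H0 A1 H0).
  eapply Rle_trans; [apply (norm_le_minus _ (scal (w' - w)%C (p w)))|].
  rewrite norm_scal_C. eapply Rle_trans; [|exact E2].
  apply Rle_trans with (Cmod (w' - w) * (1 + norm (p w))); [lra|].
  apply Rmult_le_compat_r; lra.
Qed.

Lemma index_cont (w : C) (I : C -> Prop) : (forall z, I z -> z <> w) ->
  cont_on (V := C_NormedModule) I (fun z => (/ (z - w))%C).
Proof.
  intros H. eapply strict_deriv_cont. intros z Hz.
  apply strict_deriv_inv. now apply H.
Qed.

Lemma index_constant (K : chain) (w0 w1 : C) (d : R) (v : C) :
  closed_chain K -> 0 < d ->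
  (forall t z, 0 <= t <= 1 -> img K z ->
     d <= Cmod (z - (w0 + t * (w1 - w0)))) ->
  cint (V := C_NormedModule) K (fun z => (/ (z - w0))%C) v ->
  cint (V := C_NormedModule) K (fun z => (/ (z - w1))%C) v.
Proof.
  intros HK Hd Hsep Hv.
  set (W := fun t : R => (w0 + t * (w1 - w0))%C).
  assert (Hex : forall t, exists u, 0 <= t <= 1 ->
    cint (V := C_NormedModule) K (fun z => (/ (z - W t))%C) u).
  { intros t. destruct (classic (0 <= t <= 1)) as [Ht|Ht].
    - destruct (cint_ex (V := C_NormedModule) K
        (fun z => (/ (z - W t))%C)) as [u Hu]; [apply norm_complete_C| |].
      + apply index_cont. intros z Hz Hzw. specialize (Hsep t z Ht Hz).
        fold (W t) in Hsep. rewrite <- Hzw in Hsep.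
        replace (z - z)%C with (RtoC 0) in Hsep by ring. rewrite Cmod_0 in Hsep. lra.
      + exists u. intros _. exact Hu.
    - exists (RtoC 0). easy. }
  destruct (choice _ Hex) as [u Hu].
  assert (E : u 0 = u 1).
  { apply (constant_of_quadratic (V := C_NormedModule) u
      (Cmod (w1 - w0) ^ 2 / d ^ 3 * len K)).
    intros s t Hs Ht.
    assert (HD : forall z, img K z -> z <> W t).
    { intros z Hz Hzw. specialize (Hsep t z Ht Hz). fold (W t) in Hsep.
      rewrite <- Hzw in Hsep. replace (z - z)%C with (RtoC 0) in Hsep by ring.
      rewrite Cmod_0 in Hsep. lra. }
    (* The part of first order in [s - t] is a multiple of the derivative of [1 / (z - W t)], whose
       integral over a closed chain vanishes. What remains carries the square of [s - t] and three
       inverse distances, each at most [/ d]. *)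
    assert (H0 := cint_closed (V := C_NormedModule) K _ _ HK
      (fun z Hz => strict_deriv_inv (W t) z (HD z Hz))).
    assert (H1 := cint_plus K _ _ _ _ (cint_minus K _ _ _ _ (Hu s Hs) (Hu t Ht))
      (cint_scal K _ _ (RtoC (s - t) * (w1 - w0))%C H0)).
    set (B := Cmod (w1 - w0) ^ 2 / d ^ 3 * (s - t) ^ 2).
    replace (Cmod (w1 - w0) ^ 2 / d ^ 3 * len K * (s - t) ^ 2) with (B * len K)
      by (unfold B; ring).
    assert (E : minus (u s) (u t) = plus (minus (u s) (u t))
        (scal (RtoC (s - t) * (w1 - w0))%C (@zero C_NormedModule)))
      by lin_ring.
    apply (Rle_trans _ _ _ (Req_le _ _ (f_equal norm E))).
    refine (cint_norm K _ _ _ _ _ H1).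
    - unfold B. apply Rmult_le_pos; [|apply pow2_ge_0].
      apply Rdiv_le_0_compat; [apply pow2_ge_0|now apply pow_lt].
    - intros z Hz.
      assert (Ds := Hsep s z Hs Hz). assert (Dt := Hsep t z Ht Hz).
      fold (W s) in Ds. fold (W t) in Dt.
      assert (Ns : (z - W s)%C <> 0) by (apply Cmod_pos_neq; lra).
      assert (Nt : (z - W t)%C <> 0) by (apply Cmod_pos_neq; lra).
      change (Cmod ((/ (z - W s) - / (z - W t)) +
        (RtoC (s - t) * (w1 - w0)) * (- (/ (z - W t) * / (z - W t)))) <= B).
      replace ((/ (z - W s) - / (z - W t)) +
        (RtoC (s - t) * (w1 - w0)) * (- (/ (z - W t) * / (z - W t))))%C
      with ((RtoC (s - t) * (w1 - w0)) * (RtoC (s - t) * (w1 - w0))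
        * (/ (z - W s) * (/ (z - W t) * / (z - W t))))%C.
      2:{ replace (W s) with (W t + RtoC (s - t) * (w1 - w0))%C
            by (unfold W; rewrite RtoC_minus; ring).
          replace (W s) with (W t + RtoC (s - t) * (w1 - w0))%C in Ns
            by (unfold W; rewrite RtoC_minus; ring).
          field. split; easy. }
      rewrite !Cmod_mult, !Cmod_inv, Cmod_R by easy.
      unfold B. rewrite <- (pow2_abs (s - t)).
      replace (Cmod (w1 - w0) ^ 2 / d ^ 3 * Rabs (s - t) ^ 2) with
        (Rabs (s - t) * Cmod (w1 - w0) * (Rabs (s - t) * Cmod (w1 - w0))
          * (/ d * (/ d * / d))) by (field; lra).
      assert (HI : forall r, d <= r -> 0 <= / r <= / d).
      { intros r Hr. split; [left; apply Rinv_0_lt_compat; lra|].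
        apply Rinv_le_contravar; lra. }
      destruct (HI _ Ds), (HI _ Dt).
      apply Rmult_le_compat_l.
      + assert (0 <= Rabs (s - t) * Cmod (w1 - w0)).
        { apply Rmult_le_pos; [apply Rabs_pos|apply Cmod_ge_0]. }
        now apply Rmult_le_pos.
      + apply Rmult_le_compat; try lra.
        * apply Rmult_le_pos; lra.
        * apply Rmult_le_compat; lra. }
  assert (E0 : u 0 = v).
  { apply (cint_unique (V := C_NormedModule) K (fun z => (/ (z - w0))%C)); [|easy].
    assert (A := Hu 0 ltac:(lra)). replace (W 0) with w0 in A by (unfold W; ring).
    exact A. }
  assert (A := Hu 1 ltac:(lra)). replace (W 1) with w1 in A by (unfold W; ring).
  rewrite <- E0, E. exact A.
Qed.

(** * Complex differentiability *)

(** Plain differentiability at one point, which is all that [ex_derive] provides; Goursat's lemma is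
    what leads from it to [strict_deriv]. *)
Definition cdiff (f : C -> C) (z l : C) : Prop :=
  forall eps, 0 < eps -> exists d, 0 < d /\
    forall w, Cmod (w - z) < d ->
      Cmod (f w - f z - (w - z) * l) <= eps * Cmod (w - z).

Definition ccont (f : C -> C) (z : C) : Prop :=
  forall eps, 0 < eps -> exists d, 0 < d /\
    forall w, Cmod (w - z) < d -> Cmod (f w - f z) <= eps.

Lemma Cminus_diag (z : C) : (z - z)%C = 0.
Proof. ring. Qed.

Lemma Cminus_neq_0 (z w : C) : z <> w -> (z - w)%C <> 0.
Proof.
  intros H E. apply H. replace z with ((z - w) + w)%C by ring. rewrite E. ring.
Qed.

Lemma Cmod_minus_pos (z w : C) : z <> w -> 0 < Cmod (z - w).
Proof. intros H. apply Cmod_gt_0. now apply Cminus_neq_0. Qed.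

Lemma Cmod_le_minus (a b : C) : Cmod a <= Cmod b + Cmod (a - b).
Proof. apply (norm_le_minus (V := C_NormedModule)). Qed.

Lemma ex_derive_cdiff (f : C -> C) (z : C) :
  ex_derive f z -> exists l, cdiff f z l.
Proof.
  intros [l [_ H]]. exists l. intros eps He.
  destruct (H z (fun P HP => HP) (mkposreal eps He)) as [d Hd].
  exists d. split; [apply cond_pos|]. intros w Hw. apply (Hd w). exact Hw.
Qed.

Lemma strict_deriv_cdiff (P p : C -> C) (z : C) :
  strict_deriv (V := C_NormedModule) P p z -> cdiff P z (p z).
Proof.
  intros H eps He. destruct (H eps He) as (d & Hd & H1).
  exists d. split; [easy|]. intros w Hw.
  assert (H0 : Cmod (z - z) < d) by now rewrite Cminus_diag, Cmod_0.
  exact (H1 z w z H0 Hw H0).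
Qed.

Lemma cdiff_ccont f z l : cdiff f z l -> ccont f z.
Proof.
  intros H eps He. destruct (H 1 Rlt_0_1) as (d & Hd & H1).
  assert (Hl := Cmod_ge_0 l).
  destruct (le_scaled_eps (1 + Cmod l) eps) as [E1 E2]; [lra|easy|].
  exists (Rmin d (eps / (1 + Cmod l + 1))). split; [now apply Rmin_glb_lt|].
  intros w Hw.
  assert (A1 := Rlt_le_trans _ _ _ Hw (Rmin_l _ _)).
  assert (A2 := Rlt_le_trans _ _ _ Hw (Rmin_r _ _)).
  specialize (H1 w A1).
  eapply Rle_trans; [apply (Cmod_le_minus _ ((w - z) * l))|].
  rewrite Cmod_mult. eapply Rle_trans; [|exact E2].
  apply Rle_trans with (Cmod (w - z) * (1 + Cmod l)); [lra|].
  apply Rmult_le_compat_r; lra.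
Qed.

Lemma cdiff_ext f g z l d : 0 < d ->
  (forall w, Cmod (w - z) < d -> f w = g w) -> cdiff f z l -> cdiff g z l.
Proof.
  intros Hd Hfg H eps He. destruct (H eps He) as (d' & Hd' & H1).
  exists (Rmin d d'). split; [now apply Rmin_glb_lt|]. intros w Hw.
  rewrite <- !Hfg.
  - apply H1. eapply Rlt_le_trans; [exact Hw|apply Rmin_r].
  - rewrite Cminus_diag, Cmod_0. easy.
  - eapply Rlt_le_trans; [exact Hw|apply Rmin_l].
Qed.

Lemma cdiff_affine (p q z : C) : cdiff (fun w => p + q * w)%C z q.
Proof.
  intros eps He. exists 1. split; [lra|]. intros w _.
  replace (_ - _)%C with (RtoC 0) by ring. rewrite Cmod_0.
  apply Rmult_le_pos; [lra|apply Cmod_ge_0].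
Qed.

Lemma cdiff_mult f g z l m : cdiff f z l -> cdiff g z m ->
  cdiff (fun w => f w * g w)%C z (l * g z + f z * m).
Proof.
  intros Hf Hg eps He.
  assert (Hl := Cmod_ge_0 l). assert (Hm := Cmod_ge_0 (g z)).
  assert (Hf0 := Cmod_ge_0 (f z)).
  destruct (le_scaled_eps (Cmod (g z) + 1) (eps / 3)) as [E1 E2]; [lra..|].
  destruct (le_scaled_eps (Cmod l) (eps / 3)) as [E3 E4]; [lra..|].
  destruct (le_scaled_eps (Cmod (f z)) (eps / 3)) as [E5 E6]; [lra..|].
  destruct (Hf _ E1) as (d1 & D1 & H1).
  destruct (Hg _ E5) as (d2 & D2 & H2).
  destruct (cdiff_ccont g z m Hg _ E3) as (d3 & D3 & H3).
  destruct (cdiff_ccont g z m Hg 1) as (d4 & D4 & H4); [lra|].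
  exists (Rmin (Rmin d1 d2) (Rmin d3 d4)).
  split; [repeat apply Rmin_glb_lt; easy|]. intros w Hw.
  assert (Hw1 := Rlt_le_trans _ _ _ Hw (Rmin_l _ _)).
  assert (Hw2 := Rlt_le_trans _ _ _ Hw (Rmin_r _ _)).
  specialize (H1 w (Rlt_le_trans _ _ _ Hw1 (Rmin_l _ _))).
  specialize (H2 w (Rlt_le_trans _ _ _ Hw1 (Rmin_r _ _))).
  specialize (H3 w (Rlt_le_trans _ _ _ Hw2 (Rmin_l _ _))).
  specialize (H4 w (Rlt_le_trans _ _ _ Hw2 (Rmin_r _ _))).
  replace (f w * g w - f z * g z - (w - z) * (l * g z + f z * m))%C with
    ((f w - f z - (w - z) * l) * g w + ((w - z) * l * (g w - g z)
      + f z * (g w - g z - (w - z) * m)))%C by ring.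
  assert (Hwz := Cmod_ge_0 (w - z)).
  eapply Rle_trans; [apply Cmod_triangle|].
  eapply Rle_trans; [apply Rplus_le_compat_l, Cmod_triangle|].
  rewrite !Cmod_mult.
  assert (Hgw : Cmod (g w) <= Cmod (g z) + 1).
  { eapply Rle_trans; [apply (Cmod_le_minus _ (g z))|]. lra. }
  apply Rle_trans with (eps / 3 * Cmod (w - z)
    + (eps / 3 * Cmod (w - z) + eps / 3 * Cmod (w - z))); [|lra].
  apply Rplus_le_compat; [|apply Rplus_le_compat].
  - apply Rle_trans with
      (eps / 3 / (Cmod (g z) + 1 + 1) * Cmod (w - z) * (Cmod (g z) + 1)).
    + apply Rmult_le_compat; try easy; apply Cmod_ge_0.
    + apply Rmult_le_compat_r with (r := Cmod (w - z)) in E2; lra.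
  - apply Rle_trans with (Cmod (w - z) * Cmod l * (eps / 3 / (Cmod l + 1))).
    + apply Rmult_le_compat_l; [now apply Rmult_le_pos|easy].
    + apply Rmult_le_compat_r with (r := Cmod (w - z)) in E4; lra.
  - apply Rle_trans with
      (Cmod (f z) * (eps / 3 / (Cmod (f z) + 1) * Cmod (w - z))).
    + now apply Rmult_le_compat_l.
    + apply Rmult_le_compat_r with (r := Cmod (w - z)) in E6; lra.
Qed.

Lemma cdiff_pow m z : exists l, cdiff (fun w => w ^ m)%C z l.
Proof.
  induction m as [|m [l IH]].
  - exists (RtoC 0). apply cdiff_ext with (fun w => RtoC 1 + 0 * w)%C 1; [lra| |].
    + intros w _. simpl. ring.
    + apply cdiff_affine.
  - exists (1 * z ^ m + (0 + 1 * z) * l)%C.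
    apply cdiff_ext with (fun w => (0 + 1 * w) * w ^ m)%C 1; [lra| |].
    + intros w _. simpl. ring.
    + apply (cdiff_mult (fun w => 0 + 1 * w)%C (fun w => w ^ m)%C);
        [apply cdiff_affine|easy].
Qed.

(** * Integrals over segments *)

Lemma norm_C_R (z : C) : norm (V := C_R_NormedModule) z = Cmod z.
Proof.
  unfold norm; simpl. unfold prod_norm, Cmod, norm; simpl. unfold abs; simpl.
  f_equal. rewrite !Rmult_1_r, <- !Rabs_mult, !Rabs_pos_eq by apply Rle_0_sqr. ring.
Qed.

Lemma scal_C_R (r : R) (z : C) :
  scal (V := C_R_NormedModule) r z = (RtoC r * z)%C.
Proof.
  destruct z as [x y]. unfold scal; simpl. unfold prod_scal, scal; simpl.
  unfold mult; simpl. unfold RtoC, Cmult; simpl. f_equal; ring.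
Qed.

Notation CRInt := (RInt (V := C_R_CompleteNormedModule)).

Definition seg_path (a b : C) (t : R) : C := (a + t * (b - a))%C.

(** [RInt] with [C] as a real vector space is used here instead of [cint]: bisection and reversal of
    segments then reduce to an affine substitution in the parameter. *)
Definition seg (f : C -> C) (a b : C) : C :=
  ((b - a) * CRInt (fun t => f (seg_path a b t)) 0 1)%C.

Definition seg_cont (f : C -> C) (a b : C) : Prop :=
  forall t, 0 <= t <= 1 -> ccont f (seg_path a b t).

Lemma seg_path_minus a b s t :
  (seg_path a b s - seg_path a b t = RtoC (s - t) * (b - a))%C.
Proof. unfold seg_path. rewrite RtoC_minus. ring. Qed.

Lemma seg_continuous f a b t : seg_cont f a b -> 0 <= t <= 1 ->
  continuous (U := C_R_NormedModule) (fun s => f (seg_path a b s)) t.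
Proof.
  intros Hf Ht. apply (filterlim_locally (U := C_R_NormedModule)).
  intros eps. assert (He := cond_pos eps).
  destruct (Hf t Ht (eps / 2)) as (d & Hd & H); [lra|].
  destruct (le_scaled_eps (Cmod (b - a)) (d / 2)) as [E1 E2];
    [apply Cmod_ge_0|lra|].
  exists (mkposreal _ E1). intros s Hs.
  apply C_NormedModule_mixin_compat1. eapply Rle_lt_trans; [apply H|lra].
  rewrite seg_path_minus, Cmod_mult, Cmod_R.
  change (Rabs (s - t) < d / 2 / (Cmod (b - a) + 1)) in Hs.
  eapply Rle_lt_trans; [|apply (Rle_lt_trans _ _ d E2); lra].
  apply Rmult_le_compat_r; [apply Cmod_ge_0|]. lra.
Qed.

Lemma seg_ex f a b u v : seg_cont f a b -> 0 <= u <= 1 -> 0 <= v <= 1 ->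
  ex_RInt (V := C_R_CompleteNormedModule) (fun t => f (seg_path a b t)) u v.
Proof.
  intros Hf Hu Hv. apply (ex_RInt_continuous (V := C_R_CompleteNormedModule)).
  intros t [H1 H2]. apply seg_continuous; [easy|]. split.
  - eapply Rle_trans; [|exact H1]. apply Rmin_glb; lra.
  - eapply Rle_trans; [exact H2|]. apply Rmax_lub; lra.
Qed.

Lemma seg_bound f a b M : seg_cont f a b ->
  (forall t, 0 <= t <= 1 -> Cmod (f (seg_path a b t)) <= M) ->
  Cmod (seg f a b) <= M * Cmod (b - a).
Proof.
  intros Hf HM. unfold seg. rewrite Cmod_mult, Rmult_comm.
  apply Rmult_le_compat_r; [apply Cmod_ge_0|].
  rewrite <- norm_C_R. replace M with ((1 - 0) * M) by ring.
  apply (norm_RInt_le_const (V := C_R_NormedModule)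
    (fun t => f (seg_path a b t)) 0 1); [lra| |].
  - intros t Ht. rewrite norm_C_R. now apply HM.
  - apply (RInt_correct (V := C_R_CompleteNormedModule)). apply seg_ex; (easy || lra).
Qed.

Lemma seg_minus f g a b : seg_cont f a b -> seg_cont g a b ->
  seg (fun z => f z - g z)%C a b = (seg f a b - seg g a b)%C.
Proof.
  intros Hf Hg. unfold seg.
  assert (E : CRInt (fun t => f (seg_path a b t) - g (seg_path a b t))%C 0 1 =
    (CRInt (fun t => f (seg_path a b t)) 0 1
     - CRInt (fun t => g (seg_path a b t)) 0 1)%C).
  { apply (RInt_minus (V := C_R_CompleteNormedModule)
      (fun t => f (seg_path a b t)) (fun t => g (seg_path a b t)));
    apply seg_ex; (easy || lra). }
  rewrite E. ring.
Qed.

Lemma seg_cont_minus f g a b : seg_cont f a b -> seg_cont g a b ->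
  seg_cont (fun z => f z - g z)%C a b.
Proof.
  intros Hf Hg t Ht eps He.
  destruct (Hf t Ht (eps / 2)) as (d1 & D1 & H1); [lra|].
  destruct (Hg t Ht (eps / 2)) as (d2 & D2 & H2); [lra|].
  exists (Rmin d1 d2). split; [now apply Rmin_glb_lt|]. intros w Hw.
  specialize (H1 w (Rlt_le_trans _ _ _ Hw (Rmin_l _ _))).
  specialize (H2 w (Rlt_le_trans _ _ _ Hw (Rmin_r _ _))).
  set (z := seg_path a b t) in *.
  replace (f w - g w - (f z - g z))%C with ((f w - f z) - (g w - g z))%C by ring.
  eapply Rle_trans; [apply (norm_minus_le (V := C_NormedModule))|].
  change (Cmod (f w - f z) + Cmod (g w - g z) <= eps). lra.
Qed.

(** [u] is the signed length of the parameter interval and [v] its start; the negative value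
    [u = -1] yields the reversal of a segment. *)
Lemma seg_reparam f a b u v : seg_cont f a b ->
  0 <= v <= 1 -> 0 <= u + v <= 1 ->
  seg f (seg_path a b v) (seg_path a b (u + v))
  = ((b - a) * CRInt (fun t => f (seg_path a b t)) v (u + v))%C.
Proof.
  intros Hf Hv Huv. unfold seg. rewrite seg_path_minus.
  replace (u + v - v) with u by ring.
  assert (E := RInt_comp_lin (V := C_R_CompleteNormedModule)
    (fun t => f (seg_path a b t)) u v 0 1).
  rewrite Rmult_0_r, Rplus_0_l, Rmult_1_r in E.
  rewrite <- E by now apply seg_ex.
  rewrite (RInt_ext (V := C_R_CompleteNormedModule)
    (fun y => scal u (f (seg_path a b (u * y + v))))
    (fun y => scal (V := C_R_NormedModule) u
       (f (seg_path (seg_path a b v) (seg_path a b (u + v)) y)))).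
  2:{ intros y _. f_equal. f_equal. unfold seg_path.
      rewrite !RtoC_plus, !RtoC_mult. ring. }
  rewrite (RInt_scal (V := C_R_CompleteNormedModule)).
  - rewrite scal_C_R. ring.
  - apply seg_ex; [|lra|lra]. intros t Ht.
    replace (seg_path (seg_path a b v) (seg_path a b (u + v)) t)
      with (seg_path a b (u * t + v)).
    2:{ unfold seg_path. rewrite !RtoC_plus, !RtoC_mult. ring. }
    apply Hf.
    assert (Hc : u * t + v = (u + v) * t + v * (1 - t)) by ring.
    rewrite Hc. split.
    + apply Rplus_le_le_0_compat; apply Rmult_le_pos; lra.
    + assert (0 <= (1 - (u + v)) * t) by (apply Rmult_le_pos; lra).
      assert (0 <= (1 - v) * (1 - t)) by (apply Rmult_le_pos; lra). lra.
Qed.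

Lemma seg_path_0 a b : seg_path a b 0 = a.
Proof. unfold seg_path. ring. Qed.

Lemma seg_path_1 a b : seg_path a b 1 = b.
Proof. unfold seg_path. ring. Qed.

Lemma seg_split f a b m : seg_cont f a b -> m = seg_path a b (/ 2) ->
  seg f a b = (seg f a m + seg f m b)%C.
Proof.
  intros Hf ->.
  assert (E1 := seg_reparam f a b (/ 2) 0 Hf ltac:(lra) ltac:(lra)).
  assert (E2 := seg_reparam f a b (/ 2) (/ 2) Hf ltac:(lra) ltac:(lra)).
  replace (/ 2 + 0) with (/ 2) in E1 by ring.
  replace (/ 2 + / 2) with 1 in E2 by lra.
  rewrite seg_path_0 in E1. rewrite seg_path_1 in E2. rewrite E1, E2.
  unfold seg. rewrite <- Cmult_plus_distr_l. f_equal. symmetry.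
  apply (RInt_Chasles (V := C_R_CompleteNormedModule)); apply seg_ex; (easy || lra).
Qed.

Lemma seg_rev f a b : seg_cont f a b -> seg f b a = (- seg f a b)%C.
Proof.
  intros Hf.
  assert (E := seg_reparam f a b (-1) 1 Hf ltac:(lra) ltac:(lra)).
  replace (-1 + 1) with 0 in E by ring.
  rewrite seg_path_0, seg_path_1 in E. rewrite E. unfold seg.
  rewrite <- (opp_RInt_swap (V := C_R_CompleteNormedModule)).
  - change ((b - a) * (- CRInt (fun t => f (seg_path a b t)) 0 1) =
    - ((b - a) * CRInt (fun t => f (seg_path a b t)) 0 1))%C. ring.
  - apply seg_ex; (easy || lra).
Qed.

Lemma seg_cont_affine p q a b : seg_cont (fun z => p + q * z)%C a b.
Proof. intros t _. eapply cdiff_ccont. apply cdiff_affine. Qed.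

(** The integrand is averaged with its reflection in the midpoint. *)
Lemma seg_affine p q a b :
  seg (fun z => p + q * z)%C a b = ((b - a) * (p + q * ((a + b) / 2)))%C.
Proof.
  assert (Hf := seg_cont_affine p q a b).
  assert (E1 := seg_rev _ a b Hf).
  assert (E : (seg (fun z => p + q * z) a b - seg (fun z => p + q * z) b a
    = (b - a) * (2 * p + q * (a + b)))%C).
  { unfold seg.
    set (F := fun t => (p + q * seg_path a b t)%C).
    set (G := fun t => (p + q * seg_path b a t)%C).
    assert (E : plus (CRInt F 0 1) (CRInt G 0 1)
      = (2 * p + q * (a + b))%C).
    { rewrite <- (RInt_plus (V := C_R_CompleteNormedModule)).
      - rewrite (RInt_ext (V := C_R_CompleteNormedModule) _
          (fun _ => (2 * p + q * (a + b))%C)).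
        + rewrite (RInt_const (V := C_R_CompleteNormedModule)).
          rewrite scal_C_R. rewrite Rminus_0_r.
          change (RtoC 1 * (2 * p + q * (a + b)) = 2 * p + q * (a + b))%C. ring.
        + intros t _. change ((F t + G t) = 2 * p + q * (a + b))%C.
          unfold F, G, seg_path. ring.
      - apply (seg_ex (fun z => p + q * z)%C); [easy|lra|lra].
      - apply (seg_ex (fun z => p + q * z)%C); [apply seg_cont_affine|lra|lra]. }
    change (CRInt F 0 1 + CRInt G 0 1 = 2 * p + q * (a + b))%C in E.
    replace ((b - a) * CRInt F 0 1 - (a - b) * CRInt G 0 1)%C with
      ((b - a) * (CRInt F 0 1 + CRInt G 0 1))%C by ring.
    rewrite E. ring. }
  rewrite E1 in E. set (S := seg (fun z => p + q * z)%C a b) in *.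
  replace (S - - S)%C with (2 * S)%C in E by ring.
  replace S with ((2 * S) / 2)%C by field.
  rewrite E. field.
Qed.

(** * Goursat's lemma *)

Definition tri (f : C -> C) (a b c : C) : C := (seg f a b + seg f b c + seg f c a)%C.

(** Affine functions integrate to zero around a triangle, so [f] may be replaced by its error
    against an affine approximation. *)
Lemma tri_bound f a b c p q M :
  seg_cont f a b -> seg_cont f b c -> seg_cont f c a ->
  (forall t, 0 <= t <= 1 ->
     Cmod (f (seg_path a b t) - (p + q * seg_path a b t)) <= M /\
     Cmod (f (seg_path b c t) - (p + q * seg_path b c t)) <= M /\
     Cmod (f (seg_path c a t) - (p + q * seg_path c a t)) <= M) ->
  Cmod (tri f a b c) <= M * (Cmod (b - a) + Cmod (c - b) + Cmod (a - c)).
Proof.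
  intros H1 H2 H3 HM.
  set (e := fun z => (f z - (p + q * z))%C).
  assert (E : tri f a b c = (seg e a b + seg e b c + seg e c a)%C).
  { unfold e, tri.
    rewrite !(seg_minus f (fun z => p + q * z)%C)
      by (easy || apply seg_cont_affine).
    rewrite !seg_affine. field. }
  rewrite E.
  assert (B : forall x y, seg_cont f x y ->
    (forall t, 0 <= t <= 1 -> Cmod (e (seg_path x y t)) <= M) ->
    Cmod (seg e x y) <= M * Cmod (y - x)).
  { intros x y Hxy Hb. apply seg_bound; [|easy].
    apply (seg_cont_minus f (fun z => p + q * z)%C); [easy|apply seg_cont_affine]. }
  eapply Rle_trans; [apply Cmod_triangle|].
  eapply Rle_trans; [apply Rplus_le_compat_r, Cmod_triangle|].
  rewrite !Rmult_plus_distr_l.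
  apply Rplus_le_compat; [apply Rplus_le_compat|]; apply B; try assumption;
    intros t Ht; apply (HM t Ht).
Qed.

(** The intervals of radius [2 / 2 ^ n] about [u n] are nested; the limit is the supremum of their
    left ends. *)
Lemma geometric_limit (u : nat -> R) :
  (forall n, Rabs (u (S n) - u n) <= / 2 ^ n) ->
  exists l, forall n, Rabs (u n - l) <= 2 / 2 ^ n.
Proof.
  intros Hu.
  assert (P2 : forall n, 0 < 2 ^ n) by (intros; apply pow_lt; lra).
  assert (S2 : forall n, / 2 ^ n = 2 / 2 ^ n - 2 / 2 ^ S n).
  { intros n. simpl. specialize (P2 n). field. lra. }
  assert (Hlow : forall n k, u n - 2 / 2 ^ n <= u (n + k)%nat - 2 / 2 ^ (n + k)).
  { intros n k. induction k as [|k IH]; [rewrite Nat.add_0_r; lra|].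
    rewrite Nat.add_succ_r. eapply Rle_trans; [exact IH|].
    specialize (Hu (n + k)%nat). rewrite S2 in Hu.
    apply Rabs_le_between in Hu. lra. }
  assert (Hup : forall n k, u (n + k)%nat + 2 / 2 ^ (n + k) <= u n + 2 / 2 ^ n).
  { intros n k. induction k as [|k IH]; [rewrite Nat.add_0_r; lra|].
    rewrite Nat.add_succ_r. eapply Rle_trans; [|exact IH].
    specialize (Hu (n + k)%nat). rewrite S2 in Hu.
    apply Rabs_le_between in Hu. lra. }
  assert (Hpos : forall n, 0 < 2 / 2 ^ n).
  { intros n. apply Rdiv_lt_0_compat; [lra|apply P2]. }
  assert (Hx : forall n m, u n - 2 / 2 ^ n <= u m + 2 / 2 ^ m).
  { intros n m. destruct (Nat.le_ge_cases n m) as [H|H].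
    - replace m with (n + (m - n))%nat by lia. eapply Rle_trans; [apply (Hlow n (m - n)%nat)|].
      specialize (Hpos (n + (m - n))%nat). lra.
    - replace n with (m + (n - m))%nat by lia.
      eapply Rle_trans; [|apply (Hup m (n - m)%nat)].
      specialize (Hpos (m + (n - m))%nat). lra. }
  destruct (completeness (fun y => exists n, y = u n - 2 / 2 ^ n)) as [l [L1 L2]].
  - exists (u 0%nat + 2 / 2 ^ 0). intros y [n ->]. apply Hx.
  - exists (u 0%nat - 2 / 2 ^ 0). now exists 0%nat.
  - exists l. intros n. apply Rabs_le_between. split.
    + assert (l <= u n + 2 / 2 ^ n); [|lra].
      apply L2. intros y [m ->]. apply Hx.
    + assert (u n - 2 / 2 ^ n <= l); [|lra]. apply L1. now exists n.
Qed.

Section Goursat.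
Variables (f : C -> C) (c A B : C).
Hypothesis f_diff : forall x y, 0 <= x -> 0 <= y -> x + y <= 1 ->
  exists l, cdiff f (c + x * A + y * B)%C l.

Let pt (x y : R) : C := (c + x * A + y * B)%C.

Let simplex (x y : R) : Prop := 0 <= x /\ 0 <= y /\ x + y <= 1.

Lemma pt_path x y x' y' t :
  seg_path (pt x y) (pt x' y') t = pt (x + t * (x' - x)) (y + t * (y' - y)).
Proof.
  unfold seg_path, pt. rewrite !RtoC_plus, !RtoC_mult, !RtoC_minus. ring.
Qed.

Lemma simplex_path x y x' y' t : simplex x y -> simplex x' y' -> 0 <= t <= 1 ->
  simplex (x + t * (x' - x)) (y + t * (y' - y)).
Proof.
  intros (H1 & H2 & H3) (H4 & H5 & H6) Ht. repeat split.
  - replace (_ + _) with ((1 - t) * x + t * x') by ring.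
    apply Rplus_le_le_0_compat; apply Rmult_le_pos; lra.
  - replace (_ + _) with ((1 - t) * y + t * y') by ring.
    apply Rplus_le_le_0_compat; apply Rmult_le_pos; lra.
  - replace (_ + _) with ((1 - t) * (x + y) + t * (x' + y')) by ring.
    assert (0 <= (1 - t) * (1 - (x + y))) by (apply Rmult_le_pos; lra).
    assert (0 <= t * (1 - (x' + y'))) by (apply Rmult_le_pos; lra). lra.
Qed.

Lemma simplex_seg_cont x y x' y' : simplex x y -> simplex x' y' ->
  seg_cont f (pt x y) (pt x' y').
Proof.
  intros H H' t Ht. rewrite pt_path.
  destruct (simplex_path x y x' y' t H H' Ht) as (H1 & H2 & H3).
  destruct (f_diff _ _ H1 H2 H3) as [l Hl]. eapply cdiff_ccont, Hl.
Qed.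

(** A triple [(x, y, h)] stands for the triangle with a corner at [(x, y)] and legs [h] along both
    axes of the parameter plane. A negative [h] describes the inverted middle triangle of a
    subdivision. *)
Let in_simplex (s : R * R * R) : Prop :=
  let '(x, y, h) := s in
  simplex x y /\ simplex (x + h) y /\ simplex x (y + h).

Let tri_of (s : R * R * R) : C :=
  let '(x, y, h) := s in tri f (pt x y) (pt (x + h) y) (pt x (y + h)).

Let size (s : R * R * R) : R := let '(_, _, h) := s in Rabs h.

Lemma tri_of_split x y h : in_simplex (x, y, h) ->
  tri_of (x, y, h) = (tri_of (x, y, (h / 2)%R) + tri_of ((x + h / 2)%R, y, (h / 2)%R)
    + tri_of (x, (y + h / 2)%R, (h / 2)%R)
    + tri_of ((x + h / 2)%R, (y + h / 2)%R, (- (h / 2))%R))%C.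
Proof.
  intros (H1 & H2 & H3). cbn [tri_of].
  replace (x + h / 2 + h / 2) with (x + h) by lra.
  replace (y + h / 2 + h / 2) with (y + h) by lra.
  replace (x + h / 2 + - (h / 2)) with x by lra.
  replace (y + h / 2 + - (h / 2)) with y by lra.
  assert (M1 : simplex (x + h / 2) y) by (unfold simplex in *; lra).
  assert (M2 : simplex x (y + h / 2)) by (unfold simplex in *; lra).
  assert (M3 : simplex (x + h / 2) (y + h / 2)) by (unfold simplex in *; lra).
  unfold tri.
  rewrite (seg_split f (pt x y) (pt (x + h) y) (pt (x + h / 2) y)),
    (seg_split f (pt (x + h) y) (pt x (y + h)) (pt (x + h / 2) (y + h / 2))),
    (seg_split f (pt x (y + h)) (pt x y) (pt x (y + h / 2))).
  - rewrite (seg_rev f (pt (x + h / 2) y) (pt x (y + h / 2))),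
      (seg_rev f (pt (x + h / 2) y) (pt (x + h / 2) (y + h / 2))),
      (seg_rev f (pt x (y + h / 2)) (pt (x + h / 2) (y + h / 2)))
      by now apply simplex_seg_cont.
    ring.
  - now apply simplex_seg_cont.
  - rewrite pt_path. f_equal; lra.
  - now apply simplex_seg_cont.
  - rewrite pt_path. f_equal; lra.
  - now apply simplex_seg_cont.
  - rewrite pt_path. f_equal; lra.
Qed.

(** Four subtriangles of half the size, each with integral at most [k * (size s / 2) ^ 2], could
    only add up to [k * size s ^ 2]. *)
Lemma bad_subtriangle k s : in_simplex s ->
  k * size s ^ 2 < Cmod (tri_of s) ->
  exists s', in_simplex s' /\ k * size s' ^ 2 < Cmod (tri_of s') /\
    size s' = size s / 2 /\
    Rabs (fst (fst s') - fst (fst s)) <= size s / 2 /\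
    Rabs (snd (fst s') - snd (fst s)) <= size s / 2.
Proof.
  destruct s as [[x y] h]. intros Hs Hk.
  set (subs := (x, y, h / 2) :: (x + h / 2, y, h / 2) :: (x, y + h / 2, h / 2)
    :: (x + h / 2, y + h / 2, - (h / 2)) :: nil).
  assert (Hh : Rabs (h / 2) = Rabs h / 2).
  { unfold Rdiv. rewrite Rabs_mult, (Rabs_pos_eq (/ 2)); lra. }
  assert (Hh' : Rabs (- (h / 2)) = Rabs h / 2) by now rewrite Rabs_Ropp.
  assert (Hprop : forall s', In s' subs -> in_simplex s' /\
    size s' = size (x, y, h) / 2 /\
    Rabs (fst (fst s') - x) <= size (x, y, h) / 2 /\
    Rabs (snd (fst s') - y) <= size (x, y, h) / 2).
  { assert (Z : forall a b, a - b = 0 -> Rabs (a - b) <= Rabs h / 2).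
    { intros a b ->. rewrite Rabs_R0. assert (Hr := Rabs_pos h). lra. }
    assert (W : forall a b, a - b = h / 2 -> Rabs (a - b) <= Rabs h / 2).
    { intros a b ->. lra. }
    unfold in_simplex, simplex, size in *.
    intros s' [<-|[<-|[<-|[<-|[]]]]]; cbn [fst snd];
    (split; [lra|split; [easy|split; first [apply Z; lra | apply W; lra]]]). }
  destruct (classic (exists s', In s' subs /\
    k * size s' ^ 2 < Cmod (tri_of s'))) as [(s' & Hin & Hs')|Hno].
  - exists s'. destruct (Hprop s' Hin) as (P1 & P2 & P3 & P4). easy.
  - exfalso. apply (Rlt_irrefl (Cmod (tri_of (x, y, h)))).
    eapply Rle_lt_trans; [|exact Hk].
    assert (Hle : forall s', In s' subs -> Cmod (tri_of s') <= k * (Rabs h / 2) ^ 2).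
    { intros s' Hin. destruct (Hprop s' Hin) as (_ & P2 & _).
      change (Rabs h) with (size (x, y, h)). rewrite <- P2.
      apply Rnot_lt_le. intros Hlt. apply Hno. now exists s'. }
    rewrite tri_of_split by easy.
    eapply Rle_trans; [apply Cmod_triangle|].
    eapply Rle_trans; [apply Rplus_le_compat_r, Cmod_triangle|].
    eapply Rle_trans; [apply Rplus_le_compat_r, Rplus_le_compat_r, Cmod_triangle|].
    assert (L1 := Hle _ (or_introl eq_refl)).
    assert (L2 := Hle _ (or_intror (or_introl eq_refl))).
    assert (L3 := Hle _ (or_intror (or_intror (or_introl eq_refl)))).
    assert (L4 := Hle _ (or_intror (or_intror (or_intror (or_introl eq_refl))))).
    unfold size. lra.
Qed.

Lemma goursat : tri f c (c + A)%C (c + B)%C = 0.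
Proof.
  replace c with (pt 0 0) at 1 by (unfold pt; ring).
  replace (c + A)%C with (pt (0 + 1) 0)
    by (unfold pt; rewrite Rplus_0_l; ring).
  replace (c + B)%C with (pt 0 (0 + 1))
    by (unfold pt; rewrite Rplus_0_l; ring).
  change (tri_of (0, 0, 1) = 0). apply Cmod_eq_0.
  assert (HT := Cmod_ge_0 (tri_of (0, 0, 1))).
  destruct (Rle_lt_or_eq_dec _ _ HT) as [Hpos|]; [|easy]. exfalso.
  (* Halving makes the inequality in [good] strict for the initial triangle, which has size 1. *)
  set (k := Cmod (tri_of (0, 0, 1)) / 2).
  set (good := fun s => in_simplex s /\ k * size s ^ 2 < Cmod (tri_of s)).
  assert (HC : forall s, exists s', good s -> good s' /\
    size s' = size s / 2 /\
    Rabs (fst (fst s') - fst (fst s)) <= size s / 2 /\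
    Rabs (snd (fst s') - snd (fst s)) <= size s / 2).
  { intros s. destruct (classic (good s)) as [[G1 G2]|G].
    - destruct (bad_subtriangle k s G1 G2) as (s' & H1 & H2 & H3).
      exists s'. intros _. easy.
    - exists s. easy. }
  destruct (choice _ HC) as [next Hnext].
  set (st := fix st n := match n with O => (0, 0, 1) | S m => next (st m) end).
  assert (P2 : forall n, 0 < 2 ^ n) by (intros; apply pow_lt; lra).
  assert (Hst : forall n, good (st n) /\ size (st n) = / 2 ^ n).
  { induction n as [|n [IH1 IH2]].
    - split; [split|].
      + unfold in_simplex, simplex. simpl. lra.
      + simpl. rewrite Rabs_R1. unfold k. simpl tri_of in *. lra.
      + simpl. rewrite Rabs_R1. lra.
    - destruct (Hnext (st n) IH1) as (G1 & G2 & _). cbn [st]. split; [easy|].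
      rewrite G2, IH2. simpl. specialize (P2 n). field. lra. }
  assert (Hx : forall n, Rabs (fst (fst (st (S n))) - fst (fst (st n))) <= / 2 ^ n /\
    Rabs (snd (fst (st (S n))) - snd (fst (st n))) <= / 2 ^ n).
  { intros n. destruct (Hst n) as [G1 G2].
    destruct (Hnext (st n) G1) as (_ & _ & G3 & G4). cbn [st].
    rewrite G2 in G3, G4. assert (Hp : 0 < / 2 ^ n) by now apply Rinv_0_lt_compat.
    lra. }
  destruct (geometric_limit (fun n => fst (fst (st n)))) as [x Hlx];
    [intros n; apply Hx|].
  destruct (geometric_limit (fun n => snd (fst (st n)))) as [y Hly];
    [intros n; apply Hx|].
  assert (Hsmall : forall e, 0 < e -> exists n, / 2 ^ n < e).
  { intros e He. destruct (pow_lt_1_zero (/ 2)) with (y := e) as [n Hn].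
    - rewrite Rabs_pos_eq; lra.
    - easy.
    - exists n. specialize (Hn n (le_n _)). rewrite pow_inv in Hn.
      rewrite Rabs_pos_eq in Hn; [easy|]. left. now apply Rinv_0_lt_compat. }
  assert (Hxy : simplex x y).
  { assert (Hge : forall a, (forall e, 0 < e -> - e <= a) -> 0 <= a).
    { intros a Ha. apply Rnot_lt_le. intros Hlt.
      specialize (Ha (- a / 2)). lra. }
    assert (Hn : forall e, 0 < e -> exists x' y', simplex x' y' /\
      Rabs (x' - x) <= e /\ Rabs (y' - y) <= e).
    { intros e He. destruct (Hsmall (e / 2)) as [n Hn]; [lra|].
      exists (fst (fst (st n))), (snd (fst (st n))).
      destruct (Hst n) as [[G1 _] _]. specialize (Hlx n). specialize (Hly n).
      simpl in Hlx, Hly. split; [|split; lra].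
      destruct (st n) as [[x' y'] h]. simpl. apply G1. }
    repeat split.
    - apply Hge. intros e He. destruct (Hn e He) as (x' & y' & (S1 & S2 & S3) & B1 & B2).
      apply Rabs_le_between in B1. lra.
    - apply Hge. intros e He. destruct (Hn e He) as (x' & y' & (S1 & S2 & S3) & B1 & B2).
      apply Rabs_le_between in B2. lra.
    - assert (0 <= 1 - (x + y)); [|lra]. apply Hge. intros e He.
      destruct (Hn (e / 2)) as (x' & y' & (S1 & S2 & S3) & B1 & B2); [lra|].
      apply Rabs_le_between in B1. apply Rabs_le_between in B2. lra. }
  destruct Hxy as (X1 & X2 & X3). destruct (f_diff x y X1 X2 X3) as [l Hl].
  fold (pt x y) in Hl.
  set (D := Cmod A + Cmod B).
  assert (HD : 0 <= D) by (unfold D; assert (H1 := Cmod_ge_0 A);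
    assert (H2 := Cmod_ge_0 B); lra).
  assert (Hk : 0 < k) by (unfold k; lra).
  (* On a triangle of size [q] the points lie within [3 * D * q] of the limit point, so the affine
     error is at most [eps * (3 * D * q)], and the perimeter is at most [2 * q * D]. The product is
     [6 * D ^ 2 * eps * q ^ 2]. *)
  assert (HD6 : 0 <= 6 * D ^ 2) by (assert (H := pow2_ge_0 D); lra).
  destruct (le_scaled_eps (6 * D ^ 2) k HD6 Hk) as [E1 E2].
  set (eps := k / (6 * D ^ 2 + 1)) in *.
  destruct (Hl eps E1) as (d & Hd & Hdiff).
  destruct (Hsmall (d / (3 * D + 1))) as [n Hn]; [apply Rdiv_lt_0_compat; lra|].
  assert (Hn' : 3 * D * / 2 ^ n < d).
  { apply Rle_lt_trans with (/ 2 ^ n * (3 * D)); [lra|].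
    assert (Hp : 0 < / 2 ^ n) by now apply Rinv_0_lt_compat.
    apply Rlt_le_trans with (d / (3 * D + 1) * (3 * D + 1)).
    - apply Rlt_le_trans with (/ 2 ^ n * (3 * D + 1)); [lra|].
      apply Rmult_le_compat_r; lra.
    - right. field. lra. }
  destruct (Hst n) as [[G1 G2] G3]. specialize (Hlx n). specialize (Hly n).
  cbv beta in Hlx, Hly.
  destruct (st n) as [[x' y'] h]. cbn [fst snd] in *. unfold size in G2, G3.
  rewrite G3 in G2. set (q := / 2 ^ n) in *.
  replace (2 / 2 ^ n) with (2 * q) in Hlx by (unfold q; reflexivity).
  replace (2 / 2 ^ n) with (2 * q) in Hly by (unfold q; reflexivity).
  assert (Hq : 0 < q) by now apply Rinv_0_lt_compat.
  destruct G1 as (V1 & V2 & V3).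
  apply (Rlt_irrefl (k * q ^ 2)). eapply Rlt_le_trans; [exact G2|].
  set (M := eps * (3 * D * q)).
  assert (Hnear : forall u v, Rabs (u - x') <= q -> Rabs (v - y') <= q ->
    Cmod (f (pt u v) - (f (pt x y) - pt x y * l + l * pt u v)) <= M).
  { intros u v Hu Hv.
    assert (Huv : Cmod (pt u v - pt x y) <= 3 * D * q).
    { replace (pt u v - pt x y)%C with (RtoC (u - x) * A + RtoC (v - y) * B)%C
        by (unfold pt; rewrite !RtoC_minus; ring).
      eapply Rle_trans; [apply Cmod_triangle|]. rewrite !Cmod_mult, !Cmod_R.
      assert (U1 : Rabs (u - x) <= 3 * q).
      { replace (u - x) with ((u - x') + (x' - x)) by ring.
        eapply Rle_trans; [apply Rabs_triang|]. lra. }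
      assert (U2 : Rabs (v - y) <= 3 * q).
      { replace (v - y) with ((v - y') + (y' - y)) by ring.
        eapply Rle_trans; [apply Rabs_triang|]. lra. }
      replace (3 * D * q) with (3 * q * Cmod A + 3 * q * Cmod B)
        by (unfold D; ring).
      apply Rplus_le_compat; apply Rmult_le_compat_r; (easy || apply Cmod_ge_0). }
    replace (_ - _)%C with (f (pt u v) - f (pt x y) - (pt u v - pt x y) * l)%C by ring.
    eapply Rle_trans; [apply Hdiff; lra|].
    apply Rmult_le_compat_l; lra. }
  assert (Hb : Cmod (tri_of (x', y', h)) <= M *
    (Cmod (pt (x' + h) y' - pt x' y') + Cmod (pt x' (y' + h) - pt (x' + h) y')
     + Cmod (pt x' y' - pt x' (y' + h)))).
  { apply (tri_bound f _ _ _ (f (pt x y) - pt x y * l)%C l);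
      [now apply simplex_seg_cont..|].
    assert (Hth : forall t r, 0 <= t <= 1 -> Rabs r <= Rabs h -> Rabs (t * r) <= q).
    { intros t r Ht Hr. rewrite Rabs_mult, (Rabs_pos_eq t) by lra.
      rewrite <- G3. apply Rle_trans with (1 * Rabs r); [|lra].
      apply Rmult_le_compat_r; [apply Rabs_pos|lra]. }
    intros t Ht. rewrite !pt_path.
    repeat split; apply Hnear.
    - replace (_ - _) with (t * h) by ring. apply Hth; lra.
    - replace (_ - _) with (t * 0) by ring. apply Hth; [lra|].
      rewrite Rabs_R0. apply Rabs_pos.
    - replace (_ - _) with ((1 - t) * h) by ring. apply Hth; lra.
    - replace (_ - _) with (t * h) by ring. apply Hth; lra.
    - replace (_ - _) with (t * 0) by ring. apply Hth; [lra|].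
      rewrite Rabs_R0. apply Rabs_pos.
    - replace (_ - _) with ((1 - t) * h) by ring. apply Hth; lra. }
  eapply Rle_trans; [exact Hb|].
  assert (L1 : Cmod (pt (x' + h) y' - pt x' y') = q * Cmod A).
  { replace (_ - _)%C with (RtoC h * A)%C by (unfold pt; rewrite RtoC_plus; ring).
    now rewrite Cmod_mult, Cmod_R, G3. }
  assert (L3 : Cmod (pt x' y' - pt x' (y' + h)) = q * Cmod B).
  { replace (_ - _)%C with (- (RtoC h * B))%C by (unfold pt; rewrite RtoC_plus; ring).
    now rewrite Cmod_opp, Cmod_mult, Cmod_R, G3. }
  assert (L2 : Cmod (pt x' (y' + h) - pt (x' + h) y') <= q * Cmod B + q * Cmod A).
  { rewrite <- L1, <- L3.
    rewrite (Cmod_minus_sym (pt x' y')), (Cmod_minus_sym (pt (x' + h) y') (pt x' y')).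
    apply Cmod_minus_triangle. }
  apply Rle_trans with (M * (2 * q * D)).
  - apply Rmult_le_compat_l; [|unfold D; lra]. unfold M.
    apply Rmult_le_pos; [lra|]. apply Rmult_le_pos; lra.
  - apply Rmult_le_compat_r with (r := q ^ 2) in E2; [|apply pow2_ge_0].
    unfold M. eapply Rle_trans; [|exact E2]. right. ring.
Qed.
End Goursat.

(** * Primitives on starlike domains *)

Definition C_open (D : C -> Prop) : Prop :=
  forall z, D z -> exists d, 0 < d /\ forall w, Cmod (w - z) < d -> D w.

Definition starlike (c : C) (D : C -> Prop) : Prop :=
  forall z t, D z -> 0 <= t <= 1 -> D (c + t * (z - c))%C.

Definition holo_on (D : C -> Prop) (f : C -> C) : Prop :=
  forall z, D z -> exists l, cdiff f z l.

Lemma disc_segment z d a b t : Cmod (a - z) < d -> Cmod (b - z) < d ->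
  0 <= t <= 1 -> Cmod (seg_path a b t - z) < d.
Proof.
  intros Ha Hb Ht. unfold seg_path.
  replace (_ - _)%C with (RtoC (1 - t) * (a - z) + RtoC t * (b - z))%C
    by (rewrite RtoC_minus; ring).
  eapply Rle_lt_trans; [apply Cmod_triangle|].
  rewrite !Cmod_mult, !Cmod_R, !Rabs_pos_eq by lra.
  destruct (Req_dec t 0) as [->|Ht0]; [lra|].
  replace d with ((1 - t) * d + t * d) by ring.
  apply Rplus_le_lt_compat.
  - apply Rmult_le_compat_l; lra.
  - apply Rmult_lt_compat_l; lra.
Qed.

(** Goursat's lemma on the triangle [c], [a], [b] turns increments of the integral from [c] into
    integrals over [[a, b]]. That fact is kept in the conclusion because difference quotients of [P]
    are later expanded to second order. *)
Lemma primitive_ex (D : C -> Prop) (c : C) (f : C -> C) :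
  C_open D -> starlike c D -> D c -> holo_on D f ->
  exists P, forall z, D z ->
    strict_deriv (V := C_NormedModule) P f z /\
    exists d, 0 < d /\ forall a b, Cmod (a - z) < d -> Cmod (b - z) < d ->
      seg_cont f a b /\ (P b - P a)%C = seg f a b.
Proof.
  intros HO HS Hc Hf. exists (seg f c). intros z Hz.
  destruct (HO z Hz) as (d & Hd & HD).
  assert (Hcont : forall a b, (forall t, 0 <= t <= 1 -> D (seg_path a b t)) ->
    seg_cont f a b).
  { intros a b Hab t Ht. destruct (Hf _ (Hab t Ht)) as [l Hl].
    eapply cdiff_ccont, Hl. }
  assert (Hseg : forall a b, Cmod (a - z) < d -> Cmod (b - z) < d ->
    seg_cont f a b /\ (seg f c b - seg f c a)%C = seg f a b).
  { intros a b Ha Hb.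
    assert (Hab : forall t, 0 <= t <= 1 -> D (seg_path a b t)).
    { intros t Ht. apply HD. now apply disc_segment. }
    split; [now apply Hcont|].
    assert (HG := goursat f c (a - c)%C (b - c)%C).
    replace (c + (a - c))%C with a in HG by ring.
    replace (c + (b - c))%C with b in HG by ring.
    unfold tri in HG. rewrite (seg_rev f c b) in HG.
    2:{ apply Hcont. intros t Ht. apply HS; [|easy].
        rewrite <- (seg_path_1 a b). apply Hab; lra. }
    replace (seg f a b) with
      ((seg f c a + seg f a b + - seg f c b) + (seg f c b - seg f c a))%C by ring.
    rewrite HG; [ring|]. intros x y Hx Hy Hxy. apply Hf.
    (* Every point of the triangle other than [c] is a contraction towards [c] of a point of
       [[a, b]], so starlikeness covers it. *)
    destruct (Req_dec (x + y) 0) as [H0|H0].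
    - replace x with 0 by lra. replace y with 0 by lra.
      replace (_ + _)%C with c by ring. easy.
    - replace (c + x * (a - c) + y * (b - c))%C
        with (c + RtoC (x + y) * (seg_path a b (y / (x + y)) - c))%C.
      + apply HS; [|lra]. apply Hab. split; [apply Rdiv_le_0_compat; lra|].
        apply Rmult_le_reg_r with (x + y); [lra|].
        unfold Rdiv. rewrite Rmult_assoc, Rinv_l; lra.
      + unfold seg_path. rewrite RtoC_div, RtoC_plus by easy. field.
        rewrite <- RtoC_plus. intros E. now apply RtoC_inj in E. }
  split; [|now exists d].
  intros eps He. destruct (Hf z Hz) as [l Hl].
  destruct (cdiff_ccont f z l Hl (eps / 2)) as (d' & Hd' & H'); [lra|].
  exists (Rmin d d'). split; [now apply Rmin_glb_lt|]. intros a b w Ha Hb Hw.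
  destruct (Hseg a b) as [Hc1 Hc2].
  { eapply Rlt_le_trans; [exact Ha|apply Rmin_l]. }
  { eapply Rlt_le_trans; [exact Hb|apply Rmin_l]. }
  change (Cmod (seg f c b - seg f c a - (b - a) * f w) <= eps * Cmod (b - a)).
  rewrite Hc2.
  (* The constant [f w] is written as an affine function with slope 0, so that [seg_affine]
     integrates it. *)
  replace (seg f a b - (b - a) * f w)%C with
    (seg (fun u => f u - (f w + 0 * u))%C a b).
  2:{ rewrite (seg_minus f (fun u => f w + 0 * u)%C)
        by (easy || apply seg_cont_affine).
      rewrite seg_affine. ring. }
  apply seg_bound.
  - apply (seg_cont_minus f (fun u => f w + 0 * u)%C);
      [easy|apply seg_cont_affine].
  - intros t Ht.
    assert (A1 : Cmod (f (seg_path a b t) - f z) <= eps / 2).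
    { apply H'. apply disc_segment; try easy.
      - eapply Rlt_le_trans; [exact Ha|apply Rmin_r].
      - eapply Rlt_le_trans; [exact Hb|apply Rmin_r]. }
    assert (A2 : Cmod (f w - f z) <= eps / 2).
    { apply H'. eapply Rlt_le_trans; [exact Hw|apply Rmin_r]. }
    replace (_ - _)%C with (f (seg_path a b t) - f w)%C by ring.
    eapply Rle_trans; [apply (Cmod_minus_triangle (f z))|].
    rewrite (Cmod_minus_sym (f z)). lra.
Qed.

Definition diff_quot (P f : C -> C) (z w : C) : C :=
  if Ceq_dec w z then f z else ((P w - P z) * / (w - z))%C.

(** The quotient of a primitive is differentiable even at [z], because
    [P w - P z] is the integral of [f] along a segment and [f] is
    differentiable at [z]. *)
Lemma diff_quot_holo (D : C -> Prop) (P f : C -> C) (z : C) :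
  D z -> holo_on D f ->
  (forall z, D z ->
    strict_deriv (V := C_NormedModule) P f z /\
    exists d, 0 < d /\ forall a b, Cmod (a - z) < d -> Cmod (b - z) < d ->
      seg_cont f a b /\ (P b - P a)%C = seg f a b) ->
  holo_on D (diff_quot P f z).
Proof.
  intros Hz Hf HP w Hw. destruct (Ceq_dec w z) as [->|Hwz].
  (* The affine part of [f] at [z] integrates to [f z * (u - z) + l * (u - z) ^ 2 / 2], hence the
     half. *)
  - destruct (Hf z Hz) as [l Hl]. exists (l / 2)%C.
    destruct (HP z Hz) as (_ & d & Hd & Hseg).
    intros eps He. destruct (Hl eps He) as (d' & Hd' & H').
    exists (Rmin d d'). split; [now apply Rmin_glb_lt|]. intros u Hu.
    assert (Hu1 := Rlt_le_trans _ _ _ Hu (Rmin_l _ _)).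
    assert (Hu2 := Rlt_le_trans _ _ _ Hu (Rmin_r _ _)).
    unfold diff_quot. destruct (Ceq_dec z z) as [_|]; [|easy].
    destruct (Ceq_dec u z) as [->|Huz].
    { replace (_ - _)%C with (RtoC 0) by ring. rewrite Cmod_0.
      apply Rmult_le_pos; [lra|apply Cmod_ge_0]. }
    destruct (Hseg z u) as [Hc Hs]; [now rewrite Cminus_diag, Cmod_0|easy|].
    rewrite Hs.
    assert (Hnz := Cminus_neq_0 _ _ Huz).
    replace (seg f z u * / (u - z) - f z - (u - z) * (l / 2))%C with
      (seg (fun v => f v - ((f z - z * l) + l * v))%C z u * / (u - z))%C.
    2:{ rewrite (seg_minus f (fun v => (f z - z * l) + l * v)%C)
          by (easy || apply seg_cont_affine).
        rewrite seg_affine. field. easy. }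
    rewrite Cmod_mult, Cmod_inv by easy.
    assert (Hpos := Cmod_minus_pos _ _ Huz).
    apply Rmult_le_reg_r with (Cmod (u - z)); [easy|].
    rewrite Rmult_assoc, Rinv_l, Rmult_1_r by lra.
    apply seg_bound.
    + apply (seg_cont_minus f (fun v => (f z - z * l) + l * v)%C);
        [easy|apply seg_cont_affine].
    + intros t Ht.
      assert (Hv : Cmod (seg_path z u t - z) <= Cmod (u - z)).
      { replace (seg_path z u t - z)%C with (RtoC t * (u - z))%C
          by (unfold seg_path; ring).
        rewrite Cmod_mult, Cmod_R, Rabs_pos_eq by lra.
        rewrite <- (Rmult_1_l (Cmod (u - z))) at 2.
        apply Rmult_le_compat_r; lra. }
      set (v := seg_path z u t) in *.
      replace (_ - _)%C with (f v - f z - (v - z) * l)%C by ring.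
      eapply Rle_trans; [apply H'; lra|]. apply Rmult_le_compat_l; lra.
  - destruct (HP w Hw) as [Hs _]. apply strict_deriv_cdiff in Hs.
    assert (Hi := strict_deriv_cdiff _ _ _ (strict_deriv_inv z w Hwz)).
    eexists. apply cdiff_ext with (fun u => (P u - P z) * / (u - z))%C (Cmod (w - z)).
    + now apply Cmod_minus_pos.
    + intros u Hu. unfold diff_quot. destruct (Ceq_dec u z) as [->|]; [|easy].
      rewrite Cmod_minus_sym in Hu. lra.
    + apply (cdiff_mult (fun u => P u - P z)%C (fun u => / (u - z))%C); [|exact Hi].
      intros eps He. destruct (Hs eps He) as (d & Hd & H).
      exists d. split; [easy|]. intros u Hu.
      replace (P u - P z - (P w - P z) - (u - w) * f w)%C with
        (P u - P w - (u - w) * f w)%C by ring.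
      now apply H.
Qed.

(** * Operator norms and resolvents *)

Section OperatorNorm.
Context {X : NormedModule C_AbsRing}.

Lemma opnorm_le (S : X -> X) (b : R) :
  0 <= b -> (forall x, norm x <= 1 -> norm (S x) <= b) -> opnorm S <= b.
Proof.
  intros Hb H. unfold opnorm.
  destruct (Lub_Rbar_correct (fun y => exists x : X, norm x <= 1 /\ y = norm (S x)))
    as [_ H2].
  assert (H3 : Rbar_le (Lub_Rbar (fun y => exists x : X,
    norm x <= 1 /\ y = norm (S x))) b).
  { apply H2. intros y (x & Hx & ->). now apply H. }
  destruct (Lub_Rbar _); simpl in *; easy.
Qed.

(** Boundedness of [S] makes the supremum finite; an infinite one would be turned into 0 by
    [real]. *)
Lemma opnorm_bound (S : X -> X) (x : X) : is_linear S ->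
  norm (S x) <= opnorm S * norm x.
Proof.
  intros HS. destruct (linear_norm S HS) as (M & HM & HSM).
  destruct (Req_dec (norm x) 0) as [Hx|Hx].
  - specialize (HSM x). rewrite Hx in *. lra.
  - assert (Hx' : 0 < norm x) by (assert (H := norm_ge_0 x); lra).
    set (u := scal (RtoC (/ norm x)) x).
    assert (Hu : norm u = 1).
    { unfold u. rewrite norm_scal_C, Cmod_R, Rabs_pos_eq.
      - field. lra.
      - left. now apply Rinv_0_lt_compat. }
    assert (Hle : norm (S u) <= opnorm S).
    { unfold opnorm.
      destruct (Lub_Rbar_correct
        (fun y => exists x : X, norm x <= 1 /\ y = norm (S x))) as [H1 H2].
      assert (H3 : Rbar_le (Lub_Rbar (fun y => exists x : X,
        norm x <= 1 /\ y = norm (S x))) M).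
      { apply H2. intros y (v & Hv & ->). simpl.
        eapply Rle_trans; [apply HSM|]. rewrite <- (Rmult_1_r M) at 2.
        apply Rmult_le_compat_l; lra. }
      specialize (H1 (norm (S u)) (ex_intro _ u (conj (Req_le _ _ Hu) eq_refl))).
      destruct (Lub_Rbar _); simpl in *; easy. }
    unfold u in Hle. rewrite (linear_scal S HS) in Hle.
    rewrite (norm_scal_C (V := X)), Cmod_R, Rabs_pos_eq in Hle.
    2:{ left. now apply Rinv_0_lt_compat. }
    apply Rmult_le_compat_r with (r := norm x) in Hle; [|lra].
    rewrite (Rmult_comm (/ norm x)), Rmult_assoc, Rinv_l in Hle; lra.
Qed.

Lemma linear_minus (S : X -> X) (x y : X) : is_linear S ->
  S (minus x y) = minus (S x) (S y).
Proof.
  intros HS. replace (minus x y) with (plus x (scal (RtoC (-1)) y)) by lin_ring.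
  rewrite (linear_plus S HS), (linear_scal S HS). lin_ring.
Qed.

Lemma linear_zero (S : X -> X) : is_linear S -> S zero = zero.
Proof.
  intros HS. transitivity (S (scal (RtoC 0) zero)); [f_equal; lin_ring|].
  rewrite (linear_scal S HS). lin_ring.
Qed.

Lemma linear_bounded_by (S : X -> X) (M : R) :
  (forall x y, S (plus x y) = plus (S x) (S y)) ->
  (forall (c : C) x, S (scal c x) = scal c (S x)) ->
  (forall x, norm (S x) <= M * norm x) -> is_linear S.
Proof.
  intros H1 H2 H3. split; [easy|easy|].
  exists (Rmax M 1). split.
  - apply Rlt_le_trans with 1; [lra|apply Rmax_r].
  - intros x. eapply Rle_trans; [apply H3|].
    apply Rmult_le_compat_r; [apply norm_ge_0|apply Rmax_l].
Qed.

Lemma is_linear_scal_fun (S : X -> X) (c : C) : is_linear S ->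
  is_linear (fun x => scal c (S x)).
Proof.
  intros HS. destruct (linear_norm S HS) as (M & HM & HSM).
  apply linear_bounded_by with (Cmod c * M).
  - intros x y. rewrite (linear_plus S HS). lin_ring.
  - intros a x. rewrite (linear_scal S HS). lin_ring.
  - intros x. rewrite norm_scal_C, Rmult_assoc.
    apply Rmult_le_compat_l; [apply Cmod_ge_0|apply HSM].
Qed.

Lemma is_linear_minus_fun (S S' : X -> X) : is_linear S -> is_linear S' ->
  is_linear (fun x => minus (S x) (S' x)).
Proof.
  intros HS HS'. destruct (linear_norm S HS) as (M & HM & HSM).
  destruct (linear_norm S' HS') as (M' & HM' & HSM').
  apply linear_bounded_by with (M + M').
  - intros x y. rewrite (linear_plus S HS), (linear_plus S' HS'). lin_ring.
  - intros a x. rewrite (linear_scal S HS), (linear_scal S' HS'). lin_ring.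
  - intros x. eapply Rle_trans; [apply norm_minus_le|].
    rewrite Rmult_plus_distr_r. now apply Rplus_le_compat.
Qed.

Lemma is_linear_qsum (h : C -> X -> X) (N : list (C * C)) :
  (forall w z, In (w, z) N -> is_linear (h z)) ->
  is_linear (fun x => qsum N (fun z => h z x)).
Proof.
  induction N as [|[w z] N IH]; intros H; simpl.
  - apply linear_bounded_by with 0.
    + intros x y. lin_ring.
    + intros c x. lin_ring.
    + intros x. rewrite norm_zero. lra.
  - assert (HN : is_linear (fun x => qsum N (fun z => h z x))).
    { apply IH. intros. eapply H. right. eassumption. }
    assert (Hz : is_linear (fun x => scal w (h z x))).
    { apply is_linear_scal_fun. apply (H w). now left. }
    assert (Ho : is_linear (fun x => scal (RtoC (-1)) (qsum N (fun z => h z x)))).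
    { now apply (is_linear_scal_fun (fun x => qsum N (fun z => h z x))). }
    assert (A := is_linear_minus_fun _ _ Hz Ho).
    destruct A as [A1 A2 A3].
    assert (E : forall x, minus (scal w (h z x))
        (scal (RtoC (-1)) (qsum N (fun z => h z x)))
      = plus (scal w (h z x)) (qsum N (fun z => h z x))) by (intros; lin_ring).
    split.
    + intros x y. rewrite <- !E. apply A1.
    + intros c x. rewrite <- !E. apply A2.
    + destruct A3 as (M & HM & A3). exists M. split; [easy|].
      intros x. rewrite <- E. apply A3.
Qed.

Lemma resolvent_spec (T : X -> X) (z : C) :
  (exists S, is_resolvent T z S) -> is_resolvent T z (resolvent z T).
Proof. intros H. unfold resolvent. now apply epsilon_spec. Qed.

(** Stated for two operators and two points: equal operators give the resolvent identity, equal
    points compare the resolvents of [l T] and [m T]. *)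
Lemma resolvent_difference (T T' S S' : X -> X) (z z' : C) (x : X) :
  is_resolvent T z S -> is_resolvent T' z' S' ->
  minus (S x) (S' x)
  = S (minus (minus (scal z' (S' x)) (T' (S' x)))
             (minus (scal z (S' x)) (T (S' x)))).
Proof.
  intros (H1 & H2 & H3) (H1' & H2' & H3').
  rewrite linear_minus by easy. now rewrite H2, H3'.
Qed.

Lemma resolvent_identity (T S S' : X -> X) (z z' : C) (x : X) :
  is_resolvent T z S -> is_resolvent T z' S' ->
  minus (S x) (S' x) = scal (z' - z)%C (S (S' x)).
Proof.
  intros H H'. rewrite (resolvent_difference T T S S' z z' x H H').
  destruct H as (H1 & _). rewrite <- (linear_scal S H1). f_equal. lin_ring.
Qed.

Lemma resolvent_unique (T S S' : X -> X) (z : C) (x : X) :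
  is_resolvent T z S -> is_resolvent T z S' -> S x = S' x.
Proof.
  intros H H'. apply norm_minus_eq_0.
  rewrite (resolvent_identity T S S' z z x H H').
  replace (scal _ _) with (@zero X) by lin_ring. rewrite norm_zero. lra.
Qed.
End OperatorNorm.

(** * Neumann series and perturbation of resolvents *)

Section Neumann.
Context {X : NormedModule C_AbsRing}.
Hypothesis X_complete : norm_complete X.

Lemma geometric_series (a : nat -> X) (q b : R) : 0 <= q < 1 -> 0 <= b ->
  (forall n, norm (a n) <= q ^ n * b) ->
  exists s : nat -> X, s O = a O /\ (forall n, s (S n) = plus (s n) (a (S n))) /\
  exists y, forall eps, 0 < eps -> exists N, forall n, (N <= n)%nat ->
    norm (minus (s n) y) <= eps.
Proof.
  intros Hq Hb Ha.
  set (s := fix s n := match n with O => a O | S m => plus (s m) (a (S m)) end).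
  exists s. split; [easy|]. split; [easy|]. apply X_complete.
  assert (Hs : forall n k, norm (minus (s (n + k)%nat) (s n))
    <= q ^ n * b / (1 - q) - q ^ (n + k) * b / (1 - q)).
  { intros n k. induction k as [|k IH].
    - rewrite Nat.add_0_r. replace (minus _ _) with (@zero X) by lin_ring.
      rewrite norm_zero. lra.
    - rewrite Nat.add_succ_r. cbn [s].
      replace (minus _ _) with
        (plus (minus (s (n + k)%nat) (s n)) (a (S (n + k)))) by lin_ring.
      eapply Rle_trans; [apply norm_plus_le|].
      assert (H := Ha (S (n + k))). simpl in H |- *.
      assert (Hm : 0 <= (1 - q) * (q ^ (n + k) * b)).
      { repeat apply Rmult_le_pos; try lra. apply pow_le; lra. }
      replace (q ^ n * b / (1 - q) - q * q ^ (n + k) * b / (1 - q)) with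
        (q ^ n * b / (1 - q) - q ^ (n + k) * b / (1 - q) + q ^ (n + k) * b)
        by (field; lra).
      assert (q * q ^ (n + k) * b <= q ^ (n + k) * b).
      { rewrite Rmult_assoc. rewrite <- (Rmult_1_l (q ^ (n + k) * b)) at 2.
        apply Rmult_le_compat_r; [|lra]. apply Rmult_le_pos; [apply pow_le|]; lra. }
      lra. }
  intros eps He. destruct (le_scaled_eps (b / (1 - q)) (eps / 2)) as [E1 E2];
    [apply Rdiv_le_0_compat; lra|lra|].
  destruct (pow_lt_1_zero q) with (y := eps / 2 / (b / (1 - q) + 1)) as [N HN];
    [rewrite Rabs_pos_eq; lra|exact E1|].
  exists N.
  assert (HNn : forall n, (N <= n)%nat -> norm (minus (s n) (s N)) <= eps / 2).
  { intros n Hn. replace n with (N + (n - N))%nat by lia.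
    eapply Rle_trans; [apply Hs|].
    specialize (HN N (le_n _)). rewrite Rabs_pos_eq in HN by (apply pow_le; lra).
    assert (Hq2 : 0 <= q ^ (N + (n - N)) * b / (1 - q)).
    { apply Rdiv_le_0_compat; [|lra]. apply Rmult_le_pos; [apply pow_le; lra|easy]. }
    assert (q ^ N * b / (1 - q) <= eps / 2); [|lra].
    eapply Rle_trans; [|exact E2].
    unfold Rdiv at 1. rewrite Rmult_assoc. apply Rmult_le_compat_r; [|lra].
    apply Rdiv_le_0_compat; lra. }
  intros n m Hn Hm. eapply Rle_trans; [apply (norm_minus_triangle (s N))|].
  rewrite (norm_minus_sym (s N)).
  assert (H1 := HNn n Hn). assert (H2 := HNn m Hm). lra.
Qed.

(** The partial sums of the powers [A^n x] solve the equation up to [A^(n+1) x], which tends to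
    zero. *)
Lemma neumann_solution (A : X -> X) (q : R) (x : X) :
  is_linear A -> 0 <= q < 1 -> (forall y, norm (A y) <= q * norm y) ->
  exists y, minus y (A y) = x.
Proof.
  intros HA Hq Hn.
  set (a := fun n => Nat.iter n A x).
  assert (Ha : forall n, norm (a n) <= q ^ n * norm x).
  { induction n as [|n IH]; simpl; [lra|].
    eapply Rle_trans; [apply Hn|]. rewrite Rmult_assoc.
    apply Rmult_le_compat_l; [lra|exact IH]. }
  destruct (geometric_series a q (norm x) Hq (norm_ge_0 x) Ha)
    as (s & Hs0 & HsS & y & Hy).
  exists y. apply norm_minus_small. intros eps He.
  assert (Hs : forall n, minus (s n) (A (s n)) = minus x (a (S n))).
  { induction n as [|n IH].
    - rewrite Hs0. reflexivity.
    - rewrite HsS, (linear_plus A HA).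
      replace (minus _ _) with (plus (minus (s n) (A (s n)))
        (minus (a (S n)) (A (a (S n))))) by lin_ring.
      rewrite IH. change (A (a (S n))) with (a (S (S n))). lin_ring. }
  destruct (Hy (eps / 3)) as [N1 HN1]; [lra|].
  assert (Hx := norm_ge_0 x).
  destruct (le_scaled_eps (norm x) (eps / 3)) as [E1 E2]; [easy|lra|].
  destruct (pow_lt_1_zero q) with (y := eps / 3 / (norm x + 1)) as [N2 HN2];
    [rewrite Rabs_pos_eq; lra|exact E1|].
  set (n := Nat.max N1 N2).
  assert (B1 : norm (minus (s n) y) <= eps / 3)
    by (apply HN1; unfold n; lia).
  assert (B2 : norm (a (S n)) <= eps / 3).
  { eapply Rle_trans; [apply Ha|]. eapply Rle_trans; [|exact E2].
    apply Rmult_le_compat_r; [easy|].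
    specialize (HN2 (S n) ltac:(unfold n; lia)).
    rewrite Rabs_pos_eq in HN2; [lra|]. apply pow_le; lra. }
  assert (Ex : minus (minus y (A y)) x =
    minus (minus (A (minus (s n) y)) (minus (s n) y)) (a (S n))).
  { assert (E := Hs n). rewrite (linear_minus A) by easy.
    transitivity (minus (minus y (A y))
      (plus (minus (s n) (A (s n))) (a (S n)))); [|lin_ring].
    f_equal. rewrite E. lin_ring. }
  rewrite Ex.
  eapply Rle_trans; [apply norm_minus_le|].
  apply Rle_trans with ((eps / 3 + eps / 3) + eps / 3); [|lra].
  apply Rplus_le_compat; [|exact B2].
  eapply Rle_trans; [apply norm_minus_le|]. apply Rplus_le_compat; [|lra].
  eapply Rle_trans; [apply Hn|].
  assert (H0 := norm_ge_0 (minus (s n) y)).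
  apply Rle_trans with (1 * norm (minus (s n) y)); [|lra].
  apply Rmult_le_compat_r; lra.
Qed.

(** With [A = (z0 - z) S0] one has [z - T = (1 - A) (z0 - T)], so the resolvent at [z] is [S0] after
    the inverse of [1 - A]. That inverse is chosen vector by vector; its linearity comes from
    injectivity of [1 - A]. *)
Lemma resolvent_perturbation (T S0 : X -> X) (z0 z : C) (M q : R) :
  is_resolvent T z0 S0 -> 0 <= M -> (forall x, norm (S0 x) <= M * norm x) ->
  Cmod (z - z0) * M <= q -> 0 <= q < 1 ->
  exists S, is_resolvent T z S /\ forall x, norm (S x) <= M / (1 - q) * norm x.
Proof.
  intros (L0 & H2 & H3) HM0 HM Hzq Hq.
  set (A := fun y => scal (z0 - z)%C (S0 y)).
  assert (HA : is_linear A) by now apply is_linear_scal_fun.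
  assert (HAn : forall y, norm (A y) <= q * norm y).
  { intros y. unfold A. rewrite norm_scal_C, Cmod_minus_sym.
    apply Rle_trans with (Cmod (z - z0) * (M * norm y)).
    - apply Rmult_le_compat_l; [apply Cmod_ge_0|apply HM].
    - rewrite <- Rmult_assoc. apply Rmult_le_compat_r; [apply norm_ge_0|easy]. }
  assert (Hinj : forall y, norm y <= norm (minus y (A y)) / (1 - q)).
  { intros y. assert (H := norm_le_minus y (A y)). assert (H' := HAn y).
    apply Rmult_le_reg_r with (1 - q); [lra|].
    unfold Rdiv. rewrite Rmult_assoc, Rinv_l by lra. lra. }
  assert (Huniq : forall y y', minus y (A y) = minus y' (A y') -> y = y').
  { intros y y' E. apply norm_minus_eq_0.
    eapply Rle_trans; [apply Hinj|].
    rewrite (linear_minus A) by easy.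
    replace (minus _ _) with (minus (minus y (A y)) (minus y' (A y'))) by lin_ring.
    rewrite E. replace (minus _ _) with (@zero X) by lin_ring.
    rewrite norm_zero. unfold Rdiv. lra. }
  destruct (choice (fun x y => minus y (A y) = x)) as [N HN].
  { intros x. now apply neumann_solution with q. }
  assert (HS : forall x, norm (S0 (N x)) <= M / (1 - q) * norm x).
  { intros x. eapply Rle_trans; [apply HM|].
    unfold Rdiv. rewrite Rmult_assoc. apply Rmult_le_compat_l; [easy|].
    rewrite Rmult_comm. rewrite <- (HN x) at 2. apply Hinj. }
  exists (fun x => S0 (N x)). split; [|exact HS].
  split; [|split].
  - apply linear_bounded_by with (M / (1 - q)); [| |exact HS].
    + intros x y. rewrite <- (linear_plus S0 L0). f_equal. apply Huniq.
      rewrite HN, (linear_plus A HA).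
      rewrite <- (HN x) at 1. rewrite <- (HN y) at 1. lin_ring.
    + intros c x. rewrite <- (linear_scal S0 L0). f_equal. apply Huniq.
      rewrite HN, (linear_scal A HA). rewrite <- (HN x) at 1. lin_ring.
  - intros x. transitivity (S0 (minus (scal z0 x) (T x))); [|apply H2].
    f_equal. apply Huniq. rewrite HN.
    unfold A. rewrite H2. lin_ring.
  - intros x. transitivity (minus (N x) (A (N x))); [|apply HN].
    transitivity (minus (minus (scal z0 (S0 (N x))) (T (S0 (N x)))) (A (N x)));
      [unfold A; lin_ring|]. now rewrite H3.
Qed.
End Neumann.

(** * The convex domains *)

(** For [0 <= s < 1] the closed set is the convex hull of [1] and the closed
    disc of radius [s], as a union of discs shrinking towards [1]. *)
Definition Kset (s : R) (z : C) : Prop :=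
  exists t, 0 <= t <= 1 /\ Cmod (z - t) <= (1 - t) * s.

Definition Bset (s : R) (z : C) : Prop :=
  exists t, 0 <= t < 1 /\ Cmod (z - t) < (1 - t) * s.

Lemma Cmod_sqr (z : C) : Cmod z ^ 2 = Re z ^ 2 + Im z ^ 2.
Proof. apply Cmod2_alt. Qed.

Lemma Cmod_le_sqr (z : C) (r : R) : 0 <= r ->
  Re z ^ 2 + Im z ^ 2 <= r ^ 2 -> Cmod z <= r.
Proof.
  intros Hr H. rewrite <- Cmod_sqr in H. rewrite <- !Rsqr_pow2 in H.
  now apply Rsqr_incr_0_var.
Qed.

Lemma Cmod_RtoC_minus (s t : R) : Cmod (RtoC s - RtoC t) = Rabs (s - t).
Proof. now rewrite <- RtoC_minus, Cmod_R. Qed.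

Lemma Kset_convex (s : R) : convex_set (Kset s).
Proof.
  intros z w u (t1 & Ht1 & H1) (t2 & Ht2 & H2) Hu.
  exists ((1 - u) * t1 + u * t2). split.
  - split.
    + apply Rplus_le_le_0_compat; apply Rmult_le_pos; lra.
    + assert (0 <= (1 - u) * (1 - t1)) by (apply Rmult_le_pos; lra).
      assert (0 <= u * (1 - t2)) by (apply Rmult_le_pos; lra). lra.
  - replace (_ - _)%C with (RtoC (1 - u) * (z - t1) + RtoC u * (w - t2))%C
      by (rewrite RtoC_plus, !RtoC_mult, RtoC_minus; ring).
    eapply Rle_trans; [apply Cmod_triangle|].
    rewrite !Cmod_mult, !Cmod_R, !Rabs_pos_eq by lra.
    apply Rle_trans with ((1 - u) * ((1 - t1) * s) + u * ((1 - t2) * s)).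
    + apply Rplus_le_compat; apply Rmult_le_compat_l; lra.
    + right. ring.
Qed.

Lemma Kset_one (s : R) : Kset s 1.
Proof.
  exists 1. split; [lra|]. rewrite Cminus_diag, Cmod_0. lra.
Qed.

Lemma Kset_disc (s : R) (z : C) : Cmod z <= s -> Kset s z.
Proof.
  intros H. exists 0. split; [lra|].
  replace (z - 0)%C with z by ring. lra.
Qed.

Lemma hull_Kset (eta : R) (z : C) :
  convex_hull (fun w => w = RtoC 1 \/ Defs.disc (RtoC 0) (sin eta) w) z ->
  Kset (sin eta) z.
Proof.
  intros H. apply H; [apply Kset_convex|].
  intros w [->|Hw]; [apply Kset_one|].
  unfold Defs.disc in Hw. replace (w - 0)%C with w in Hw by ring.
  apply Kset_disc. lra.
Qed.

(** Scaling back from the expanded point leaves a margin [d * s] in the radius, which makes the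
    inequality strict. *)
Lemma shrink_Kset (s d : R) (z : C) : 0 < s -> 0 < d ->
  Kset s (RtoC (1 + d) * z)%C -> Bset s z.
Proof.
  intros Hs Hd (t & Ht & H). exists (t / (1 + d)).
  assert (Ht' : t / (1 + d) < 1).
  { apply Rmult_lt_reg_r with (1 + d); [lra|].
    unfold Rdiv. rewrite Rmult_assoc, Rinv_l; lra. }
  split; [split; [apply Rdiv_le_0_compat; lra|easy]|].
  apply Rmult_lt_reg_l with (1 + d); [lra|].
  replace ((1 + d) * Cmod (z - RtoC (t / (1 + d))))
    with (Cmod (RtoC (1 + d) * z - t)).
  - eapply Rle_lt_trans; [exact H|].
    replace ((1 + d) * ((1 - t / (1 + d)) * s)) with ((1 - t) * s + d * s)
      by (field; lra).
    assert (0 < d * s) by now apply Rmult_lt_0_compat. lra.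
  - replace (RtoC (1 + d) * z - t)%C with (RtoC (1 + d) * (z - RtoC (t / (1 + d))))%C.
    + rewrite Cmod_mult, Cmod_R, Rabs_pos_eq; lra.
    + replace (RtoC t) with (RtoC (1 + d) * RtoC (t / (1 + d)))%C.
      * ring.
      * rewrite <- RtoC_mult. f_equal. field. lra.
Qed.

Lemma Bset_open (s : R) : C_open (Bset s).
Proof.
  intros z (t & Ht & H). exists ((1 - t) * s - Cmod (z - t)). split; [lra|].
  intros w Hw. exists t. split; [easy|].
  assert (A := Cmod_minus_triangle z w t). lra.
Qed.

Lemma locally_C_ball (z : C) (P : C -> Prop) (d : R) : 0 < d ->
  (forall w, Cmod (w - z) < d -> P w) -> locally (T := C_UniformSpace) z P.
Proof.
  intros Hd H. apply locally_C. exists (mkposreal d Hd). intros w Hw. now apply H.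
Qed.

Lemma locally_C_elim (z : C) (P : C -> Prop) : locally (T := C_UniformSpace) z P ->
  exists d, 0 < d /\ forall w, Cmod (w - z) < d -> P w.
Proof.
  intros H. apply locally_C in H. destruct H as [d Hd]. exists d.
  split; [apply cond_pos|]. intros w Hw. apply Hd. exact Hw.
Qed.

(** An interior point can be expanded from 0 within the hull, which gives strictness. Conversely, a
    point of the disc about [t] is a convex combination of 1, with weight [t], and of a point of the
    disc about 0. *)
Lemma B_Bset (eta : R) (z : C) : 0 < sin eta -> (B eta z <-> Bset (sin eta) z).
Proof.
  intros Hs. split.
  - intros H. apply locally_C_elim in H. destruct H as (d & Hd & H).
    destruct (le_scaled_eps (Cmod z) (d / 2)) as [E1 E2];
      [apply Cmod_ge_0|lra|].
    apply shrink_Kset with (d / 2 / (Cmod z + 1)); [easy..|].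
    apply hull_Kset, H.
    replace (_ - z)%C with (RtoC (d / 2 / (Cmod z + 1)) * z)%C
      by (rewrite RtoC_plus; ring).
    rewrite Cmod_mult, Cmod_R, Rabs_pos_eq; lra.
  - intros H. destruct (Bset_open _ z H) as (d & Hd & H').
    apply locally_C_ball with d; [easy|]. intros w Hw.
    destruct (H' w Hw) as (t & Ht & Hwt). intros K HK HA.
    replace w with (RtoC (1 - t) * ((w - t) * RtoC (/ (1 - t))) + RtoC t * 1)%C.
    + apply HK; [|apply HA; now left|lra]. apply HA. right.
      unfold Defs.disc. replace (_ - 0)%C with ((w - t) * RtoC (/ (1 - t)))%C by ring.
      rewrite Cmod_mult, Cmod_R, Rabs_pos_eq
        by (left; apply Rinv_0_lt_compat; lra).
      apply Rmult_lt_reg_r with (1 - t); [lra|].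
      rewrite Rmult_assoc, Rinv_l; lra.
    + replace (RtoC (1 - t) * ((w - t) * RtoC (/ (1 - t))))%C
        with ((RtoC (1 - t) * RtoC (/ (1 - t))) * (w - t))%C by ring.
      rewrite <- RtoC_mult, Rinv_r by lra. ring.
Qed.

Lemma lipschitz_continuity (f : R -> R) (L : R) :
  (forall x y, Rabs (f x - f y) <= L * Rabs (x - y)) -> continuity f.
Proof.
  intros H x eps He.
  assert (HL : 0 <= L).
  { specialize (H 1 0). rewrite (Rminus_0_r 1), Rabs_R1 in H.
    assert (A := Rabs_pos (f 1 - f 0)). lra. }
  destruct (le_scaled_eps L (eps / 2)) as [E1 E2]; [easy|lra|].
  exists (eps / 2 / (L + 1)). split; [exact E1|].
  intros y [_ Hy]. simpl in *. unfold R_dist in *.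
  eapply Rle_lt_trans; [apply H|].
  apply Rle_lt_trans with (eps / 2); [|lra].
  eapply Rle_trans; [|exact E2]. rewrite Rmult_comm.
  apply Rmult_le_compat_r; lra.
Qed.

(** The continuous function [|z - t| - (1 - t) s] of [t] attains its minimum on [[0,1]]; off the set
    this minimum is positive and serves as the radius. *)
Lemma Kset_closed (s : R) (z : C) : 0 <= s -> ~ Kset s z ->
  exists d, 0 < d /\ forall w, Cmod (w - z) < d -> ~ Kset s w.
Proof.
  intros Hs Hz. set (f := fun t : R => Cmod (z - t) - (1 - t) * s).
  assert (Hf : continuity f).
  { apply lipschitz_continuity with (1 + s). intros x y. unfold f.
    replace (Cmod (z - x) - (1 - x) * s - (Cmod (z - y) - (1 - y) * s)) with
      ((Cmod (z - x) - Cmod (z - y)) + (x - y) * s) by ring.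
    eapply Rle_trans; [apply Rabs_triang|].
    rewrite Rabs_mult, (Rabs_pos_eq s) by easy.
    assert (Rabs (Cmod (z - x) - Cmod (z - y)) <= Rabs (x - y)); [|lra].
    rewrite <- (Cmod_RtoC_minus x y).
    assert (A1 := Cmod_minus_triangle y z x).
    assert (A2 := Cmod_minus_triangle x z y).
    rewrite (Cmod_minus_sym y x) in A1.
    apply Rabs_le_between. lra. }
  destruct (continuity_ab_min f 0 1) as (t0 & Hmin & Ht0); [lra|auto|].
  assert (Hpos : 0 < f t0).
  { unfold f. apply Rnot_le_lt. intros Hle. apply Hz. exists t0. split; [easy|lra]. }
  exists (f t0). split; [easy|]. intros w Hw (t & Ht & Hwt).
  specialize (Hmin t Ht). unfold f in Hmin at 2.
  assert (A := Cmod_minus_triangle w z t). rewrite (Cmod_minus_sym z w) in A. lra.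
Qed.

Lemma sin_pos_acute (eta : R) : 0 < eta < PI / 2 -> 0 < sin eta.
Proof. intros H. apply sin_gt_0; [easy|]. assert (A := PI_RGT_0). lra. Qed.

Lemma sin_lt_1_acute (eta : R) : 0 <= eta < PI / 2 -> sin eta < 1.
Proof.
  intros H. rewrite <- sin_PI2. assert (A := PI_RGT_0). apply sin_increasing_1; lra.
Qed.

(** [Kset 0] is the segment [[0,1]], so one description absorbs the convention for the angle 0 and
    [theta T = 0] needs no separate treatment later. *)
Lemma closedB_Kset (eta : R) (z : C) : 0 <= eta < PI / 2 ->
  (closedB eta z <-> Kset (sin eta) z).
Proof.
  intros He. unfold closedB. split.
  - intros [[-> (t & Ht & ->)]|[H0 H]].
    + exists t. split; [easy|]. rewrite sin_0, Cminus_diag, Cmod_0. lra.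
    + assert (Hs : 0 < sin eta) by (apply sin_pos_acute; lra).
      apply NNPP. intros Hz.
      destruct (Kset_closed (sin eta) z) as (d & Hd & H'); [lra|easy|].
      destruct (H (mkposreal d Hd)) as (w & Hw & Hwz).
      apply (H' w Hwz). apply B_Bset in Hw; [|easy].
      destruct Hw as (t & Ht & Hwt). exists t. lra.
  - intros (t & Ht & H). destruct (Req_dec eta 0) as [->|H0].
    + left. split; [easy|]. exists t. split; [easy|].
      rewrite sin_0, Rmult_0_r in H.
      assert (E : (z - t)%C = 0).
      { apply Cmod_eq_0. assert (A := Cmod_ge_0 (z - t)). lra. }
      replace z with ((z - t) + t)%C by ring. rewrite E. ring.
    + right. split; [easy|]. intros eps.
      assert (Hs : 0 < sin eta) by (apply sin_pos_acute; lra).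
      assert (Hz := Cmod_ge_0 z). assert (Heps := cond_pos eps).
      set (d := Rmin (/ 2) (eps / (2 * (Cmod z + 1)))).
      assert (Hd : 0 < d).
      { apply Rmin_glb_lt; [lra|]. apply Rdiv_lt_0_compat; lra. }
      assert (Hd1 : d <= / 2) by apply Rmin_l.
      assert (Hd2 : d <= eps / (2 * (Cmod z + 1))) by apply Rmin_r.
      exists (RtoC (1 - d) * z)%C. split.
      * apply B_Bset; [easy|]. exists ((1 - d) * t). split; [split|].
        -- apply Rmult_le_pos; lra.
        -- assert ((1 - d) * t <= (1 - d) * 1) by (apply Rmult_le_compat_l; lra). lra.
        -- replace (_ - _)%C with (RtoC (1 - d) * (z - t))%C
             by (rewrite RtoC_mult; ring).
           rewrite Cmod_mult, Cmod_R, Rabs_pos_eq by lra.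
           apply Rle_lt_trans with ((1 - d) * ((1 - t) * sin eta)).
           ++ apply Rmult_le_compat_l; lra.
           ++ assert (0 < d * sin eta) by now apply Rmult_lt_0_compat. lra.
      * unfold Defs.disc. replace (_ - z)%C with (RtoC (- d) * z)%C
          by (rewrite RtoC_opp, RtoC_minus; ring).
        rewrite Cmod_mult, Cmod_R, Rabs_Ropp, Rabs_pos_eq by lra.
        apply Rle_lt_trans with (d * (Cmod z + 1)); [lra|].
        apply Rmult_le_compat_r with (r := Cmod z + 1) in Hd2; [|lra].
        replace (eps / (2 * (Cmod z + 1)) * (Cmod z + 1)) with (eps / 2) in Hd2
          by (field; lra). lra.
Qed.

(** Each disc is contracted about its own center [t] by the ratio [s / s'], which moves its points
    by at most [(1 - t) * (s' - s)]. *)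
Lemma Kset_near (s s' : R) (z : C) : 0 <= s <= s' -> Kset s' z ->
  exists w, Kset s w /\ Cmod (z - w) <= s' - s.
Proof.
  intros Hs (t & Ht & H).
  destruct (Req_dec s' 0) as [H0|H0].
  { exists z. replace s with s' by lra. split; [now exists t|].
    rewrite Cminus_diag, Cmod_0. lra. }
  exists (t + RtoC (s / s') * (z - t))%C.
  assert (Hq : 0 <= s / s') by (apply Rdiv_le_0_compat; lra).
  split.
  - exists t. split; [easy|]. replace (_ - _)%C with (RtoC (s / s') * (z - t))%C by ring.
    rewrite Cmod_mult, Cmod_R, Rabs_pos_eq by easy.
    apply Rle_trans with (s / s' * ((1 - t) * s')).
    + now apply Rmult_le_compat_l.
    + right. field. lra.
  - replace (_ - _)%C with (RtoC (1 - s / s') * (z - t))%C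
      by (rewrite RtoC_minus; ring).
    assert (Hq1 : s / s' <= 1).
    { apply Rmult_le_reg_r with s'; [lra|]. unfold Rdiv.
      rewrite Rmult_assoc, Rinv_l; lra. }
    rewrite Cmod_mult, Cmod_R, Rabs_pos_eq by lra.
    apply Rle_trans with ((1 - s / s') * s').
    + apply Rmult_le_compat_l; [lra|]. eapply Rle_trans; [exact H|].
      rewrite <- (Rmult_1_l s') at 2. apply Rmult_le_compat_r; lra.
    + right. field. easy.
Qed.

Lemma Re_minus_R (z : C) (t : R) : Re (z - t)%C = Re z - t.
Proof. unfold Re; simpl; ring. Qed.

Lemma Im_minus_R (z : C) (t : R) : Im (z - t)%C = Im z.
Proof. unfold Im; simpl; ring. Qed.

(** Outside the sector at [1] tangent to the disc, [z0] is chosen on the line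
    [Re = 1] so that [z0 - z] is orthogonal to [z - 1]; inside the sector, it is
    the radial projection of [z] to the unit circle. *)
Lemma outside_Kset (s : R) (z : C) : 0 < s < 1 -> ~ Kset s z -> Cmod z <= 1 ->
  exists z0, 1 <= Cmod z0 /\ z0 <> 1 /\
    Cmod (z - z0) <= sqrt (1 - s ^ 2) * Cmod (z0 - 1).
Proof.
  intros Hs Hz Hz1. set (k := sqrt (1 - s ^ 2)).
  assert (Hk2 : k ^ 2 = 1 - s ^ 2).
  { unfold k. rewrite pow2_sqrt; nra. }
  assert (Hk : 0 < k) by (unfold k; apply sqrt_lt_R0; nra).
  set (x := Re z). set (y := Im z). set (a := 1 - x).
  assert (Hz2 : x ^ 2 + y ^ 2 <= 1).
  { unfold x, y. rewrite <- Cmod_sqr. assert (A := Cmod_ge_0 z). nra. }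
  assert (Ha : 0 <= a) by (unfold a; nra).
  assert (Hy := Rabs_pos y). assert (Hy2 := pow2_abs y).
  (* The tangent sector at 1 has a half-angle with sine [s] and cosine [k]; the inequality says that
     [z] lies outside it. *)
  destruct (Rlt_dec (a * s) (Rabs y * k)) as [Hout|Hin].
  - assert (Hy0 : y <> 0).
    { intros E. rewrite E, Rabs_R0 in Hout. nra. }
    (* The solution of the orthogonality condition [b * y = a ^ 2 + y ^ 2] for [z0 = (1, b)]. *)
    set (b := (a ^ 2 + y ^ 2) / y).
    assert (Hyp : 0 < y ^ 2) by (apply pow2_gt_0; easy).
    assert (Hb : b ^ 2 = (a ^ 2 + y ^ 2) ^ 2 / y ^ 2) by (unfold b; field; easy).
    assert (Hb0 : b <> 0).
    { intros E. assert (E2 : b * y = a ^ 2 + y ^ 2) by (unfold b; field; easy).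
      rewrite E in E2. nra. }
    exists (1, b). repeat split.
    + assert (A := Cmod_sqr (1, b)). unfold Re, Im in A. cbn [fst snd] in A. assert (A' := Cmod_ge_0 (1, b)).
      nra.
    + intros E. injection E. easy.
    + assert (Hb' : Cmod ((1, b) - 1) ^ 2 = b ^ 2) by (rewrite Cmod_sqr; unfold Re, Im; simpl; ring).
      apply Cmod_le_sqr; [apply Rmult_le_pos; [lra|apply Cmod_ge_0]|].
      rewrite Rpow_mult_distr, Hb', Hk2, Hb.
      replace (Re (z - (1, b))) with (- a) by (unfold a, x, Re; simpl; ring).
      replace (Im (z - (1, b))) with (y - b) by (unfold y, Re, Im; simpl; ring).
      replace ((- a) ^ 2 + (y - b) ^ 2) with ((a ^ 2 * (a ^ 2 + y ^ 2)) / y ^ 2)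
        by (unfold b; field; easy).
      unfold Rdiv. rewrite <- Rmult_assoc.
      apply Rmult_le_compat_r; [left; now apply Rinv_0_lt_compat|].
      assert (Hsq : (a * s) ^ 2 <= (Rabs y * k) ^ 2).
      { apply pow_incr. split; [apply Rmult_le_pos; lra|lra]. }
      rewrite !Rpow_mult_distr, Hy2, Hk2 in Hsq.
      assert (0 <= a ^ 2) by apply pow2_ge_0. nra.
  - apply Rnot_lt_le in Hin.
    assert (Hxy : x * k < Rabs y * s).
    { apply Rnot_le_lt. intros Hle. apply Hz.
      (* The point where the normal through [z] to the nearer side of the sector meets the real
         axis. If it were nonnegative, the disc of the set about [t] would contain [z]. *)
      set (t := x - Rabs y * s / k).
      assert (Hys : 0 <= Rabs y * s / k).
      { apply Rdiv_le_0_compat; [apply Rmult_le_pos; lra|easy]. }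
      exists t. split; [split|].
      - assert (Rabs y * s / k <= x); [|unfold t; lra].
        apply Rmult_le_reg_r with k; [easy|].
        unfold Rdiv. rewrite Rmult_assoc, Rinv_l; lra.
      - unfold t, a in *. lra.
      - assert (Ht1 : (1 - t) * s * k = a * s * k + Rabs y * s ^ 2).
        { unfold t, a. field. lra. }
        assert (Ht1' : Rabs y <= (1 - t) * s * k).
        { rewrite Ht1. assert (Rabs y * k * k <= a * s * k)
            by (apply Rmult_le_compat_r; lra).
          assert (E : Rabs y * k * k = Rabs y * (1 - s ^ 2)) by (rewrite <- Hk2; ring).
          lra. }
        apply Cmod_le_sqr.
        + apply Rmult_le_reg_r with k; [easy|]. lra.
        + rewrite Re_minus_R, Im_minus_R. fold x y.
          replace ((x - t) ^ 2 + y ^ 2) with (y ^ 2 / k ^ 2).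
          * apply Rmult_le_reg_r with (k ^ 2); [now apply pow_lt|].
            unfold Rdiv. rewrite Rmult_assoc, Rinv_l by (apply pow_nonzero; lra).
            rewrite <- Hy2, Rmult_1_r, <- Rpow_mult_distr.
            apply pow_incr. lra.
          * unfold t. rewrite <- Hy2.
            replace ((x - (x - Rabs y * s / k)) ^ 2) with (Rabs y ^ 2 * s ^ 2 / k ^ 2)
              by (field; lra).
            rewrite <- (Rmult_1_r (Rabs y ^ 2)) at 1.
            replace 1 with (s ^ 2 + k ^ 2) by lra. field. lra. }
    assert (Hm : s < Cmod z).
    { apply Rnot_le_lt. intros Hle. apply Hz. now apply Kset_disc. }
    set (m := Cmod z) in *.
    assert (Hm2 : m ^ 2 = x ^ 2 + y ^ 2) by apply Cmod_sqr.
    assert (Hxm : x <= s * m).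
    { destruct (Rle_dec x 0) as [Hx|Hx]; [nra|].
      assert (Hsq : (x * k) ^ 2 <= (Rabs y * s) ^ 2) by (apply pow_incr; nra).
      rewrite !Rpow_mult_distr, Hk2, Hy2 in Hsq.
      assert (x ^ 2 <= (s * m) ^ 2) by (rewrite Rpow_mult_distr, Hm2; nra).
      rewrite <- !Rsqr_pow2 in H. apply Rsqr_incr_0_var; [easy|nra]. }
    exists (RtoC (/ m) * z)%C.
    assert (Hmi : 0 < / m) by (apply Rinv_0_lt_compat; lra).
    assert (Hmm : / m * m = 1) by (apply Rinv_l; lra).
    assert (HR : Re (RtoC (/ m) * z)%C = / m * x) by (unfold x, Re; simpl; ring).
    assert (HI : Im (RtoC (/ m) * z)%C = / m * y) by (unfold y, Re, Im; simpl; ring).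
    assert (Hux : / m * x <= s).
    { apply Rmult_le_compat_l with (r := / m) in Hxm; nra. }
    assert (Hn : Cmod (RtoC (/ m) * z) = 1).
    { rewrite Cmod_mult, Cmod_R, Rabs_pos_eq by lra. exact Hmm. }
    (* The projected point has modulus 1 and real part at most [s]. Its distance to [z] is
       [1 - m < 1 - s], and [(1 - s) ^ 2 <= (1 - s ^ 2) * (2 * (1 - s))]. *)
    assert (Hd : 2 * (1 - s) <= Cmod (RtoC (/ m) * z - 1) ^ 2).
    { rewrite Cmod_sqr, Re_minus_R, Im_minus_R, HR, HI.
      assert (E : (/ m * x) ^ 2 + (/ m * y) ^ 2 = 1).
      { rewrite !Rpow_mult_distr, <- Rmult_plus_distr_l, <- Hm2,
          <- Rpow_mult_distr, Hmm. ring. }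
      nra. }
    repeat split.
    + rewrite Hn. lra.
    + intros E. rewrite E, Cminus_diag, Cmod_0 in Hd. nra.
    + replace (z - RtoC (/ m) * z)%C with (RtoC (1 - / m) * z)%C
        by (rewrite RtoC_minus; ring).
      rewrite Cmod_mult, Cmod_R. fold m.
      assert (Hm1 : 1 <= / m).
      { rewrite <- Rinv_1. apply Rinv_le_contravar; lra. }
      rewrite Rabs_left1 by lra.
      replace (- (1 - / m) * m) with (1 - m) by (field_simplify; lra).
      apply Rsqr_incr_0_var; [|apply Rmult_le_pos; [lra|apply Cmod_ge_0]].
      rewrite !Rsqr_pow2, Rpow_mult_distr, Hk2.
      apply Rmult_le_compat_l with (r := 1 - s ^ 2) in Hd; [|nra].
      eapply Rle_trans; [|exact Hd].
      apply Rle_trans with ((1 - s) ^ 2); [apply pow_incr; lra|].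
      assert (0 <= (1 - s) ^ 2) by apply pow2_ge_0. nra.
Qed.

(** * Resolvents of Tadmor-Ritt operators *)

Lemma Lub_Rbar_ge (E : R -> Prop) (y : R) :
  is_finite (Lub_Rbar E) -> E y -> y <= real (Lub_Rbar E).
Proof.
  intros HF Hy. destruct (Lub_Rbar_correct E) as [H _]. specialize (H y Hy).
  rewrite <- HF in H. exact H.
Qed.

Lemma Lub_Rbar_finite (E : R -> Prop) (y b : R) :
  E y -> (forall x, E x -> x <= b) -> is_finite (Lub_Rbar E).
Proof.
  intros Hy Hb. destruct (Lub_Rbar_correct E) as [H1 H2].
  specialize (H1 y Hy). assert (H3 : Rbar_le (Lub_Rbar E) b).
  { apply H2. intros x Hx. now apply Hb. }
  destruct (Lub_Rbar E); easy.
Qed.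

Section TadmorRitt.
Context {X : NormedModule C_AbsRing}.
Hypothesis X_complete : norm_complete X.
Hypothesis X_nontrivial : exists x : X, x <> zero.
Variable T : X -> X.
Hypothesis T_TR : Tadmor_Ritt T.

Let CT := real (C_TR T).

Lemma sup_resolvent_bound (D : C -> Prop) (z : C) (x : X) :
  is_finite (sup_resolvent T D) -> D z -> is_resolvent T z (resolvent z T) ->
  Cmod (z - 1) * norm (resolvent z T x) <= real (sup_resolvent T D) * norm x.
Proof.
  intros HF Hz [HL _]. rewrite <- norm_scal_C.
  assert (HL' := is_linear_scal_fun (resolvent z T) (z - 1)%C HL).
  eapply Rle_trans; [apply (opnorm_bound _ x HL')|].
  apply Rmult_le_compat_r; [apply norm_ge_0|].
  apply Lub_Rbar_ge; [easy|]. now exists z.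
Qed.

Lemma TR_resolvent (z : C) : 1 < Cmod z -> is_resolvent T z (resolvent z T).
Proof.
  intros Hz. apply resolvent_spec. apply NNPP. intros H.
  destruct T_TR as (_ & H1 & _). apply H1 in H. lra.
Qed.

Lemma TR_bound (z : C) (x : X) : 1 < Cmod z ->
  Cmod (z - 1) * norm (resolvent z T x) <= CT * norm x.
Proof.
  intros Hz. apply (sup_resolvent_bound (fun z => 1 < Cmod z)); [apply T_TR|easy|].
  now apply TR_resolvent.
Qed.

(** At the test point 2, where [|z - 1| = 1], the value 0 would annihilate an invertible operator on
    a nonzero space. *)
Lemma TR_pos : 0 < CT.
Proof.
  destruct X_nontrivial as [x Hx].
  assert (H2 : 1 < Cmod 2) by (rewrite Cmod_R, Rabs_pos_eq; lra).
  assert (HB := TR_bound 2 x H2).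
  replace (Cmod (2 - 1)) with 1 in HB.
  2:{ replace (2 - 1)%C with (RtoC 1) by ring. now rewrite Cmod_1. }
  destruct (TR_resolvent 2 H2) as (H3 & H4 & H5).
  assert (Hn : 0 < norm (resolvent 2 T x)).
  { destruct (Rle_lt_or_eq_dec _ _ (norm_ge_0 (resolvent 2 T x))) as [|E]; [easy|].
    exfalso. apply Hx. rewrite <- (H5 x).
    replace (resolvent 2 T x) with (@zero X).
    - rewrite (linear_zero T) by apply T_TR. lin_ring.
    - symmetry. now apply norm_eq_zero. }
  assert (Hx0 := norm_ge_0 x). nra.
Qed.

(** An inequality and not an equality, because [acos] saturates: if [1 / CT >= 1] then [theta T] is
    0. *)
Lemma cos_theta : 0 <= theta T < PI / 2 /\ cos (theta T) * CT <= 1.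
Proof.
  assert (HC := TR_pos). assert (HPI := PI_RGT_0).
  assert (Hi : 0 < 1 / CT) by (apply Rdiv_lt_0_compat; lra).
  destruct (Rle_dec 1 (1 / CT)) as [H1|H1].
  - assert (Ht : theta T = 0).
    { unfold theta. fold CT. unfold acos.
      destruct (Rle_dec (1 / CT) (-1)); [lra|]. destruct (Rle_dec 1 (1 / CT)); lra. }
    rewrite Ht, cos_0. split; [lra|]. apply Rmult_le_compat_r with (r := CT) in H1; [|lra].
    replace (1 / CT * CT) with 1 in H1 by (field; lra). lra.
  - apply Rnot_le_lt in H1.
    assert (Hc : cos (theta T) = 1 / CT) by (apply cos_acos; lra).
    assert (Hb : 0 <= theta T <= PI) by apply acos_bound.
    split; [split; [lra|]|].
    + apply Rnot_le_lt. intros Hle.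
      assert (A := cos_decr_1 (PI / 2) (theta T)).
      rewrite cos_PI2, Hc in A.
      assert (1 / CT <= 0) by (apply A; lra). lra.
    + rewrite Hc. right. field. lra.
Qed.

(** Since [s > sin theta], the constant [k = sqrt (1 - s ^ 2)] of [outside_Kset] satisfies
    [k * CT < 1], which is the ratio of the Neumann series. The bound [1 <= M] is wanted for the
    operators [l T], whose resolvent at [l = 0] is multiplication by [/ z]. *)
Lemma resolvent_off_Kset (s : R) : sin (theta T) < s < 1 ->
  exists M, 1 <= M /\ forall z, ~ Kset s z ->
    is_resolvent T z (resolvent z T) /\
    forall x, Cmod (z - 1) * norm (resolvent z T x) <= M * norm x.
Proof.
  intros Hs. destruct cos_theta as [Hth HcC]. assert (HC := TR_pos).
  assert (Hsin : 0 <= sin (theta T)) by (apply sin_ge_0; assert (A := PI_RGT_0); lra).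
  set (k := sqrt (1 - s ^ 2)).
  assert (Hkc : 0 <= k < cos (theta T)).
  { split; [apply sqrt_pos|].
    rewrite <- (sqrt_pow2 (cos (theta T))).
    - apply sqrt_lt_1_alt. split; [nra|].
      assert (A := sin2_cos2 (theta T)). unfold Rsqr in A. nra.
    - apply cos_ge_0; lra. }
  assert (HkC : k * CT < 1) by nra.
  (* The room between [k] and [1 / CT] pays for the move from [z0], possibly on the unit circle, to
     a point of modulus greater than 1. *)
  set (k' := (k + 1 / CT) / 2).
  assert (Hk : k < 1 / CT).
  { apply Rmult_lt_reg_r with CT; [easy|].
    replace (1 / CT * CT) with 1 by (field; lra). easy. }
  assert (Hk'C : k' * CT < 1).
  { unfold k'. replace ((k + 1 / CT) / 2 * CT) with ((k * CT + 1) / 2)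
      by (field; lra). lra. }
  assert (Hkk' : k < k') by (unfold k'; lra).
  set (q := k' * CT). assert (Hq : 0 <= q < 1) by (unfold q; nra).
  set (M := (1 + k') * CT / (1 - q)).
  assert (HCM : CT <= M).
  { unfold M. apply Rmult_le_reg_r with (1 - q); [lra|].
    unfold Rdiv. rewrite Rmult_assoc, Rinv_l by lra. nra. }
  exists (Rmax M 1). split; [apply Rmax_r|]. intros z Hz.
  assert (Hmax : forall x : X, M * norm x <= Rmax M 1 * norm x).
  { intros x. apply Rmult_le_compat_r; [apply norm_ge_0|apply Rmax_l]. }
  destruct (Rlt_dec 1 (Cmod z)) as [Hz1|Hz1].
  - split; [now apply TR_resolvent|]. intros x.
    eapply Rle_trans; [now apply TR_bound|]. eapply Rle_trans; [|apply Hmax].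
    apply Rmult_le_compat_r; [apply norm_ge_0|easy].
  - apply Rnot_lt_le in Hz1.
    destruct (outside_Kset s z) as (z0 & H1 & H2 & H3); [lra|easy|easy|]. fold k in H3.
    assert (Hz0 := Cmod_minus_pos _ _ H2).
    (* Chosen so that [k |z0 - 1| + e |z0| = k' (|z0 - 1| - e |z0|)], which is exactly what
       [|z - z1| <= k' |z1 - 1|] requires. *)
    set (e := (k' - k) * Cmod (z0 - 1) / (Cmod z0 * (1 + k'))).
    assert (He : 0 < e).
    { unfold e. apply Rdiv_lt_0_compat; nra. }
    set (z1 := (RtoC (1 + e) * z0)%C).
    assert (Hz01 : Cmod (z1 - z0) = e * Cmod z0).
    { unfold z1. replace (_ - z0)%C with (RtoC e * z0)%C by (rewrite RtoC_plus; ring).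
      now rewrite Cmod_mult, Cmod_R, Rabs_pos_eq by lra. }
    assert (Hez : e * Cmod z0 * (1 + k') = (k' - k) * Cmod (z0 - 1)).
    { unfold e. field. lra. }
    assert (Hz1n : 1 < Cmod z1).
    { unfold z1. rewrite Cmod_mult, Cmod_R, Rabs_pos_eq by lra. nra. }
    assert (Hd1 : Cmod (z0 - 1) - e * Cmod z0 <= Cmod (z1 - 1)).
    { assert (A := Cmod_minus_triangle z1 z0 1).
      rewrite (Cmod_minus_sym z0 z1) in A. lra. }
    assert (Hzz1 : Cmod (z - z1) <= k' * Cmod (z1 - 1)).
    { assert (A := Cmod_minus_triangle z0 z z1).
      rewrite (Cmod_minus_sym z0 z1) in A. nra. }
    assert (Hp : 0 < Cmod (z1 - 1)).
    { apply Cmod_minus_pos. intros E. rewrite E, Cmod_1 in Hz1n. lra. }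
    destruct (resolvent_perturbation X_complete T (resolvent z1 T) z1 z
      (CT / Cmod (z1 - 1)) q) as (S & HS & HSb).
    + now apply TR_resolvent.
    + apply Rdiv_le_0_compat; lra.
    + intros x. assert (A := TR_bound z1 x Hz1n).
      apply Rmult_le_reg_l with (Cmod (z1 - 1)); [easy|].
      replace (Cmod (z1 - 1) * (CT / Cmod (z1 - 1) * norm x)) with (CT * norm x)
        by (field; lra). easy.
    + unfold q. replace (k' * CT) with (k' * Cmod (z1 - 1) * (CT / Cmod (z1 - 1)))
        by (field; lra).
      apply Rmult_le_compat_r; [apply Rdiv_le_0_compat; lra|easy].
    + easy.
    + assert (HR : is_resolvent T z (resolvent z T)) by (apply resolvent_spec; now exists S).
      split; [easy|]. intros x. eapply Rle_trans; [|apply Hmax].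
      rewrite (resolvent_unique T (resolvent z T) S z x HR HS).
      assert (Hz11 : Cmod (z - 1) <= (1 + k') * Cmod (z1 - 1)).
      { assert (A := Cmod_minus_triangle z1 z 1). lra. }
      apply Rle_trans with ((1 + k') * Cmod (z1 - 1)
        * (CT / Cmod (z1 - 1) / (1 - q) * norm x)).
      * apply Rmult_le_compat; [apply Cmod_ge_0|apply norm_ge_0|easy|apply HSb].
      * right. unfold M. field. lra.
Qed.

Lemma sin_theta_lt (eta : R) : theta T < eta < PI / 2 ->
  0 <= sin (theta T) < sin eta /\ 0 < sin eta < 1.
Proof.
  intros He. destruct cos_theta as [Hth _]. assert (HP := PI_RGT_0).
  repeat split.
  - apply sin_ge_0; lra.
  - apply sin_increasing_1; lra.
  - apply sin_pos_acute; lra.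
  - apply sin_lt_1_acute; lra.
Qed.

(** [real] is meaningful only for a finite supremum, so finiteness is drawn first from
    [resolvent_off_Kset]. The point 2 shows that the set of values is nonempty and that the constant
    is nonnegative. *)
Lemma C_eta_bound (eta : R) : theta T < eta < PI / 2 ->
  0 <= real (C_eta eta T) /\ forall z x, ~ Kset (sin eta) z ->
    is_resolvent T z (resolvent z T) /\
    Cmod (z - 1) * norm (resolvent z T x) <= real (C_eta eta T) * norm x.
Proof.
  intros He. destruct cos_theta as [Hth _]. assert (HP := PI_RGT_0).
  destruct (sin_theta_lt eta He) as [Hs1 Hs2].
  destruct (resolvent_off_Kset (sin eta)) as (M & HM & HR); [lra|].
  assert (Hcl : forall z, ~ closedB eta z <-> ~ Kset (sin eta) z).
  { intros z. rewrite closedB_Kset by lra. easy. }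
  assert (H2 : ~ Kset (sin eta) 2).
  { intros (t & Ht & Hz). rewrite Cmod_RtoC_minus, Rabs_pos_eq in Hz by lra. nra. }
  assert (HF : is_finite (C_eta eta T)).
  { apply Lub_Rbar_finite with
      (opnorm (fun x : X => scal (2 - 1)%C (resolvent 2 T x))) M.
    - exists (RtoC 2). split; [now apply Hcl|easy].
    - intros y (z & Hz & ->). apply Hcl in Hz.
      destruct (HR z Hz) as [H3 H4]. apply opnorm_le; [lra|].
      intros x Hx. rewrite norm_scal_C. eapply Rle_trans; [apply H4|].
      rewrite <- (Rmult_1_r M) at 2. apply Rmult_le_compat_l; lra. }
  assert (HB : forall z x, ~ Kset (sin eta) z ->
    is_resolvent T z (resolvent z T) /\
    Cmod (z - 1) * norm (resolvent z T x) <= real (C_eta eta T) * norm x).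
  { intros z x Hz. destruct (HR z Hz) as [H3 H4]. split; [easy|].
    apply (sup_resolvent_bound (fun z => ~ closedB eta z)); [easy|now apply Hcl|easy]. }
  split; [|exact HB].
  destruct X_nontrivial as [x Hx].
  assert (Hn : 0 < norm x).
  { destruct (Rle_lt_or_eq_dec _ _ (norm_ge_0 x)) as [|E]; [easy|].
    exfalso. apply Hx. now apply norm_eq_zero. }
  destruct (HB 2 x H2) as [_ HB2].
  assert (A1 := Cmod_ge_0 (2 - 1)). assert (A2 := norm_ge_0 (resolvent 2 T x)).
  nra.
Qed.
End TadmorRitt.

(** * The integral of the resolvent *)

Lemma resolvent_commutes_with {X : NormedModule C_AbsRing} (A T S : X -> X)
    (z : C) (x : X) :
  is_linear A -> (forall y, A (T y) = T (A y)) -> is_resolvent T z S ->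
  S (A x) = A (S x).
Proof.
  intros HA HAT (H1 & H2 & H3).
  assert (E : A x = minus (scal z (A (S x))) (T (A (S x)))).
  { rewrite <- HAT, <- (linear_scal A HA), <- (linear_minus A), H3; easy. }
  rewrite E. apply H2.
Qed.

Lemma qsum_scal_vec {V : NormedModule C_AbsRing} (N : list (C * C))
    (f : C -> C) (x : V) :
  qsum N (fun z => scal (f z) x) = scal (qsum (V := C_NormedModule) N f) x.
Proof.
  induction N as [|p N IH]; simpl.
  - change (zero = scal (RtoC 0) x). lin_ring.
  - rewrite IH. change (plus (scal (fst p) (scal (f (snd p)) x))
      (scal (qsum (V := C_NormedModule) N f) x)
      = scal (fst p * f (snd p) + qsum (V := C_NormedModule) N f)%C x). lin_ring.
Qed.

Lemma cint_scal_vec {V : NormedModule C_AbsRing} (K : chain) (f : C -> C) (v : C)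
    (x : V) :
  cint (V := C_NormedModule) K f v ->
  cint K (fun z => scal (f z) x) (scal v x).
Proof.
  intros H eps He.
  destruct (le_scaled_eps (norm x) eps) as [E1 E2]; [apply norm_ge_0|easy|].
  destruct (H _ E1) as (d & Hd & H1). exists d. split; [easy|]. intros N HN.
  specialize (H1 N HN). rewrite qsum_scal_vec.
  replace (minus _ _) with (scal (qsum (V := C_NormedModule) N f - v)%C x)
    by lin_ring.
  rewrite norm_scal_C. eapply Rle_trans; [|exact E2].
  apply Rmult_le_compat_r; [apply norm_ge_0|exact H1].
Qed.

Lemma chain_open_distance (K : chain) (D : C -> Prop) : C_open D ->
  (forall z, img K z -> D z) ->
  exists d, 0 < d /\ forall z w, img K z -> Cmod (w - z) < d -> D w.
Proof.
  intros HD HK.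
  assert (HC : forall z, exists d, 0 < d /\ (img K z ->
    forall w, Cmod (w - z) < d -> D w)).
  { intros z. destruct (classic (img K z)) as [Hz|Hz].
    - destruct (HD z (HK z Hz)) as (d & H1 & H2). now exists d.
    - exists 1. split; [lra|easy]. }
  destruct (choice _ HC) as [d Hd].
  destruct (img_lebesgue K (fun z => d z / 2)) as (rho & Hrho & H).
  { intros z _. destruct (Hd z); lra. }
  exists rho. split; [easy|]. intros z w Hz Hw.
  destruct (H z Hz) as (z' & Hz' & H1 & H2).
  destruct (Hd z') as [_ H3]. apply (H3 Hz' w).
  assert (A := Cmod_minus_triangle z w z'). lra.
Qed.

Lemma chain_Kset_distance (K : chain) (s : R) : 0 <= s ->
  (forall z, img K z -> ~ Kset s z) ->
  exists d, 0 < d /\ forall z w, img K z -> Kset s w -> d <= Cmod (z - w).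
Proof.
  intros Hs HK.
  destruct (chain_open_distance K (fun z => ~ Kset s z)) as (d & Hd & H);
    [intros z; now apply Kset_closed|easy|].
  exists d. split; [easy|]. intros z w Hz Hw. apply Rnot_lt_le. intros Hlt.
  apply (H z w Hz); [now rewrite Cmod_minus_sym|easy].
Qed.

Section ResolventIntegral.
Context {X : NormedModule C_AbsRing}.
Hypothesis X_complete : norm_complete X.
Variables (T : X -> X) (s M : R).
Hypothesis T_linear : is_linear T.
Hypothesis s_ge_0 : 0 <= s.
Hypothesis M_ge_1 : 1 <= M.
Hypothesis T_resolvent : forall z, ~ Kset s z ->
  is_resolvent T z (resolvent z T) /\
  forall x, Cmod (z - 1) * norm (resolvent z T x) <= M * norm x.

Let Tl (l : R) (x : X) : X := scal (RtoC l) (T x).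

Lemma Tl_one : Tl 1 = T.
Proof. apply functional_extensionality. intros x. unfold Tl. lin_ring. Qed.

Lemma Kset_real (t : R) : 0 <= t <= 1 -> Kset s t.
Proof.
  intros Ht. exists t. split; [easy|]. rewrite Cminus_diag, Cmod_0.
  apply Rmult_le_pos; lra.
Qed.

(** For [l > 0] the resolvent of [l T] is [R(z / l, T) / l], and [z / l] is off the set because the
    set is starlike about 0. The singular point moves from 1 to [l]. *)
Lemma scaled_resolvent (l : R) (z : C) : 0 <= l <= 1 -> ~ Kset s z ->
  is_resolvent (Tl l) z (resolvent z (Tl l)) /\
  forall x, Cmod (z - l) * norm (resolvent z (Tl l) x) <= M * norm x.
Proof.
  intros Hl Hz.
  assert (Hz0 : z <> 0).
  { intros ->. apply Hz. apply Kset_real. lra. }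
  assert (HS : exists S, is_resolvent (Tl l) z S /\
    forall x, Cmod (z - l) * norm (S x) <= M * norm x).
  { destruct (Req_dec l 0) as [->|Hl0].
    - exists (fun x => scal (/ z)%C x). split; [split; [|split]|].
      + apply linear_bounded_by with (Cmod (/ z)).
        * intros x y. lin_ring.
        * intros c x. lin_ring.
        * intros x. rewrite norm_scal_C. lra.
      + intros x. unfold Tl. lin_field; easy.
      + intros x. unfold Tl. lin_field; easy.
      + intros x. rewrite norm_scal_C, <- Rmult_assoc, <- Cmod_mult.
        replace ((z - 0) * / z)%C with (RtoC 1) by (field; easy).
        rewrite Cmod_1. apply Rmult_le_compat_r; [apply norm_ge_0|easy].
    - assert (Hl' : RtoC l <> 0) by (intros E; now apply RtoC_inj in E).
      assert (Hzl : ~ Kset s (z / l)%C).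
      { intros H. apply Hz.
        replace z with (RtoC (1 - l) * 0 + RtoC l * (z / l))%C by (field; easy).
        apply Kset_convex; [apply Kset_real; lra|easy|easy]. }
      destruct (T_resolvent _ Hzl) as [(L & H1 & H2) H3].
      exists (fun x => scal (/ RtoC l)%C (resolvent (z / l)%C T x)).
      split; [split; [|split]|].
      + now apply is_linear_scal_fun.
      + intros x. rewrite <- (linear_scal _ L).
        transitivity (resolvent (z / l)%C T (minus (scal (z / l)%C x) (T x)));
          [|apply H1].
        f_equal. unfold Tl. lin_field; easy.
      + intros x. set (y := resolvent (z / l)%C T x).
        transitivity (minus (scal (z / l)%C y) (T y)); [|apply H2].
        unfold Tl. rewrite (linear_scal _ T_linear). lin_field; easy.
      + intros x. rewrite norm_scal_C, <- Rmult_assoc, <- Cmod_mult.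
        replace ((z - l) * / l)%C with (z / l - 1)%C by (field; easy). apply H3. }
  destruct HS as (S & HS & HSb).
  assert (HR : is_resolvent (Tl l) z (resolvent z (Tl l)))
    by (apply resolvent_spec; now exists S).
  split; [easy|]. intros x.
  rewrite (resolvent_unique (Tl l) _ S z x HR HS). apply HSb.
Qed.

Variable K : chain.
Hypothesis K_closed : closed_chain K.
Variable d : R.
Hypothesis d_pos : 0 < d.
Hypothesis K_far : forall z w, img K z -> Kset s w -> d <= Cmod (z - w).

(** Half of the distance [d], so that the condition also holds on a neighbourhood of the chain, as
    differentiation requires. *)
Let far (z : C) : Prop := forall w, Kset s w -> d / 2 <= Cmod (z - w).

Let N := 2 * M / d.

Lemma far_near (z a : C) : img K z -> Cmod (a - z) < d / 2 -> far a.
Proof.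
  intros Hz Ha w Hw. assert (A := K_far z w Hz Hw).
  assert (B := Cmod_minus_triangle a z w). rewrite (Cmod_minus_sym z a) in B. lra.
Qed.

Lemma far_resolvent (l : R) (z : C) : 0 <= l <= 1 -> far z ->
  is_resolvent (Tl l) z (resolvent z (Tl l)) /\
  forall x, norm (resolvent z (Tl l) x) <= N * norm x.
Proof.
  intros Hl Hz. assert (HzK : ~ Kset s z).
  { intros H. specialize (Hz z H). rewrite Cminus_diag, Cmod_0 in Hz. lra. }
  destruct (scaled_resolvent l z Hl HzK) as [H1 H2]. split; [easy|]. intros x.
  specialize (Hz l (Kset_real l Hl)). specialize (H2 x).
  assert (A := norm_ge_0 (resolvent z (Tl l) x)).
  unfold N. apply Rmult_le_reg_l with (d / 2); [lra|].
  replace (d / 2 * (2 * M / d * norm x)) with (M * norm x) by (field; lra).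
  eapply Rle_trans; [|exact H2]. now apply Rmult_le_compat_r.
Qed.

Lemma N_ge_0 : 0 <= N.
Proof. unfold N. apply Rdiv_le_0_compat; lra. Qed.

Lemma resolvent_strict_deriv (l : R) (z : C) (x : X) : 0 <= l <= 1 -> img K z ->
  strict_deriv (fun a => resolvent a (Tl l) x)
    (fun a => opp (resolvent a (Tl l) (resolvent a (Tl l) x))) z.
Proof.
  intros Hl Hz.
  (* [r] is linear everywhere, as [strict_deriv_pseudo_resolvent] requires. *)
  set (r := fun a => if excluded_middle_informative (far a)
                     then resolvent a (Tl l) else fun _ => @zero X).
  assert (Hr : forall a, Cmod (a - z) < d / 2 -> r a = resolvent a (Tl l)).
  { intros a Ha. unfold r. destruct (excluded_middle_informative (far a)); [easy|].
    exfalso. eapply n, far_near; eassumption. }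
  assert (Hf : forall a, Cmod (a - z) < d / 2 ->
    is_resolvent (Tl l) a (resolvent a (Tl l)) /\
    forall y, norm (resolvent a (Tl l) y) <= N * norm y).
  { intros a Ha. apply far_resolvent; [easy|]. eapply far_near; eassumption. }
  assert (H := strict_deriv_pseudo_resolvent r z (d / 2) N x).
  assert (H' : strict_deriv (fun a => r a x) (fun a => opp (r a (r a x))) z).
  { apply H; [lra|apply N_ge_0| | |].
    - intros a b y Ha Hb. rewrite !Hr by easy.
      apply resolvent_identity with (Tl l); now apply Hf.
    - intros a y y'. unfold r. destruct (excluded_middle_informative (far a)) as [Ha|Ha].
      + apply linear_minus. apply far_resolvent; easy.
      + lin_ring.
    - intros a y Ha. rewrite Hr by easy. now apply Hf. }
  intros eps He. destruct (H' eps He) as (e & He' & H1).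
  exists (Rmin e (d / 2)). split; [apply Rmin_glb_lt; lra|].
  intros a b w Ha Hb Hw. rewrite <- !Hr.
  - apply H1; (eapply Rlt_le_trans; [eassumption|apply Rmin_l]).
  - eapply Rlt_le_trans; [exact Hw|apply Rmin_r].
  - eapply Rlt_le_trans; [exact Ha|apply Rmin_r].
  - eapply Rlt_le_trans; [exact Hb|apply Rmin_r].
Qed.

Lemma img_far (z : C) : img K z -> far z.
Proof.
  intros Hz. apply far_near with z; [easy|].
  rewrite Cminus_diag, Cmod_0. lra.
Qed.

(** The integral of [(z - l T)^-1] does not depend on [l] in [[0,1]]: the
    derivative with respect to [l] is [T (z - l T)^-2], which has the primitive
    [- T (z - l T)^-1]. *)
Lemma cint_resolvent (v : C) (x : X) :
  cint (V := C_NormedModule) K (fun z => (/ (z - 0))%C) v ->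
  cint K (fun z => resolvent z T x) (scal v x).
Proof.
  intros Hv.
  destruct (linear_norm T T_linear) as (t & Ht & HT).
  assert (HN := N_ge_0).
  assert (Hex : forall l, exists u, 0 <= l <= 1 ->
    cint K (fun z => resolvent z (Tl l) x) u).
  { intros l. destruct (classic (0 <= l <= 1)) as [Hl|Hl].
    - destruct (cint_ex K (fun z => resolvent z (Tl l) x) X_complete) as [u Hu].
      + eapply strict_deriv_cont. intros z Hz. now apply resolvent_strict_deriv.
      + now exists u.
    - now exists zero. }
  destruct (choice _ Hex) as [u Hu].
  assert (E : u 0 = u 1).
  { apply (constant_of_quadratic u (N * (N * (t * (N * (t * norm x)))) * len K)).
    intros l m Hl Hm.
    assert (H0 := cint_closed K _ _ K_closed
      (fun z Hz => resolvent_strict_deriv m z (T x) Hm Hz)).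
    assert (H1 := cint_plus K _ _ _ _ (cint_minus K _ _ _ _ (Hu l Hl) (Hu m Hm))
      (cint_scal K _ _ (RtoC (l - m)) H0)).
    set (B := N * (N * (t * (N * (t * norm x)))) * (l - m) ^ 2).
    replace (N * (N * (t * (N * (t * norm x)))) * len K * (l - m) ^ 2)
      with (B * len K) by (unfold B; ring).
    assert (E : minus (u l) (u m) = plus (minus (u l) (u m))
        (scal (RtoC (l - m)) zero)) by lin_ring.
    rewrite E. refine (cint_norm K _ _ _ _ _ H1).
    - assert (Hx := norm_ge_0 x). unfold B.
      apply Rmult_le_pos; [|apply pow2_ge_0].
      do 2 (apply Rmult_le_pos; [exact HN|]).
      apply Rmult_le_pos; [lra|]. apply Rmult_le_pos; [exact HN|].
      apply Rmult_le_pos; lra.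
    - intros z Hz. apply img_far in Hz.
      destruct (far_resolvent l z Hl Hz) as [R1 B1].
      destruct (far_resolvent m z Hm Hz) as [R2 B2].
      set (Ql := resolvent z (Tl l)) in *. set (Qm := resolvent z (Tl m)) in *.
      assert (Hcom : forall y, Qm (T y) = T (Qm y)).
      { intros y. apply resolvent_commutes_with with (Tl m) z; [easy| |easy].
        intros w. unfold Tl. apply (linear_scal T T_linear). }
      assert (HL : forall c y, Ql (scal c y) = scal c (Ql y)).
      { intros c y. apply (linear_scal Ql), R1. }
      assert (Hd : forall y, minus (Ql y) (Qm y)
        = scal (RtoC (l - m)) (Ql (Qm (T y)))).
      { intros y. rewrite (resolvent_difference _ _ _ _ z z y R1 R2).
        rewrite <- HL, Hcom. f_equal. unfold Tl.
        rewrite RtoC_minus. lin_ring. }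
      (* The difference formula is used twice: the exact differential removes the first-order term
         and [(l - m) ^ 2] comes out. *)
      replace (plus _ _) with
        (scal (RtoC (l - m) * RtoC (l - m))%C (Ql (Qm (T (Qm (T x)))))).
      2:{ rewrite Hd.
          transitivity (scal (RtoC (l - m)) (minus (Ql (Qm (T x))) (Qm (Qm (T x)))));
            [rewrite Hd; lin_ring|lin_ring]. }
      rewrite norm_scal_C, Cmod_mult, Cmod_R, <- Rabs_mult.
      rewrite Rabs_pos_eq by (apply Rle_0_sqr).
      unfold B. rewrite Rmult_comm. replace ((l - m) * (l - m)) with ((l - m) ^ 2) by ring.
      apply Rmult_le_compat_r; [apply pow2_ge_0|].
      eapply Rle_trans; [apply B1|]. apply Rmult_le_compat_l; [easy|].
      eapply Rle_trans; [apply B2|]. apply Rmult_le_compat_l; [easy|].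
      eapply Rle_trans; [apply HT|]. apply Rmult_le_compat_l; [lra|].
      eapply Rle_trans; [apply B2|]. apply Rmult_le_compat_l; [easy|].
      apply HT. }
  (* At [l = 0] the resolvent is multiplication by [/ z], so its integral is the index [v] about 0
     times [x]. *)
  assert (E0 : u 0 = scal v x).
  { apply (cint_unique K (fun z => resolvent z (Tl 0) x)); [apply Hu; lra|].
    apply cint_ext with (fun z => scal (/ (z - 0))%C x).
    - intros z Hz. apply img_far in Hz.
      destruct (far_resolvent 0 z ltac:(lra) Hz) as [(L & H1 & _) _].
      assert (Hz0 : z <> 0).
      { intros ->. specialize (Hz 0 (Kset_real 0 ltac:(lra))).
        rewrite Cminus_diag, Cmod_0 in Hz. lra. }
      rewrite <- (H1 (scal (/ (z - 0))%C x)). f_equal. unfold Tl.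
      lin_field; easy.
    - now apply cint_scal_vec. }
  rewrite <- E0, E, <- Tl_one. apply Hu. lra.
Qed.

Lemma strict_deriv_resolvent (z : C) (x : X) : img K z ->
  strict_deriv (fun a => resolvent a T x)
    (fun a => opp (resolvent a T (resolvent a T x))) z.
Proof.
  intros Hz. rewrite <- Tl_one. apply resolvent_strict_deriv; [lra|easy].
Qed.
End ResolventIntegral.

(** * Deformation of contours *)

(** One increment of length [d / 2] is approximated with the derivative read at [w] and at [z];
    subtracting and dividing by the increment compares the two values. *)
Lemma strict_deriv_continuous_deriv {V : NormedModule C_AbsRing} (P p : C -> V)
    (z : C) : strict_deriv P p z -> forall eps, 0 < eps -> exists d, 0 < d /\
  forall w, Cmod (w - z) < d -> norm (minus (p w) (p z)) <= eps.
Proof.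
  intros H eps He. destruct (H (eps / 2)) as (d & Hd & H1); [lra|].
  exists d. split; [easy|]. intros w Hw.
  set (b := (z + RtoC (d / 2))%C).
  assert (Hb : Cmod (b - z) = d / 2).
  { unfold b. replace (_ - z)%C with (RtoC (d / 2)) by ring.
    rewrite Cmod_R, Rabs_pos_eq; lra. }
  assert (Hz : Cmod (z - z) < d) by now rewrite Cminus_diag, Cmod_0.
  assert (A1 := H1 z b w Hz ltac:(lra) Hw).
  assert (A2 := H1 z b z Hz ltac:(lra) Hz).
  assert (A3 : norm (scal (b - z)%C (minus (p w) (p z))) <= eps * Cmod (b - z)).
  { replace (scal _ _) with
      (minus (minus (minus (P b) (P z)) (scal (b - z)%C (p z)))
             (minus (minus (P b) (P z)) (scal (b - z)%C (p w)))) by lin_ring.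
    eapply Rle_trans; [apply norm_minus_le|]. lra. }
  rewrite norm_scal_C, Hb in A3.
  apply Rmult_le_reg_l with (d / 2); lra.
Qed.

Lemma strict_deriv_bounded {V : NormedModule C_AbsRing} (P p : C -> V) (z : C) :
  strict_deriv P p z -> exists B d, 0 < B /\ 0 < d /\
  forall w, Cmod (w - z) < d -> norm (p w) <= B /\ norm (P w) <= B /\
    norm (minus (P w) (P z)) <= B * Cmod (w - z).
Proof.
  intros H.
  destruct (strict_deriv_continuous_deriv P p z H 1 Rlt_0_1) as (d1 & D1 & H1).
  destruct (H 1 Rlt_0_1) as (d2 & D2 & H2).
  set (A := norm (p z) + 1).
  assert (HA : 1 <= A) by (unfold A; assert (B := norm_ge_0 (p z)); lra).
  assert (HP := norm_ge_0 (P z)).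
  exists (norm (P z) + (1 + A)), (Rmin (Rmin d1 d2) 1).
  split; [lra|]. split; [repeat apply Rmin_glb_lt; lra|].
  intros w Hw. assert (Hw1 := Rlt_le_trans _ _ _ Hw (Rmin_l _ _)).
  assert (Hw2 := Rlt_le_trans _ _ _ Hw (Rmin_r _ _)).
  assert (B1 := H1 w (Rlt_le_trans _ _ _ Hw1 (Rmin_l _ _))).
  assert (Hz : Cmod (z - z) < d2) by now rewrite Cminus_diag, Cmod_0.
  assert (Hw3 := Rlt_le_trans _ _ _ Hw1 (Rmin_r _ _)).
  assert (B2 := H2 z w w Hz Hw3 Hw3).
  assert (B3 : norm (p w) <= A).
  { eapply Rle_trans; [apply (norm_le_minus _ (p z))|]. unfold A. lra. }
  assert (Hm := Cmod_ge_0 (w - z)).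
  assert (B4 : norm (minus (P w) (P z)) <= (1 + A) * Cmod (w - z)).
  { eapply Rle_trans; [apply (norm_le_minus _ (scal (w - z)%C (p w)))|].
    rewrite norm_scal_C.
    apply Rle_trans with (Cmod (w - z) * A + 1 * Cmod (w - z)); [|lra].
    apply Rplus_le_compat; [now apply Rmult_le_compat_l|easy]. }
  split; [lra|]. split.
  - eapply Rle_trans; [apply (norm_le_minus _ (P z))|]. nra.
  - nra.
Qed.

Lemma strict_deriv_scal {V : NormedModule C_AbsRing} (P p : C -> C) (Q q : C -> V)
    (z : C) :
  strict_deriv (V := C_NormedModule) P p z -> strict_deriv Q q z ->
  strict_deriv (fun a => scal (P a) (Q a))
    (fun a => plus (scal (p a) (Q a)) (scal (P a) (q a))) z.
Proof.
  intros HP HQ eps He.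
  destruct (strict_deriv_bounded P p z HP) as (B1 & d1 & HB1 & D1 & H1).
  destruct (strict_deriv_bounded Q q z HQ) as (B2 & d2 & HB2 & D2 & H2).
  set (B := B1 + B2).
  destruct (le_scaled_eps B (eps / 4)) as [E1 E2]; [unfold B; lra|lra|].
  set (e := eps / 4 / (B + 1)) in *.
  destruct (HP e E1) as (d3 & D3 & H3).
  destruct (HQ e E1) as (d4 & D4 & H4).
  destruct (le_scaled_eps (2 * B) e) as [E3 E4]; [unfold B; lra|lra|].
  set (d5 := e / (2 * B + 1)) in *.
  exists (Rmin (Rmin d1 d2) (Rmin (Rmin d3 d4) d5)).
  split; [repeat apply Rmin_glb_lt; easy|].
  intros a b w Ha Hb Hw.
  assert (Hsplit : forall u, Cmod (u - z) < Rmin (Rmin d1 d2) (Rmin (Rmin d3 d4) d5) ->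
    Cmod (u - z) < d1 /\ Cmod (u - z) < d2 /\ Cmod (u - z) < d3 /\
    Cmod (u - z) < d4 /\ Cmod (u - z) < d5).
  { intros u Hu.
    assert (U1 := Rlt_le_trans _ _ _ Hu (Rmin_l _ _)).
    assert (U2 := Rlt_le_trans _ _ _ Hu (Rmin_r _ _)).
    assert (U3 := Rlt_le_trans _ _ _ U2 (Rmin_l _ _)).
    repeat split.
    - exact (Rlt_le_trans _ _ _ U1 (Rmin_l _ _)).
    - exact (Rlt_le_trans _ _ _ U1 (Rmin_r _ _)).
    - exact (Rlt_le_trans _ _ _ U3 (Rmin_l _ _)).
    - exact (Rlt_le_trans _ _ _ U3 (Rmin_r _ _)).
    - exact (Rlt_le_trans _ _ _ U2 (Rmin_r _ _)). }
  destruct (Hsplit a Ha) as (A1 & A2 & A3 & A4 & A5).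
  destruct (Hsplit b Hb) as (C1 & C2 & C3 & C4 & C5).
  destruct (Hsplit w Hw) as (W1 & W2 & W3 & W4 & W5).
  specialize (H3 a b w A3 C3 W3). specialize (H4 a b w A4 C4 W4).
  destruct (H1 a A1) as (_ & PA & PA').
  destruct (H1 w W1) as (PW & _ & PW').
  destruct (H2 b C2) as (_ & QB & QB').
  destruct (H2 w W2) as (QW & _ & QW').
  assert (HBle : B1 <= B /\ B2 <= B) by (unfold B; lra).
  assert (Hm := Cmod_ge_0 (b - a)).
  assert (HPw : norm (V := C_NormedModule) (minus (P a) (P w)) <= e).
  { eapply Rle_trans; [apply (norm_minus_triangle (P z))|].
    rewrite (norm_minus_sym (P z)).
    eapply Rle_trans; [|exact E4]. nra. }
  assert (HQw : norm (minus (Q b) (Q w)) <= e).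
  { eapply Rle_trans; [apply (norm_minus_triangle (Q z))|].
    rewrite (norm_minus_sym (Q z)).
    eapply Rle_trans; [|exact E4]. nra. }
  (* Four errors, each given a quarter of [eps]: those of [P] and of [Q], and the displacements of
     [Q b] and of [P a] to the tag [w]. *)
  replace (minus _ _) with
    (plus (plus (scal (minus (minus (P b) (P a)) (scal (b - a)%C (p w))) (Q b))
             (scal (P a) (minus (minus (Q b) (Q a)) (scal (b - a)%C (q w)))))
       (plus (scal ((b - a) * p w)%C (minus (Q b) (Q w)))
             (scal ((b - a) * minus (P a) (P w))%C (q w)))).
  2:{ change (minus (minus (P b) (P a)) (scal (b - a)%C (p w))) with
        ((P b - P a) - (b - a) * p w)%C.
      change (minus (P a) (P w)) with (P a - P w)%C. lin_ring. }
  apply Rle_trans with ((eps / 4 * Cmod (b - a) + eps / 4 * Cmod (b - a))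
    + (eps / 4 * Cmod (b - a) + eps / 4 * Cmod (b - a))); [|lra].
  assert (HeB : e * B <= eps / 4) by exact E2.
  assert (Hmul : forall x y, 0 <= x <= e * Cmod (b - a) -> 0 <= y <= B ->
    x * y <= eps / 4 * Cmod (b - a)).
  { intros x y Hx Hy. apply Rle_trans with (e * Cmod (b - a) * B).
    - now apply Rmult_le_compat.
    - rewrite Rmult_assoc, (Rmult_comm (Cmod (b - a))), <- Rmult_assoc.
      now apply Rmult_le_compat_r. }
  eapply Rle_trans; [apply norm_plus_le|].
  apply Rplus_le_compat; (eapply Rle_trans; [apply norm_plus_le|]);
    apply Rplus_le_compat; rewrite norm_scal_C.
  - apply Hmul; (split; [first [apply Cmod_ge_0|apply norm_ge_0]|]); [exact H3|lra].
  - rewrite Rmult_comm. apply Hmul; (split; [first [apply Cmod_ge_0|apply norm_ge_0]|]).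
    + exact H4.
    + change (Cmod (P a) <= B1) in PA. lra.
  - rewrite Cmod_mult, Rmult_assoc, (Rmult_comm (Cmod (p w))), <- Rmult_assoc.
    change (Cmod (p w) <= B1) in PW.
    apply Hmul; (split; [|]).
    + apply Rmult_le_pos; [easy|apply norm_ge_0].
    + rewrite Rmult_comm. now apply Rmult_le_compat_r.
    + apply Cmod_ge_0.
    + lra.
  - rewrite Cmod_mult. apply Hmul; split.
    + apply Rmult_le_pos; [easy|apply Cmod_ge_0].
    + rewrite Rmult_comm. apply Rmult_le_compat_r; [easy|exact HPw].
    + apply norm_ge_0.
    + lra.
Qed.

(** The gauge is also taken at most [/ (norm (h w) + 1)], so that its uniform lower bound [rho]
    turns into the upper bound [/ rho] for [h]. *)
Lemma cont_on_bounded {V : NormedModule C_AbsRing} (K : chain) (h : C -> V) :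
  cont_on (img K) h -> exists B, 0 < B /\ forall z, img K z -> norm (h z) <= B.
Proof.
  intros Hh.
  assert (HC : forall w, exists d, 0 < d /\ (img K w ->
    forall w', img K w' -> Cmod (w' - w) < d -> norm (minus (h w') (h w)) <= 1)).
  { intros w. destruct (classic (img K w)) as [Hw|Hw].
    - destruct (Hh w Hw 1) as (d & H1 & H2); [lra|]. exists d. now split.
    - exists 1. split; [lra|easy]. }
  destruct (choice _ HC) as [d Hd].
  destruct (img_lebesgue K (fun w => Rmin (d w) (/ (norm (h w) + 1))))
    as (rho & Hrho & H).
  { intros w _. apply Rmin_glb_lt; [apply Hd|]. apply Rinv_0_lt_compat.
    assert (A := norm_ge_0 (h w)). lra. }
  exists (/ rho). split; [now apply Rinv_0_lt_compat|]. intros w Hw.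
  destruct (H w Hw) as (z & Hz & H1 & H2). destruct (Hd z) as [_ H3].
  assert (A := norm_ge_0 (h z)).
  eapply Rle_trans; [apply (norm_le_minus _ (h z))|].
  apply Rle_trans with (norm (h z) + 1).
  - apply Rplus_le_compat_l. apply H3; [easy..|].
    eapply Rlt_le_trans; [exact H1|apply Rmin_l].
  - rewrite <- (Rinv_inv (norm (h z) + 1)). apply Rinv_le_contravar; [easy|].
    eapply Rle_trans; [exact H2|apply Rmin_r].
Qed.

Section Deformation.
Context {X : NormedModule C_AbsRing}.
Hypothesis X_complete : norm_complete X.
Variables (T : X -> X) (s M : R).
Hypothesis T_linear : is_linear T.
Hypothesis s_ge_0 : 0 <= s.
Hypothesis M_ge_1 : 1 <= M.
Hypothesis T_resolvent : forall z, ~ Kset s z ->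
  is_resolvent T z (resolvent z T) /\
  forall x, Cmod (z - 1) * norm (resolvent z T x) <= M * norm x.

Lemma chain_strict_deriv_resolvent (K : chain) (z : C) (x : X) :
  (forall w, img K w -> ~ Kset s w) -> img K z ->
  strict_deriv (fun a => resolvent a T x)
    (fun a => opp (resolvent a T (resolvent a T x))) z.
Proof.
  intros HK. destruct (chain_Kset_distance K s s_ge_0 HK) as (d & Hd & Hfar).
  now apply (strict_deriv_resolvent T s M T_linear s_ge_0 M_ge_1 T_resolvent K d Hd Hfar).
Qed.

Lemma cint_by_parts (K : chain) (P F : C -> C) (x : X) :
  closed_chain K -> (forall w, img K w -> ~ Kset s w) ->
  (forall z, img K z -> strict_deriv (V := C_NormedModule) P F z) ->
  cint K (fun z => minus (scal (F z) (resolvent z T x))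
    (scal (P z) (resolvent z T (resolvent z T x)))) zero.
Proof.
  intros HK HKs HP.
  apply cint_ext with (fun z => plus (scal (F z) (resolvent z T x))
    (scal (P z) (opp (resolvent z T (resolvent z T x))))).
  { intros z _. lin_ring. }
  apply cint_closed with (fun z => scal (P z) (resolvent z T x)); [easy|].
  intros z Hz. apply (strict_deriv_scal P F); [now apply HP|].
  now apply chain_strict_deriv_resolvent with K.
Qed.

Variables (K L : chain) (D : C -> Prop) (c : C) (F : C -> C) (v : C).
Hypothesis K_closed : closed_chain K.
Hypothesis L_closed : closed_chain L.
Hypothesis D_open : C_open D.
Hypothesis D_star : starlike c D.
Hypothesis D_center : D c.
Hypothesis F_holo : holo_on D F.
Hypothesis K_D : forall z, img K z -> D z.
Hypothesis L_D : forall z, img L z -> D z.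
Hypothesis K_off : forall z, img K z -> ~ Kset s z.
Hypothesis L_off : forall z, img L z -> ~ Kset s z.
Hypothesis v_neq_0 : v <> 0.
Hypothesis K_index_0 : cint (V := C_NormedModule) K (fun z => (/ (z - 0))%C) v.
Hypothesis K_index_L : forall w, img L w ->
  cint (V := C_NormedModule) K (fun z => (/ (z - w))%C) (RtoC 0).
Hypothesis L_index_K : forall z, img K z ->
  cint (V := C_NormedModule) L (fun w => (/ (w - z))%C) v.
Variable e : R.
Hypothesis e_pos : 0 < e.
Hypothesis K_L_far : forall z w, img K z -> img L w -> e <= Cmod (w - z).

Lemma K_L_neq (z w : C) : img K z -> img L w -> (w - z)%C <> 0.
Proof.
  intros Hz Hw. apply Cmod_pos_neq. assert (A := K_L_far z w Hz Hw). lra.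
Qed.

(** By the resolvent identity,
    [R(z)^2 / (w - z) = R(w)^2 / (w - z) + R(z) R(w)^2 + R(z)^2 R(w)]. *)
Lemma cint_resolvent_sqr_kernel (w : C) (x : X) : img L w ->
  cint K (fun z => scal (/ (w - z))%C (resolvent z T (resolvent z T x)))
    (scal v (resolvent w T (resolvent w T x))).
Proof.
  intros Hw. set (Rw := resolvent w T).
  (* The three terms integrate to 0 because [K] has index 0 about [w], to [v R(w)^2] by the integral
     of the resolvent, and to 0 because [R(z)^2] is an exact derivative. *)
  destruct (chain_Kset_distance K s s_ge_0 K_off) as (d & Hd & Hfar).
  assert (H1 := cint_scal_vec K _ _ (opp (Rw (Rw x))) (K_index_L w Hw)).
  assert (H2 := cint_resolvent X_complete T s M T_linear s_ge_0 M_ge_1 T_resolvent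
    K K_closed d Hd Hfar v (Rw (Rw x)) K_index_0).
  assert (H3 := cint_closed K _ _ K_closed
    (fun z Hz => chain_strict_deriv_resolvent K z (Rw x) K_off Hz)).
  assert (H := cint_minus K _ _ _ _ (cint_plus K _ _ _ _ H1 H2) H3).
  replace (scal v (Rw (Rw x))) with
    (minus (plus (scal (RtoC 0) (opp (Rw (Rw x)))) (scal v (Rw (Rw x)))) zero)
    by lin_ring.
  refine (cint_ext K _ _ _ _ H).
  intros z Hz. cbv beta.
  destruct (T_resolvent z (K_off z Hz)) as [Rz _].
  destruct (T_resolvent w (L_off w Hw)) as [RRw _]. fold Rw in RRw.
  assert (E := fun y => resolvent_identity T (resolvent z T) Rw z w y Rz RRw).
  set (r := resolvent z T) in *.
  assert (Hwz := K_L_neq z w Hz Hw).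
  assert (E1 : r (r x) = plus (Rw (Rw x)) (scal (w - z)%C
    (plus (r (Rw (Rw x))) (r (r (Rw x)))))).
  { assert (Ea : r x = plus (Rw x) (scal (w - z)%C (r (Rw x)))).
    { rewrite <- E. lin_ring. }
    assert (Eb : r (Rw x) = plus (Rw (Rw x)) (scal (w - z)%C (r (Rw (Rw x))))).
    { rewrite <- E. lin_ring. }
    rewrite Ea at 1. rewrite (linear_plus r), (linear_scal r) by apply Rz.
    rewrite Eb at 1. lin_ring. }
  rewrite E1.
  replace (z - w)%C with (- (w - z))%C by ring.
  lin_field; try easy.
  all: intros A; apply Hwz; rewrite <- (Copp_involutive (w - z)), A; ring.
Qed.

(** In the application [K] is [Gamma] and [L] is the contracted boundary. The integral of [P R^2]
    over [K] is compared with Riemann sums over [L] after multiplication by [v], which is cancelled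
    at the end. *)
Theorem contour_deformation (x u : X) :
  cint K (fun z => scal (F z) (resolvent z T x)) u ->
  cint L (fun z => scal (F z) (resolvent z T x)) u.
Proof.
  intros Hu.
  destruct (primitive_ex D c F D_open D_star D_center F_holo) as [P HP].
  assert (HPs : forall z, D z -> strict_deriv (V := C_NormedModule) P F z)
    by (intros z Hz; now apply HP).
  set (R2 := fun z => resolvent z T (resolvent z T x)).
  assert (HuP : cint K (fun z => scal (P z) (R2 z)) u).
  { assert (H := cint_minus K _ _ _ _ Hu (cint_by_parts K P F x K_closed K_off
      (fun z Hz => HPs z (K_D z Hz)))).
    replace u with (minus u zero) by lin_ring.
    refine (cint_ext K _ _ _ _ H). intros z _. unfold R2. lin_ring. }
  assert (HL : cint L (fun z => scal (P z) (R2 z)) u).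
  2:{ assert (H := cint_plus L _ _ _ _ HL (cint_by_parts L P F x L_closed L_off
      (fun z Hz => HPs z (L_D z Hz)))).
    replace u with (plus u zero) by lin_ring.
    refine (cint_ext L _ _ _ _ H). intros z _. unfold R2. lin_ring. }
  assert (HPc : cont_on (V := C_NormedModule) (img L) P).
  { eapply strict_deriv_cont. intros z Hz. apply HPs. now apply L_D. }
  destruct (cont_on_bounded L P HPc) as (BP & HBP & HBPb).
  assert (HR2c : cont_on (img K) (fun z => opp (R2 z))).
  { intros z Hz eps He.
    destruct (strict_deriv_continuous_deriv _ _ z
      (chain_strict_deriv_resolvent K z x K_off Hz) eps He) as (d & Hd & H).
    exists d. split; [easy|]. intros w _ Hw. now apply H. }
  destruct (cont_on_bounded K _ HR2c) as (BR & HBR & HBRb).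
  (* The difference quotient is holomorphic on the starlike domain, so it has a primitive there and
     integrates to zero over [L]; the term with [P z] carries the index. *)
  assert (HCauchy : forall z, img K z ->
    cint (V := C_NormedModule) L (fun w => (P w * / (w - z))%C) (v * P z)%C).
  { intros z Hz.
    assert (Hq := diff_quot_holo D P F z (K_D z Hz) F_holo HP).
    destruct (primitive_ex D c _ D_open D_star D_center Hq) as [Q HQ].
    assert (H1 : cint (V := C_NormedModule) L (diff_quot P F z) zero).
    { apply (cint_closed (V := C_NormedModule)) with Q; [easy|].
      intros w Hw. apply HQ. now apply L_D. }
    assert (H2 := cint_plus L _ _ _ _ H1 (cint_scal L _ _ (P z) (L_index_K z Hz))).
    replace (v * P z)%C with (plus (@zero C_NormedModule) (scal (P z) v)).
    2:{ change (0 + P z * v = v * P z)%C. ring. }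
    refine (cint_ext L _ _ _ _ H2). intros w Hw.
    change ((diff_quot P F z w + P z * / (w - z))%C = (P w * / (w - z))%C).
    unfold diff_quot. destruct (Ceq_dec w z) as [E|_].
    - exfalso. apply (K_L_neq z w Hz Hw). rewrite E. ring.
    - ring. }
  intros eps He.
  assert (Hv : 0 < Cmod v) by now apply Cmod_gt_0.
  destruct (le_scaled_eps (len L * BR * len K / Cmod v) eps) as [E1 E2].
  { apply Rdiv_le_0_compat; [|easy]. apply Rmult_le_pos; [|apply len_ge_0].
    apply Rmult_le_pos; [apply len_ge_0|lra]. }
  { easy. }
  set (e0 := eps / (len L * BR * len K / Cmod v + 1)) in *.
  (* [P w / (w - z)] varies through its numerator and its denominator; each share is [e0 / 2], with
     denominators at least [e], uniformly in [z] on [K]. *)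
  destruct (cont_on_unif L P HPc (e0 / 2 * e)) as (rho1 & Hrho1 & Hn1).
  { apply Rmult_lt_0_compat; lra. }
  set (rho2 := e0 / 2 * e ^ 2 / BP).
  assert (Hrho2 : 0 < rho2).
  { unfold rho2. apply Rdiv_lt_0_compat; [|easy]. apply Rmult_lt_0_compat; [lra|].
    now apply pow_lt. }
  assert (Hnear : forall z, img K z ->
    near_constant (V := C_NormedModule) (img L) (Rmin rho1 rho2) e0
      (fun w => (P w * / (w - z))%C)).
  { intros z Hz w w' Hw Hw' Hd.
    assert (Hd1 := Rlt_le_trans _ _ _ Hd (Rmin_l _ _)).
    assert (Hd2 := Rlt_le_trans _ _ _ Hd (Rmin_r _ _)).
    specialize (Hn1 w w' Hw Hw' Hd1).
    change (Cmod (P w' - P w) <= e0 / 2 * e) in Hn1.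
    assert (N1 := K_L_neq z w Hz Hw). assert (N2 := K_L_neq z w' Hz Hw').
    assert (F1 := K_L_far z w Hz Hw). assert (F2 := K_L_far z w' Hz Hw').
    change (Cmod (P w' * / (w' - z) - P w * / (w - z)) <= e0).
    replace (P w' * / (w' - z) - P w * / (w - z))%C with
      ((P w' - P w) * / (w' - z) + (w - w') * (P w * (/ (w' - z) * / (w - z))))%C
      by (field; easy).
    assert (I1 : 0 <= / Cmod (w' - z) <= / e).
    { split; [left; apply Rinv_0_lt_compat; lra|apply Rinv_le_contravar; lra]. }
    assert (I2 : 0 <= / Cmod (w - z) <= / e).
    { split; [left; apply Rinv_0_lt_compat; lra|apply Rinv_le_contravar; lra]. }
    eapply Rle_trans; [apply Cmod_triangle|].
    rewrite !Cmod_mult, !Cmod_inv by easy.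
    assert (Hb := HBPb w Hw). change (Cmod (P w) <= BP) in Hb.
    apply Rle_trans with (e0 / 2 * e * / e + rho2 * (BP * (/ e * / e))).
    - apply Rplus_le_compat.
      + apply Rmult_le_compat; try easy; try apply Cmod_ge_0.
      + apply Rmult_le_compat; [apply Cmod_ge_0| | |].
        * repeat apply Rmult_le_pos; try easy; apply Cmod_ge_0.
        * rewrite Cmod_minus_sym. lra.
        * apply Rmult_le_compat; [apply Cmod_ge_0| |easy|].
          -- now apply Rmult_le_pos.
          -- now apply Rmult_le_compat.
    - right. unfold rho2. field. split; lra. }
  destruct (cint_uniform (V := C_NormedModule) L (Rmin rho1 rho2)) as (d & Hd & Hunif).
  { now apply Rmin_glb_lt. }
  exists d. split; [easy|]. intros N HN.
  (* A Riemann sum of Cauchy's formula, close to [v * P z] uniformly on [K]. Integrated against [R2]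
     it becomes [v] times the Riemann sum over [L] that is sought. *)
  set (G := fun z => qsum (V := C_NormedModule) N (fun w => (P w * / (w - z))%C)).
  assert (H1 : cint K (fun z => scal (G z) (R2 z))
    (scal v (qsum N (fun w => scal (P w) (R2 w))))).
  { assert (H := cint_qsum K N (fun w z => scal (P w) (scal (/ (w - z))%C (R2 z)))
      (fun w => scal (P w) (scal v (R2 w)))).
    rewrite <- qsum_scal.
    rewrite (qsum_ext N _ (fun w => scal (P w) (scal v (R2 w))))
      by (intros; lin_ring).
    apply cint_ext with
      (fun z => qsum N (fun w => scal (P w) (scal (/ (w - z))%C (R2 z)))).
    - intros z _. unfold G. rewrite <- qsum_scal_vec.
      apply qsum_ext. intros; lin_ring.
    - apply H. intros a w Haw. apply cint_scal. apply cint_resolvent_sqr_kernel.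
      eapply nodes_img; eassumption. }
  assert (H2 := cint_minus K _ _ _ _ H1 (cint_scal K _ _ v HuP)).
  assert (H3 : norm (minus (scal v (qsum N (fun w => scal (P w) (R2 w)))) (scal v u))
    <= e0 * len L * BR * len K).
  { refine (cint_norm K _ _ _ _ _ H2).
    - apply Rmult_le_pos; [|lra]. apply Rmult_le_pos; [lra|apply len_ge_0].
    - intros z Hz. replace (minus _ _) with (scal (G z - v * P z)%C (R2 z)) by lin_ring.
      rewrite norm_scal_C.
      apply Rmult_le_compat; [apply Cmod_ge_0|apply norm_ge_0| |].
      + exact (Hunif N HN _ _ _ (Hnear z Hz) (HCauchy z Hz)).
      + rewrite <- norm_opp. now apply HBRb. }
  replace (minus (scal v _) (scal v u)) with
    (scal v (minus (qsum N (fun w => scal (P w) (R2 w))) u)) in H3 by lin_ring.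
  rewrite norm_scal_C in H3.
  apply Rle_trans with (e0 * (len L * BR * len K / Cmod v)); [|exact E2].
  apply Rmult_le_reg_l with (Cmod v); [easy|].
  replace (Cmod v * (e0 * (len L * BR * len K / Cmod v))) with
    (e0 * len L * BR * len K) by (field; lra). exact H3.
Qed.
End Deformation.

(** * Arcs and segments *)

Section LipschitzCurves.
Variables (g : R -> C) (l : R).
Hypothesis g_lip : forall a b, a <= b -> Cmod (g b - g a) <= l * (b - a).

Lemma lip_var a b : 0 <= a -> a <= b -> b <= 1 ->
  Cmod (g b - g a) <= l * b - l * a.
Proof. intros _ H _. rewrite <- Rmult_minus_distr_l. now apply g_lip. Qed.

Lemma lip_ge_0 : 0 <= l.
Proof.
  assert (H := g_lip 0 1 ltac:(lra)). assert (A := Cmod_ge_0 (g 1 - g 0)). lra.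
Qed.

Lemma lip_abs s t : Cmod (g s - g t) <= l * Rabs (s - t).
Proof.
  destruct (Rle_dec t s) as [H|H].
  - rewrite Rabs_pos_eq by lra. now apply g_lip.
  - rewrite Rabs_left1, Cmod_minus_sym by lra.
    replace (- (s - t)) with (t - s) by ring. apply g_lip. lra.
Qed.

Lemma lip_cont t : 0 <= t <= 1 -> forall eps, 0 < eps ->
  exists d, 0 < d /\
    forall s, 0 <= s <= 1 -> Rabs (s - t) < d -> Cmod (g s - g t) < eps.
Proof.
  intros _ eps He. destruct (le_scaled_eps l (eps / 2)) as [E1 E2];
    [apply lip_ge_0|lra|].
  exists (eps / 2 / (l + 1)). split; [easy|]. intros s _ Hs.
  eapply Rle_lt_trans; [apply lip_abs|].
  apply Rle_lt_trans with (eps / 2); [|lra]. eapply Rle_trans; [|exact E2].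
  rewrite Rmult_comm. apply Rmult_le_compat_r; [apply lip_ge_0|lra].
Qed.

Definition lip_curve : chain := curve g (fun t => l * t) lip_var lip_cont.

(** The antiderivative is a function of the parameter and not of the point, which suits the angle
    along a circle about the pole. *)
Lemma cint_lip_curve (h : C -> C) (phi : R -> C) :
  (forall eps, 0 < eps -> exists d, 0 < d /\ forall x y xi,
     0 <= x -> y <= 1 -> x <= xi <= y -> y - x < d ->
     Cmod ((g y - g x) * h (g xi) - (phi y - phi x)) <= eps * (y - x)) ->
  cint (V := C_NormedModule) lip_curve h (phi 1 - phi 0)%C.
Proof.
  intros H eps He. destruct (H eps He) as (d & Hd & H1).
  exists d. split; [easy|]. intros N (L & HL & ->).
  replace eps with (eps * 1 - eps * 0) by ring.
  apply (knots_compare (V := C_NormedModule) g d 0 L 1 h phi (fun t => eps * t));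
    [|lra|lra|easy].
  intros x y xi Hx Hy Hxi Hxy. rewrite <- Rmult_minus_distr_l.
  now apply H1.
Qed.

(** On each cell the mean value theorem compares the increment of [Phi] with [psi] at the tag, up to
    the uniform modulus of continuity of [psi]. *)
Lemma qvar_lip_curve (k : C -> R) (Phi psi : R -> R) :
  (forall t, 0 <= t <= 1 -> is_derive Phi t (psi t)) ->
  (forall t, 0 <= t <= 1 -> continuous psi t) ->
  (forall t, 0 <= t <= 1 -> 0 <= k (g t) /\ l * k (g t) <= psi t) ->
  forall eps, 0 < eps -> exists d, 0 < d /\ forall N, nodes lip_curve d N ->
    qvar N k <= Phi 1 - Phi 0 + eps.
Proof.
  intros HPhi Hpsi Hk eps He.
  destruct (unifcont_normed_1d (V := R_NormedModule) psi 0 1 Hpsi (mkposreal eps He))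
    as [d Hd].
  exists d. split; [apply cond_pos|]. intros N (L & HL & ->).
  replace (Phi 1 - Phi 0 + eps) with ((Phi 1 + eps * 1) - (Phi 0 + eps * 0)) by ring.
  apply qvar_knots with (d := d) (b := 1) (phi := fun t => Phi t + eps * t);
    [|lra|lra|exact HL].
  intros x y xi Hx Hy Hxi Hxy.
  destruct (MVT_gen Phi x y psi) as (z & Hz & Ez).
  - rewrite Rmin_left, Rmax_right by lra. intros t Ht. apply HPhi; lra.
  - rewrite Rmin_left, Rmax_right by lra. intros t Ht.
    apply continuity_pt_filterlim. apply (ex_derive_continuous (V := R_NormedModule)).
    exists (psi t). apply HPhi; lra.
  - rewrite Rmin_left, Rmax_right in Hz by lra.
    assert (Hclose : Rabs (psi z - psi xi) < eps).
    { apply (Hd xi z); [lra|lra|]. change (Rabs (z - xi) < d).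
      apply Rabs_def1; lra. }
    apply Rabs_def2 in Hclose.
    destruct (Hk xi ltac:(lra)) as [K1 K2].
    apply Rle_trans with ((y - x) * (l * k (g xi))).
    + replace ((y - x) * (l * k (g xi))) with (l * (y - x) * k (g xi)) by ring.
      apply Rmult_le_compat_r; [easy|]. apply g_lip; lra.
    + apply Rle_trans with ((y - x) * (psi z + eps)).
      * apply Rmult_le_compat_l; lra.
      * right. replace (Phi y + eps * y - (Phi x + eps * x)) with
          ((Phi y - Phi x) + eps * (y - x)) by ring. rewrite Ez. ring.
Qed.
End LipschitzCurves.

Definition cis (x : R) : C := (cos x, sin x).

Lemma cis_plus x y : cis (x + y) = (cis x * cis y)%C.
Proof.
  unfold cis, Cmult; simpl. rewrite cos_plus, sin_plus. f_equal; ring.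
Qed.

Lemma cis_0 : cis 0 = 1.
Proof. unfold cis. now rewrite cos_0, sin_0. Qed.

Lemma Cmod_cis x : Cmod (cis x) = 1.
Proof.
  unfold Cmod, cis. cbn [fst snd].
  replace (cos x ^ 2 + sin x ^ 2) with 1; [apply sqrt_1|].
  assert (A := sin2_cos2 x). unfold Rsqr in A. lra.
Qed.

Lemma MVT_everywhere (f df : R -> R) (a b : R) :
  (forall x, is_derive f x (df x)) ->
  exists c, Rmin a b <= c <= Rmax a b /\ f b - f a = df c * (b - a).
Proof.
  intros H. apply MVT_gen.
  - intros x _. apply H.
  - intros x _. apply continuity_pt_filterlim.
    apply (ex_derive_continuous (V := R_NormedModule)). exists (df x). apply H.
Qed.

Lemma Rabs_sin_le x : Rabs (sin x) <= Rabs x.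
Proof.
  destruct (MVT_everywhere sin cos 0 x is_derive_sin) as (c & _ & E).
  rewrite sin_0, !Rminus_0_r in E. rewrite E, Rabs_mult.
  rewrite <- (Rmult_1_l (Rabs x)) at 2.
  apply Rmult_le_compat_r; [apply Rabs_pos|]. apply Rabs_le, COS_bound.
Qed.

(** The chord is at most the arc: [|cis b - cis a| = 2 |sin ((b - a) / 2)|]. *)
Lemma cis_lip a b : Cmod (cis b - cis a) <= Rabs (b - a).
Proof.
  apply Cmod_le_sqr; [apply Rabs_pos|]. rewrite pow2_abs.
  unfold Re, Im, cis; simpl fst; simpl snd.
  change (fst (cos b, sin b)) with (cos b).
  assert (E : (cos b + - cos a) ^ 2 + (sin b + - sin a) ^ 2
    = (2 * sin ((b - a) / 2)) ^ 2).
  { assert (A := cos_minus b a).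
    assert (H := cos_2a_sin ((b - a) / 2)).
    replace (2 * ((b - a) / 2)) with (b - a) in H by field.
    assert (S1 := sin2_cos2 a). assert (S2 := sin2_cos2 b). unfold Rsqr in *. nra. }
  rewrite E. rewrite <- (pow2_abs (2 * _)), <- (pow2_abs (b - a)).
  apply pow_incr. split; [apply Rabs_pos|].
  rewrite Rabs_mult, (Rabs_pos_eq 2) by lra.
  assert (A := Rabs_sin_le ((b - a) / 2)).
  assert (E2 : Rabs ((b - a) / 2) = Rabs (b - a) / 2)
    by (unfold Rdiv; rewrite Rabs_mult, (Rabs_pos_eq (/ 2)); lra).
  rewrite E2 in A. lra.
Qed.

Lemma Rabs_cos_minus_1 x : Rabs (cos x - 1) <= Rabs x.
Proof.
  assert (A := cis_lip 0 x). rewrite cis_0, Rminus_0_r in A.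
  eapply Rle_trans; [|exact A]. apply (re_le_Cmod (cis x - 1)).
Qed.

Lemma cis_linear d u v : Rabs u <= d -> Rabs v <= d ->
  Cmod (cis u - cis v - Ci * RtoC (u - v)) <= 2 * d * Rabs (u - v).
Proof.
  intros Hu Hv.
  assert (Hc : forall c, Rmin v u <= c <= Rmax v u -> Rabs c <= d).
  { intros c Hc. apply Rabs_le_between in Hu. apply Rabs_le_between in Hv.
    apply Rabs_le. unfold Rmin, Rmax in Hc.
    destruct (Rle_dec v u); lra. }
  destruct (MVT_everywhere cos (fun x => - sin x) v u is_derive_cos)
    as (c1 & H1 & E1).
  destruct (MVT_everywhere (fun x => sin x - x) (fun x => cos x - 1) v u)
    as (c2 & H2 & E2).
  { intros x. auto_derive; [easy|ring]. }
  cbv beta in E1, E2.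
  replace (cis u - cis v - Ci * RtoC (u - v))%C with
    (RtoC (- sin c1 * (u - v)) + Ci * RtoC ((cos c2 - 1) * (u - v)))%C.
  - eapply Rle_trans; [apply Cmod_triangle|].
    rewrite Cmod_mult, Cmod_Ci, !Cmod_R, !Rabs_mult, Rabs_Ropp.
    assert (A1 := Rabs_sin_le c1). assert (A2 := Rabs_cos_minus_1 c2).
    specialize (Hc c1 H1) as B1. specialize (Hc c2 H2) as B2.
    assert (A := Rabs_pos (u - v)). nra.
  - unfold cis, Ci, RtoC, Cplus, Cminus, Copp, Cmult; simpl. apply injective_projections; simpl; lra.
Qed.

Definition arc_path (c : C) (r a b : R) (t : R) : C :=
  (c + r * cis (a + t * (b - a)))%C.

Lemma arc_lip c r a b : 0 <= r -> a <= b -> forall x y, x <= y ->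
  Cmod (arc_path c r a b y - arc_path c r a b x) <= r * (b - a) * (y - x).
Proof.
  intros Hr Hab x y Hxy. unfold arc_path.
  replace (_ - _)%C with
    (RtoC r * (cis (a + y * (b - a)) - cis (a + x * (b - a))))%C by ring.
  rewrite Cmod_mult, Cmod_R, Rabs_pos_eq, Rmult_assoc by easy.
  apply Rmult_le_compat_l; [easy|]. eapply Rle_trans; [apply cis_lip|].
  replace (_ - _) with ((b - a) * (y - x)) by ring. rewrite Rabs_pos_eq; [lra|].
  apply Rmult_le_pos; lra.
Qed.

Definition arc (c : C) (r a b : R) (Hr : 0 <= r) (Hab : a <= b) : chain :=
  lip_curve (arc_path c r a b) _ (arc_lip c r a b Hr Hab).

Lemma seg_lip p q : forall x y, x <= y ->
  Cmod (seg_path p q y - seg_path p q x) <= Cmod (q - p) * (y - x).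
Proof.
  intros x y Hxy. rewrite seg_path_minus, Cmod_mult, Cmod_R, Rabs_pos_eq by lra. lra.
Qed.

Definition segment (p q : C) : chain :=
  lip_curve (seg_path p q) _ (seg_lip p q).

Lemma cint_arc_center (c : C) (r a b : R) Hr Hab : 0 < r ->
  cint (V := C_NormedModule) (arc c r a b Hr Hab)
    (fun z => (/ (z - c))%C) (Ci * RtoC (b - a))%C.
Proof.
  intros Hr0.
  replace (Ci * RtoC (b - a))%C with
    (Ci * RtoC (a + 1 * (b - a)) - Ci * RtoC (a + 0 * (b - a)))%C
    by (rewrite !RtoC_plus, !RtoC_mult, RtoC_minus; ring).
  apply (cint_lip_curve _ _ _ (fun z => / (z - c))%C
    (fun t => Ci * RtoC (a + t * (b - a)))%C).
  intros eps He. set (L := b - a). assert (HL : 0 <= L) by (unfold L; lra).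
  destruct (le_scaled_eps (2 * L ^ 2) eps) as [E1 E2];
    [assert (A := pow2_ge_0 L); lra|easy|].
  set (d := eps / (2 * L ^ 2 + 1)) in *. exists d. split; [easy|].
  intros x y xi Hx Hy Hxi Hxy. unfold arc_path. fold L.
  set (th := a + xi * L).
  assert (Hcis : cis th <> 0).
  { apply Cmod_pos_neq. rewrite Cmod_cis. lra. }
  assert (Hr' : RtoC r <> 0) by (intros E; apply RtoC_inj in E; lra).
  (* Rotation by the angle of the tag reduces the estimate to angles near 0, where [cis_linear]
     applies. *)
  assert (Hth : forall t, (RtoC r * cis (a + t * L))%C
    = (RtoC r * cis ((t - xi) * L) * cis th)%C).
  { intros t. rewrite <- Cmult_assoc, <- cis_plus. do 2 f_equal. unfold th. ring. }
  replace ((c + r * cis (a + y * L) - (c + r * cis (a + x * L))) *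
    / (c + r * cis th - c) - (Ci * RtoC (a + y * L) - Ci * RtoC (a + x * L)))%C
  with (cis ((y - xi) * L) - cis ((x - xi) * L)
        - Ci * RtoC ((y - xi) * L - (x - xi) * L))%C.
  2:{ replace (c + r * cis th - c)%C with (RtoC r * cis th)%C by ring.
      rewrite (Hth y), (Hth x).
      rewrite !RtoC_minus, !RtoC_plus, !RtoC_mult, !RtoC_minus.
      field. split; easy. }
  eapply Rle_trans; [apply (cis_linear (d * L))|].
  - rewrite Rabs_mult, (Rabs_pos_eq L) by easy.
    apply Rmult_le_compat_r; [easy|]. rewrite Rabs_pos_eq; lra.
  - rewrite Rabs_mult, (Rabs_pos_eq L) by easy.
    apply Rmult_le_compat_r; [easy|]. rewrite Rabs_left1; lra.
  - replace ((y - xi) * L - (x - xi) * L) with (L * (y - x)) by ring.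
    rewrite Rabs_pos_eq by (apply Rmult_le_pos; lra).
    replace (2 * (d * L) * (L * (y - x))) with (d * (2 * L ^ 2) * (y - x)) by ring.
    apply Rmult_le_compat_r; lra.
Qed.

(** * The exponential integral *)

Lemma Ei_integrand_continuous x : 0 < x -> continuous (fun x => exp (- x) / x) x.
Proof.
  intros Hx. apply (ex_derive_continuous (V := R_NormedModule)).
  auto_derive. lra.
Qed.

Lemma Ei_integrand_ex a b : 0 < a -> 0 < b ->
  ex_RInt (fun x => exp (- x) / x) a b.
Proof.
  intros Ha Hb. apply (ex_RInt_continuous (V := R_CompleteNormedModule)).
  intros z [Hz _]. apply Ei_integrand_continuous.
  eapply Rlt_le_trans; [|exact Hz]. now apply Rmin_glb_lt.
Qed.

Lemma Ei_integrand_pos x : 0 < x -> 0 < exp (- x) / x.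
Proof. intros Hx. apply Rdiv_lt_0_compat; [apply exp_pos|easy]. Qed.

Lemma Ei_partial_le a b : 0 < a -> a <= b ->
  RInt (fun x => exp (- x) / x) a b <= exp (- a) / a.
Proof.
  intros Ha Hab.
  assert (HI : is_RInt (fun x => exp (- x) / a) a b (exp (- a) / a - exp (- b) / a)).
  { replace (exp (- a) / a - exp (- b) / a) with
      (minus (- exp (- b) / a) (- exp (- a) / a))
      by (unfold minus, plus, opp; simpl; lra).
    apply (is_RInt_derive (V := R_CompleteNormedModule) (fun x => - exp (- x) / a)).
    - intros x _. auto_derive; [easy|]. field. lra.
    - intros x _. apply (ex_derive_continuous (V := R_NormedModule)).
      auto_derive. easy. }
  apply Rle_trans with (exp (- a) / a - exp (- b) / a).
  - rewrite <- (is_RInt_unique _ _ _ _ HI). apply RInt_le; [easy| | |].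
    + apply Ei_integrand_ex; lra.
    + eexists; exact HI.
    + intros x Hx. unfold Rdiv. apply Rmult_le_compat_l; [left; apply exp_pos|].
      apply Rinv_le_contravar; lra.
  - assert (A := exp_pos (- b)).
    assert (0 < exp (- b) / a) by now apply Rdiv_lt_0_compat. lra.
Qed.

Lemma Ei_partial_mono a b c : 0 < a -> a <= b -> b <= c ->
  RInt (fun x => exp (- x) / x) a b <= RInt (fun x => exp (- x) / x) a c.
Proof.
  intros Ha Hab Hbc.
  rewrite <- (RInt_Chasles (V := R_CompleteNormedModule) _ a b c)
    by (apply Ei_integrand_ex; lra).
  assert (H : 0 <= RInt (fun x => exp (- x) / x) b c).
  { apply RInt_ge_0; [easy|apply Ei_integrand_ex; lra|].
    intros x Hx. left. apply Ei_integrand_pos. lra. }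
  unfold plus; simpl. lra.
Qed.

(** Convergence has to be shown before [RInt_gen] has a known value: the partial integrals increase
    and are at most [exp (- a) / a], so [Ei a] is their supremum. *)
Lemma Ei_ge a b : 0 < a -> a <= b ->
  RInt (fun x => exp (- x) / x) a b <= Ei a.
Proof.
  intros Ha Hab. set (f := fun x => exp (- x) / x).
  destruct (completeness (fun y => exists b, a <= b /\ y = RInt f a b)) as [l [L1 L2]].
  - exists (exp (- a) / a). intros y (c & Hc & ->). now apply Ei_partial_le.
  - exists (RInt f a a), a. split; [lra|easy].
  - assert (HE : Ei a = l).
    { unfold Ei. apply (is_RInt_gen_unique (V := R_CompleteNormedModule)).
      intros P [eps HP].
      assert (Hex : exists c, a <= c /\ l - eps < RInt f a c).
      { apply NNPP. intros Hno. assert (He := cond_pos eps).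
        assert (l <= l - eps); [|lra]. apply L2. intros y (c & Hc & ->).
        apply Rnot_lt_le. intros Hlt. apply Hno. now exists c. }
      destruct Hex as (c & Hc & Hlt).
      exists (fun x => x = a) (fun x => c < x).
      + easy.
      + now exists c.
      + intros x y -> Hy. exists (RInt f a y). split.
        * apply RInt_correct. apply Ei_integrand_ex; simpl; lra.
        * apply HP. apply Rabs_def1.
          -- assert (RInt f a y <= l) by (apply L1; exists y; split; [lra|easy]).
             assert (He := cond_pos eps).
             change (RInt f a y - l < eps). lra.
          -- assert (RInt f a c <= RInt f a y) by (apply Ei_partial_mono; lra).
             change (- eps < RInt f a y - l). lra. }
    rewrite HE. apply L1. now exists b.
Qed.

Lemma Ei_ge_0 a : 0 < a -> 0 <= Ei a.
Proof.
  intros Ha. eapply Rle_trans; [|apply (Ei_ge a a); lra].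
  rewrite (RInt_point (V := R_CompleteNormedModule)). apply Rle_refl.
Qed.

(** * The boundary of the domain *)

(** An upper bound for the arc-length integral of [k], stated on Riemann sums so that the integral
    itself need not be constructed. *)
Definition var_bound (K : chain) (k : C -> R) (b : R) : Prop :=
  forall eps, 0 < eps -> exists d, 0 < d /\ forall N, nodes K d N ->
    qvar N k <= b + eps.

Lemma var_bound_app K L k a b : var_bound K k a -> var_bound L k b ->
  var_bound (chain_app K L) k (a + b).
Proof.
  intros Ha Hb eps He.
  destruct (Ha (eps / 2)) as (d1 & D1 & H1); [lra|].
  destruct (Hb (eps / 2)) as (d2 & D2 & H2); [lra|].
  exists (Rmin d1 d2). split; [now apply Rmin_glb_lt|].
  intros N (N1 & N2 & HN1 & HN2 & ->). rewrite qvar_app.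
  assert (A1 := H1 N1 (nodes_mono K _ _ N1 (Rmin_l _ _) HN1)).
  assert (A2 := H2 N2 (nodes_mono L _ _ N2 (Rmin_r _ _) HN2)). lra.
Qed.

Lemma var_bound_le K k a b : a <= b -> var_bound K k a -> var_bound K k b.
Proof.
  intros Hab Ha eps He. destruct (Ha eps He) as (d & D & H).
  exists d. split; [easy|]. intros N HN. specialize (H N HN). lra.
Qed.

Lemma Cmod_polar_sqr (c : C) (rho x t : R) :
  c = RtoC 1 -> Cmod (c + rho * cis x - t) ^ 2
  = (1 - t) ^ 2 + 2 * (1 - t) * rho * cos x + rho ^ 2.
Proof.
  intros ->. rewrite Cmod_sqr. unfold Re, Im, cis; simpl.
  assert (A := sin2_cos2 x). unfold Rsqr in A.
  ring_simplify.
  assert (E : rho ^ 2 * sin x ^ 2 = rho ^ 2 - rho ^ 2 * cos x ^ 2).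
  { replace (sin x ^ 2) with (1 - cos x ^ 2) by (rewrite <- A; ring). ring. }
  rewrite E. ring.
Qed.

Lemma Cmod_polar_1 (rho x : R) : 0 <= rho -> Cmod (1 + rho * cis x - 1) = rho.
Proof.
  intros H. replace (1 + rho * cis x - 1)%C with (RtoC rho * cis x)%C by ring.
  rewrite Cmod_mult, Cmod_R, Cmod_cis, Rabs_pos_eq by easy. ring.
Qed.

Lemma Cmod_circle_sqr (s x t : R) :
  Cmod (0 + s * cis x - t) ^ 2 = s ^ 2 - 2 * s * t * cos x + t ^ 2.
Proof.
  rewrite Cmod_sqr. unfold Re, Im, cis; simpl.
  assert (A := sin2_cos2 x). unfold Rsqr in A.
  ring_simplify.
  assert (E : s ^ 2 * sin x ^ 2 = s ^ 2 - s ^ 2 * cos x ^ 2).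
  { replace (sin x ^ 2) with (1 - cos x ^ 2) by (rewrite <- A; ring). ring. }
  rewrite E. ring.
Qed.

Lemma pow2_le_inv (a b : R) : 0 <= b -> a ^ 2 <= b ^ 2 -> a <= b.
Proof.
  intros Hb H. rewrite <- !Rsqr_pow2 in H. now apply Rsqr_incr_0_var.
Qed.

(** * A logarithm of [z - 1] to the left of 1 *)

Definition half_plane (z : C) : Prop := Re z < 1.

Lemma half_plane_open : C_open half_plane.
Proof.
  intros z Hz. exists (1 - Re z). split; [unfold half_plane in Hz; lra|].
  intros w Hw. unfold half_plane.
  assert (A := re_le_Cmod (w - z)). apply Rabs_le_between in A.
  replace (Re (w - z)) with (Re w - Re z) in A by (unfold Re; simpl; ring). lra.
Qed.

Lemma half_plane_star : starlike 0 half_plane.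
Proof.
  intros z t Hz Ht. unfold half_plane in *.
  replace (Re (0 + t * (z - 0))) with (t * Re z) by (unfold Re; simpl; ring).
  destruct (Req_dec t 0) as [->|Ht0]; [lra|]. nra.
Qed.

Lemma half_plane_log : exists Lg, forall z, half_plane z ->
  strict_deriv (V := C_NormedModule) Lg (fun z => (/ (z - 1))%C) z.
Proof.
  destruct (primitive_ex half_plane 0 (fun z => (/ (z - 1))%C) half_plane_open
    half_plane_star) as [Lg HL].
  - unfold half_plane, Re; simpl; lra.
  - intros z Hz. eexists. apply strict_deriv_cdiff. apply (strict_deriv_inv 1 z).
    intros ->. unfold half_plane, Re in Hz; simpl in Hz. lra.
  - exists Lg. intros z Hz. now apply HL.
Qed.

Lemma polar_half_plane u x : 0 < u -> cos x < 0 -> half_plane (1 + u * cis x)%C.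
Proof.
  intros Hu Hx. unfold half_plane, Re, cis; simpl. nra.
Qed.

Lemma bdry_lip_curve {V : NormedModule C_AbsRing} g l H (P : C -> V) :
  qsum (bdry (lip_curve g l H)) P = minus (P (g 1)) (P (g 0)).
Proof. simpl. lin_ring. Qed.

Section Contour.
Variables s k r : R.
Hypothesis s_range : 0 < s < 1.
Hypothesis k_pos : 0 < k.
Hypothesis k_sqr : k ^ 2 = 1 - s ^ 2.
Hypothesis r_range : 0 < r < 1.

(** The circles [|z| = s] and [|z - 1| = rho1] meet at the points
    [s cis (+- alpha)] and [1 - rho1 cis (+- phi)].  If [r <= k] these are the
    points where the tangents from [1] touch the circle [|z| = s]; otherwise
    the contour consists of two arcs only and the segments are degenerate. *)
Let rho1 := Rmax r k.
(** Law of cosines in the triangle with vertices 0, 1 and the meeting point, whose sides are 1, [s]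
    and [rho1]: [phi] is its angle at 1 and [alpha] its angle at 0. *)
Let cphi := (k ^ 2 + rho1 ^ 2) / (2 * rho1).
Let calpha := (1 + s ^ 2 - rho1 ^ 2) / (2 * s).
Let phi := acos cphi.
Let alpha := acos calpha.

Lemma k_lt_1 : k < 1.
Proof. nra. Qed.

Lemma rho1_range : r <= rho1 /\ k <= rho1 /\ 0 < rho1 < 1.
Proof.
  assert (H := k_lt_1). unfold rho1.
  assert (A1 := Rmax_l r k). assert (A2 := Rmax_r r k).
  repeat split; try lra. apply Rmax_lub_lt; lra.
Qed.

Lemma cphi_range : 0 < cphi <= 1.
Proof.
  destruct rho1_range as (H1 & H2 & H3). unfold cphi. split.
  - apply Rdiv_lt_0_compat; nra.
  - apply Rmult_le_reg_r with (2 * rho1); [lra|].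
    unfold Rdiv. rewrite Rmult_assoc, Rinv_l by lra.
    assert (1 - s <= k) by (apply pow2_le_inv; nra). nra.
Qed.

Lemma cphi_rho1 : 2 * rho1 * cphi = k ^ 2 + rho1 ^ 2.
Proof. destruct rho1_range as (H1 & H2 & H3). unfold cphi. field. lra. Qed.

Lemma calpha_s : 2 * s * calpha = 1 + s ^ 2 - rho1 ^ 2.
Proof. unfold calpha. field. lra. Qed.

Lemma calpha_range : 0 < calpha <= s.
Proof.
  destruct rho1_range as (H1 & H2 & H3). assert (A := calpha_s). split; nra.
Qed.

Lemma cos_phi : cos phi = cphi.
Proof. apply cos_acos. assert (A := cphi_range). lra. Qed.

Lemma cos_alpha : cos alpha = calpha.
Proof. apply cos_acos. assert (A := calpha_range). lra. Qed.

Lemma acos_acute (x : R) : 0 < x <= 1 -> 0 <= acos x < PI / 2.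
Proof.
  intros Hx. assert (Hb := acos_bound x). split; [lra|].
  apply Rnot_le_lt. intros Hle. assert (HP := PI_RGT_0).
  assert (A := cos_decr_1 (PI / 2) (acos x)). rewrite cos_PI2, cos_acos in A by lra.
  assert (x <= 0) by (apply A; lra). lra.
Qed.

Lemma phi_range : 0 <= phi < PI / 2.
Proof. apply acos_acute, cphi_range. Qed.

Lemma alpha_range : 0 <= alpha < PI / 2.
Proof. apply acos_acute. assert (A := calpha_range). lra. Qed.

Lemma sin_phi_ge_0 : 0 <= sin phi.
Proof. assert (A := phi_range). assert (H := PI_RGT_0). apply sin_ge_0; lra. Qed.

Lemma sin_alpha_ge : k <= sin alpha.
Proof.
  assert (A := alpha_range). assert (H := PI_RGT_0).
  apply pow2_le_inv; [apply sin_ge_0; lra|].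
  assert (S := sin2_cos2 alpha). rewrite cos_alpha in S. unfold Rsqr in S.
  assert (B := calpha_range). nra.
Qed.

Lemma alpha_pos : 0 < alpha.
Proof.
  assert (A := alpha_range). destruct (Req_dec alpha 0) as [E|E]; [|lra].
  assert (B := sin_alpha_ge). rewrite E, sin_0 in B. lra.
Qed.

Lemma circles_meet : s * cos alpha = 1 - rho1 * cos phi /\
  s * sin alpha = rho1 * sin phi.
Proof.
  assert (E1 := cphi_rho1). assert (E2 := calpha_s).
  destruct rho1_range as (H1 & H2 & H3).
  rewrite cos_phi, cos_alpha. split; [nra|].
  apply Rsqr_inj.
  - apply Rmult_le_pos; [lra|]. assert (A := sin_alpha_ge). lra.
  - apply Rmult_le_pos; [lra|apply sin_phi_ge_0].
  - rewrite !Rsqr_mult, !sin2, cos_phi, cos_alpha. unfold Rsqr.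
    assert (E3 : s * calpha = 1 - rho1 * cphi) by nra.
    replace (s * s * (1 - calpha * calpha)) with (s ^ 2 - (s * calpha) ^ 2) by ring.
    replace (rho1 * rho1 * (1 - cphi * cphi)) with (rho1 ^ 2 - (rho1 * cphi) ^ 2) by ring.
    rewrite E3. nra.
Qed.

Let q_up : C := (1 - r * cos phi, r * sin phi).
Let p_up : C := (1 - rho1 * cos phi, rho1 * sin phi).
Let q_lo : C := (1 - r * cos phi, - (r * sin phi)).
Let p_lo : C := (1 - rho1 * cos phi, - (rho1 * sin phi)).

Lemma r_ge_0 : 0 <= r. Proof. lra. Qed.
Lemma s_ge_0' : 0 <= s. Proof. lra. Qed.

Lemma up_outer_le : 0 <= PI - phi.
Proof. assert (A := phi_range). lra. Qed.

Lemma lo_outer_le : - (PI - phi) <= 0.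
Proof. assert (A := phi_range). lra. Qed.

Lemma up_inner_le : alpha <= PI.
Proof. assert (A := alpha_range). lra. Qed.

Lemma lo_inner_le : - PI <= - alpha.
Proof. assert (A := alpha_range). lra. Qed.

Let A2u := arc (RtoC 1) r 0 (PI - phi) r_ge_0 up_outer_le.
Let Su := segment q_up p_up.
Let A1u := arc (RtoC 0) s alpha PI s_ge_0' up_inner_le.
Let A1l := arc (RtoC 0) s (- PI) (- alpha) s_ge_0' lo_inner_le.
Let Sl := segment p_lo q_lo.
Let A2l := arc (RtoC 1) r (- (PI - phi)) 0 r_ge_0 lo_outer_le.

(** Run counterclockwise from [1 + r]: arc about 1, tangent segment inwards and arc of the circle
    [|z| = s] to [- s], then the mirror images in reverse order. *)
Definition contour : chain :=
  chain_app A2u (chain_app Su (chain_app A1u (chain_app A1l (chain_app Sl A2l)))).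

Lemma arc_path_0 c u a b : arc_path c u a b 0 = (c + u * cis a)%C.
Proof. unfold arc_path. do 3 f_equal. ring. Qed.

Lemma arc_path_1 c u a b : arc_path c u a b 1 = (c + u * cis b)%C.
Proof. unfold arc_path. do 3 f_equal. ring. Qed.

Lemma q_up_cis : (1 + r * cis (PI - phi))%C = q_up.
Proof.
  unfold cis, q_up. rewrite Rtrigo_facts.cos_pi_minus, Rtrigo_facts.sin_pi_minus.
  apply injective_projections; simpl; ring.
Qed.

Lemma q_lo_cis : (1 + r * cis (- (PI - phi)))%C = q_lo.
Proof.
  unfold cis, q_lo. rewrite cos_neg, sin_neg.
  rewrite Rtrigo_facts.cos_pi_minus, Rtrigo_facts.sin_pi_minus.
  apply injective_projections; simpl; ring.
Qed.

Lemma p_up_cis : (0 + s * cis alpha)%C = p_up.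
Proof.
  destruct circles_meet as [E1 E2]. unfold cis, p_up.
  apply injective_projections; simpl; lra.
Qed.

Lemma p_lo_cis : (0 + s * cis (- alpha))%C = p_lo.
Proof.
  destruct circles_meet as [E1 E2]. unfold cis, p_lo. rewrite cos_neg, sin_neg.
  apply injective_projections; simpl; lra.
Qed.

Lemma cis_neg_PI : cis (- PI) = cis PI.
Proof. unfold cis. rewrite cos_neg, sin_neg, sin_PI. f_equal. ring. Qed.

Lemma contour_closed : closed_chain contour.
Proof.
  intros V P. simpl.
  rewrite !arc_path_0, !arc_path_1, !seg_path_0, !seg_path_1.
  rewrite q_up_cis, q_lo_cis, p_up_cis, p_lo_cis, cis_neg_PI. lin_ring.
Qed.

Lemma not_Bset_polar (u x : R) :
  (forall t, 0 < t <= 1 -> 0 <= t ^ 2 * k ^ 2 + 2 * t * u * cos x + u ^ 2) ->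
  ~ Bset s (1 + u * cis x)%C.
Proof.
  intros H (t & Ht & Hlt). specialize (H (1 - t) ltac:(lra)).
  assert (A := Cmod_polar_sqr 1 u x t eq_refl).
  assert (B := Cmod_ge_0 (1 + u * cis x - t)).
  assert (Cmod (1 + u * cis x - t) ^ 2 < ((1 - t) * s) ^ 2) by nra.
  nra.
Qed.

(** If [r <= k] then [cphi = k] by tangency and the form is the square of [t * k - u]. Otherwise
    [u = rho1 = r] and it factors as [(1 - t) * (r ^ 2 - t * k ^ 2)]. *)
Lemma cone_form (u : R) : 0 <= u -> u <= rho1 -> (r <= u) ->
  forall t, 0 < t <= 1 -> 0 <= t ^ 2 * k ^ 2 - 2 * t * u * cphi + u ^ 2.
Proof.
  intros Hu0 Hu Hru t Ht. destruct rho1_range as (H1 & H2 & H3).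
  assert (E := cphi_rho1).
  destruct (Rle_dec r k) as [Hrk|Hrk].
  - assert (E1 : rho1 = k) by (unfold rho1; now apply Rmax_right).
    rewrite E1 in *. assert (E2 : cphi = k) by nra. rewrite E2.
    replace (_ + u ^ 2) with ((t * k - u) ^ 2) by ring. apply pow2_ge_0.
  - assert (E1 : rho1 = r) by (unfold rho1; apply Rmax_left; lra).
    rewrite E1 in *. assert (E2 : u = r) by lra. rewrite E2.
    replace (t ^ 2 * k ^ 2 - 2 * t * r * cphi + r ^ 2) with
      ((1 - t) * (r ^ 2 - t * k ^ 2)).
    + apply Rmult_le_pos; [lra|]. nra.
    + replace (2 * t * r * cphi) with (t * (2 * r * cphi)) by ring. rewrite E. ring.
Qed.

(** Outside both open pieces of the domain and in the closure of one of them. The position of the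
    contour enters later only through this predicate. *)
Definition on_boundary (z : C) : Prop :=
  r <= Cmod (z - 1) /\ ~ Bset s z /\ (Cmod (z - 1) <= r \/ Kset s z).

Lemma outer_arc_boundary x : - cos phi <= cos x -> on_boundary (1 + r * cis x)%C.
Proof.
  intros Hx. rewrite cos_phi in Hx. destruct rho1_range as (H1 & H2 & H3).
  repeat split.
  - rewrite Cmod_polar_1; lra.
  - apply not_Bset_polar. intros t Ht.
    assert (A := cone_form r ltac:(lra) H1 (Rle_refl _) t Ht).
    assert (0 < t * r) by (apply Rmult_lt_0_compat; lra). nra.
  - left. rewrite Cmod_polar_1; lra.
Qed.

Lemma segment_boundary u x : cos x = - cos phi -> r <= u <= rho1 ->
  on_boundary (1 + u * cis x)%C.
Proof.
  intros Hx Hu. rewrite cos_phi in Hx. destruct rho1_range as (H1 & H2 & H3).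
  assert (E := cphi_rho1).
  repeat split.
  - rewrite Cmod_polar_1; lra.
  - apply not_Bset_polar. intros t Ht. rewrite Hx.
    assert (A := cone_form u ltac:(lra) ltac:(lra) ltac:(lra) t Ht). lra.
  - destruct (Rle_dec r k) as [Hrk|Hrk].
    + right. assert (E1 : rho1 = k) by (unfold rho1; now apply Rmax_right).
      rewrite E1 in *. assert (E2 : cphi = k) by nra.
      assert (Huk : 0 <= u / k <= 1).
      { split; [apply Rdiv_le_0_compat; lra|].
        apply Rmult_le_reg_r with k; [easy|]. unfold Rdiv.
        rewrite Rmult_assoc, Rinv_l; lra. }
      exists (1 - u / k). split; [lra|].
      apply pow2_le_inv.
      * apply Rmult_le_pos; lra.
      * rewrite (Cmod_polar_sqr 1 u x _ eq_refl), Hx, E2.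
        replace (1 - (1 - u / k)) with (u / k) by ring.
        replace ((u / k * s) ^ 2) with ((u / k) ^ 2 * s ^ 2) by ring.
        replace (s ^ 2) with (1 - k ^ 2) by lra. right. field. lra.
    + left. assert (E1 : rho1 = r) by (unfold rho1; apply Rmax_left; lra).
      rewrite Cmod_polar_1; lra.
Qed.

Lemma inner_arc_boundary x : cos x <= cos alpha -> on_boundary (0 + s * cis x)%C.
Proof.
  intros Hx. rewrite cos_alpha in Hx. destruct rho1_range as (H1 & H2 & H3).
  assert (E := calpha_s). assert (A := calpha_range).
  repeat split.
  - apply pow2_le_inv; [apply Cmod_ge_0|]. rewrite Cmod_circle_sqr. nra.
  - intros (t & Ht & Hlt).
    assert (B := Cmod_circle_sqr s x t).
    assert (B0 := Cmod_ge_0 (0 + s * cis x - t)).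
    assert (Cmod (0 + s * cis x - t) ^ 2 < ((1 - t) * s) ^ 2) by nra.
    assert (0 <= t * (s * (s - cos x))).
    { apply Rmult_le_pos; [lra|]. apply Rmult_le_pos; lra. }
    assert (0 <= t * (t * k ^ 2)).
    { apply Rmult_le_pos; [lra|]. apply Rmult_le_pos; [lra|apply pow2_ge_0]. }
    nra.
  - right. apply Kset_disc. replace (0 + s * cis x)%C with (RtoC s * cis x)%C by ring.
    rewrite Cmod_mult, Cmod_R, Cmod_cis, Rabs_pos_eq; lra.
Qed.

Lemma convex_between a b t : a <= b -> 0 <= t <= 1 -> a <= a + t * (b - a) <= b.
Proof.
  intros Hab Ht. assert (0 <= t * (b - a)) by (apply Rmult_le_pos; lra).
  assert (0 <= (1 - t) * (b - a)) by (apply Rmult_le_pos; lra). lra.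
Qed.

Lemma cos_le_on (a x : R) : 0 <= a -> a <= x <= PI -> cos x <= cos a.
Proof. intros Ha Hx. apply cos_decr_1; lra. Qed.

Lemma seg_up_polar t :
  seg_path q_up p_up t = (1 + RtoC (r + t * (rho1 - r)) * cis (PI - phi))%C.
Proof.
  unfold seg_path, cis, q_up, p_up.
  rewrite Rtrigo_facts.cos_pi_minus, Rtrigo_facts.sin_pi_minus.
  apply injective_projections; simpl; ring.
Qed.

Lemma seg_lo_polar t :
  seg_path p_lo q_lo t = (1 + RtoC (rho1 + t * (r - rho1)) * cis (- (PI - phi)))%C.
Proof.
  unfold seg_path, cis, q_lo, p_lo. rewrite cos_neg, sin_neg.
  rewrite Rtrigo_facts.cos_pi_minus, Rtrigo_facts.sin_pi_minus.
  apply injective_projections; simpl; ring.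
Qed.

Lemma contour_boundary z : img contour z -> on_boundary z.
Proof.
  assert (HP := PI_RGT_0). assert (Hphi := phi_range). assert (Ha := alpha_range).
  destruct rho1_range as (H1 & H2 & H3).
  intros [(t & Ht & ->)|[(t & Ht & ->)|[(t & Ht & ->)|
    [(t & Ht & ->)|[(t & Ht & ->)|(t & Ht & ->)]]]]].
  - apply outer_arc_boundary.
    rewrite <- Rtrigo_facts.cos_pi_minus.
    assert (A := convex_between 0 (PI - phi) t up_outer_le Ht).
    apply cos_decr_1; lra.
  - rewrite seg_up_polar. apply segment_boundary.
    + apply Rtrigo_facts.cos_pi_minus.
    + apply convex_between; easy.
  - apply inner_arc_boundary.
    assert (A := convex_between alpha PI t up_inner_le Ht). apply cos_le_on; lra.
  - apply inner_arc_boundary.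
    assert (A := convex_between (- PI) (- alpha) t lo_inner_le Ht).
    rewrite <- cos_neg. apply cos_le_on; lra.
  - rewrite seg_lo_polar. apply segment_boundary.
    + rewrite cos_neg. apply Rtrigo_facts.cos_pi_minus.
    + assert (A := convex_between r rho1 (1 - t) H1 ltac:(lra)). lra.
  - apply outer_arc_boundary.
    rewrite <- Rtrigo_facts.cos_pi_minus.
    assert (A := convex_between (- (PI - phi)) 0 t lo_outer_le Ht).
    rewrite <- (cos_neg (_ + _)). apply cos_decr_1; lra.
Qed.

Lemma left_arc_le : PI - phi <= PI + phi.
Proof. assert (A := phi_range). lra. Qed.

(** The two arcs about 1 contribute [Ci] times their angles. All the rest lies in the half plane
    left of 1, where a logarithm exists, so only its endpoints [q_up] and [q_lo] matter. *)
Lemma contour_index_1 :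
  cint (V := C_NormedModule) contour (fun z => (/ (z - 1))%C) (2 * PI * Ci)%C.
Proof.
  destruct half_plane_log as [Lg HL].
  assert (HP := PI_RGT_0). assert (Hphi := phi_range). assert (Ha := alpha_range).
  destruct rho1_range as (H1 & H2 & H3). assert (Hcp := cphi_range).
  assert (Hcphi : cos (PI - phi) < 0).
  { rewrite Rtrigo_facts.cos_pi_minus, cos_phi. lra. }
  assert (F : forall g l H, (forall t, 0 <= t <= 1 -> half_plane (g t)) ->
    cint (V := C_NormedModule) (lip_curve g l H) (fun z => (/ (z - 1))%C)
      (Lg (g 1) - Lg (g 0))%C).
  { intros g l H Hg. assert (A := cint_ftc (V := C_NormedModule)
      (lip_curve g l H) Lg (fun z => (/ (z - 1))%C)).
    rewrite bdry_lip_curve in A. apply A. intros z (t & Ht & ->). auto. }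
  assert (I1 := cint_arc_center 1 r 0 (PI - phi) r_ge_0 up_outer_le ltac:(lra)).
  assert (I6 := cint_arc_center 1 r (- (PI - phi)) 0 r_ge_0 lo_outer_le ltac:(lra)).
  assert (J' := cint_arc_center 1 r (PI - phi) (PI + phi) r_ge_0 left_arc_le ltac:(lra)).
  assert (I2 := F _ _ (seg_lip q_up p_up)).
  assert (I3 := F _ _ (arc_lip 0 s alpha PI s_ge_0' up_inner_le)).
  assert (I4 := F _ _ (arc_lip 0 s (- PI) (- alpha) s_ge_0' lo_inner_le)).
  assert (I5 := F _ _ (seg_lip p_lo q_lo)).
  assert (J := F _ _ (arc_lip 1 r (PI - phi) (PI + phi) r_ge_0 left_arc_le)).
  rewrite !arc_path_0, !arc_path_1 in *. rewrite !seg_path_0, !seg_path_1 in *.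
  assert (Hin : forall x, half_plane (0 + s * cis x)%C).
  { intros x. unfold half_plane, Re, cis; simpl. assert (A := COS_bound x). nra. }
  assert (K2 := I2 ltac:(intros t Ht; rewrite seg_up_polar; apply polar_half_plane;
    [assert (A := convex_between r rho1 t H1 Ht); lra|easy])).
  assert (K3 := I3 ltac:(intros t _; apply Hin)).
  assert (K4 := I4 ltac:(intros t _; apply Hin)).
  assert (K5 := I5 ltac:(intros t Ht; rewrite seg_lo_polar; apply polar_half_plane;
    [assert (A := convex_between r rho1 (1 - t) H1 ltac:(lra)); lra|
     rewrite cos_neg; easy])).
  assert (KJ := J ltac:(intros t Ht; apply polar_half_plane; [lra|];
    assert (A := convex_between _ _ t left_arc_le Ht); apply cos_lt_0; lra)).
  (* The increment of the logarithm from [q_up] to [q_lo] is read off from the left arc of the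
     circle of radius [r] about 1, which lies in the half plane and has angle [2 * phi]. *)
  assert (EJ := cint_unique (V := C_NormedModule) _ _ _ _ KJ J').
  replace (cis (PI + phi)) with (cis (- (PI - phi))) in EJ.
  2:{ unfold cis. rewrite cos_neg, sin_neg, (Rplus_comm PI), neg_cos, neg_sin.
      rewrite Rtrigo_facts.cos_pi_minus, Rtrigo_facts.sin_pi_minus. easy. }
  rewrite q_up_cis, q_lo_cis in EJ.
  rewrite p_up_cis in K3. rewrite p_lo_cis, cis_neg_PI in K4.
  assert (A := cint_app _ _ _ _ _ I1 (cint_app _ _ _ _ _ K2 (cint_app _ _ _ _ _ K3
    (cint_app _ _ _ _ _ K4 (cint_app _ _ _ _ _ K5 I6))))).
  match type of A with cint _ _ ?v => replace (2 * PI * Ci)%C with v; [exact A|] end.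
  clear - EJ.
  change ((Ci * RtoC (PI - phi - 0) + ((Lg p_up - Lg q_up) +
    ((Lg (0 + s * cis PI) - Lg p_up) + ((Lg p_lo - Lg (0 + s * cis PI)) +
    ((Lg q_lo - Lg p_lo) + Ci * RtoC (0 - - (PI - phi))))))) = 2 * PI * Ci)%C.
  transitivity (Ci * RtoC (PI - phi - 0) + (Lg q_lo - Lg q_up)
    + Ci * RtoC (0 - - (PI - phi)))%C; [ring|].
  change ((Lg q_lo - Lg q_up)%C = (Ci * RtoC (PI + phi - (PI - phi)))%C) in EJ.
  rewrite EJ, !RtoC_minus, !RtoC_opp, !RtoC_plus, RtoC_minus. ring.
Qed.

(** * The length estimate *)

Section Estimate.
Variable m : nat.

Let kernel (z : C) : R := Cmod z ^ m / Cmod (z - 1).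

Lemma outer_arc_var_bound a b Hab :
  var_bound (arc 1 r a b r_ge_0 Hab) kernel ((b - a) * (1 + r) ^ m).
Proof.
  intros eps He.
  destruct (qvar_lip_curve _ _ (arc_lip 1 r a b r_ge_0 Hab) kernel
    (fun t => (b - a) * (1 + r) ^ m * t) (fun _ => (b - a) * (1 + r) ^ m))
    with (eps := eps) as (d & Hd & H).
  - intros t _. auto_derive; [easy|ring].
  - intros t _. apply continuous_const.
  - intros t _. unfold arc_path, kernel. rewrite Cmod_polar_1 by lra. split.
    + apply Rdiv_le_0_compat; [apply pow_le, Cmod_ge_0|lra].
    + replace (r * (b - a) * (Cmod (1 + r * cis (a + t * (b - a))) ^ m / r)) with
        ((b - a) * Cmod (1 + r * cis (a + t * (b - a))) ^ m) by (field; lra).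
      apply Rmult_le_compat_l; [lra|]. apply pow_incr.
      split; [apply Cmod_ge_0|]. eapply Rle_trans; [apply Cmod_triangle|].
      rewrite Cmod_1, Cmod_mult, Cmod_R, Cmod_cis, Rabs_pos_eq; lra.
  - easy.
  - exists d. split; [easy|]. intros N HN. specialize (H N HN). lra.
Qed.

(** [|s cis x - 1|^2 = (1 - s)^2 cos^2 (x/2) + (1 + s)^2 sin^2 (x/2)]. *)
Lemma circle_distance_lower x : 0 <= sin (x / 2) ->
  sin (x / 2) <= Cmod (0 + s * cis x - 1).
Proof.
  intros Hx. apply pow2_le_inv; [apply Cmod_ge_0|]. rewrite Cmod_circle_sqr.
  assert (A := cos_2a_sin (x / 2)). replace (2 * (x / 2)) with x in A by field.
  rewrite A. assert (B := SIN_bound (x / 2)). set (y := sin (x / 2)) in *.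
  assert (0 <= (1 - s) ^ 2 * (1 - y ^ 2)).
  { apply Rmult_le_pos; [apply pow2_ge_0|nra]. }
  assert (0 <= s * y ^ 2) by (apply Rmult_le_pos; [lra|apply pow2_ge_0]).
  assert (0 <= s ^ 2 * y ^ 2) by (apply Rmult_le_pos; apply pow2_ge_0).
  nra.
Qed.

(** That is [2 s^(m+1) ln (tan (x / 4))], an antiderivative of [s^(m+1) / sin (x / 2)], the majorant
    of the kernel times arc length on the inner circle. *)
Let G (x : R) : R := 2 * s ^ (m + 1) * (ln (sin (x / 4)) - ln (cos (x / 4))).

Lemma G_derive x : 0 < x < 2 * PI ->
  is_derive G x (s ^ (m + 1) / sin (x / 2)).
Proof.
  intros Hx.
  assert (S4 : 0 < sin (x / 4)) by (apply sin_gt_0; lra).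
  assert (C4 : 0 < cos (x / 4)) by (apply cos_gt_0; lra).
  assert (E : sin (x / 2) = 2 * sin (x / 4) * cos (x / 4)).
  { rewrite <- sin_2a. f_equal. field. }
  rewrite E. unfold G. auto_derive; [easy|].
  assert (S := sin2_cos2 (x / 4)). unfold Rsqr in S.
  change (x * / 4) with (x / 4).
  set (a := sin (x / 4)) in *. set (b := cos (x / 4)) in *.
  apply Rmult_eq_reg_r with (4 * a * b); [|nra].
  transitivity (2 * s ^ (m + 1) * (a * a + b * b)); [field; lra|].
  rewrite S. field. lra.
Qed.

(** Origin of [4 / cos eta]: [G PI = 0], the duplication formula gives
    [sin alpha <= 4 sin (alpha / 4)], and [k <= sin alpha]. *)
Lemma G_ends : G PI - G alpha <= 2 * s ^ (m + 1) * ln (4 / k).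
Proof.
  assert (Ha := alpha_range). assert (Ha0 := alpha_pos). assert (HP := PI_RGT_0).
  unfold G. rewrite cos_PI4, sin_PI4, Rminus_diag, Rmult_0_r.
  set (x := alpha / 4).
  assert (S4 : 0 < sin x) by (apply sin_gt_0; unfold x; lra).
  assert (C4 : 0 < cos x) by (apply cos_gt_0; unfold x; lra).
  replace (0 - 2 * s ^ (m + 1) * (ln (sin x) - ln (cos x))) with
    (2 * s ^ (m + 1) * (ln (cos x) - ln (sin x))) by ring.
  apply Rmult_le_compat_l.
  { assert (A := pow_lt s (m + 1) ltac:(lra)). lra. }
  rewrite <- ln_div by easy. apply ln_le.
  { now apply Rdiv_lt_0_compat. }
  assert (E : sin alpha <= 4 * sin x).
  { replace alpha with (2 * (2 * x)) by (unfold x; field).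
    rewrite sin_2a, sin_2a. assert (B1 := COS_bound x). assert (B2 := COS_bound (2 * x)).
    assert (cos x * cos (2 * x) <= 1) by nra. nra. }
  assert (F := sin_alpha_ge). assert (B := COS_bound x).
  apply Rmult_le_reg_r with (sin x * k); [nra|].
  replace (cos x / sin x * (sin x * k)) with (cos x * k) by (field; lra).
  replace (4 / k * (sin x * k)) with (4 * sin x) by (field; lra). nra.
Qed.

(** The sign [e] treats the arcs above and below the real axis at once: [e] times the angle runs in
    [[alpha, PI]]. *)
Lemma inner_arc_var_bound e a b Hab : e * e = 1 -> b - a = PI - alpha ->
  (forall t, 0 <= t <= 1 -> alpha <= e * (a + t * (b - a)) <= PI) ->
  e * G (e * b) - e * G (e * a) = G PI - G alpha ->
  var_bound (arc 0 s a b s_ge_0' Hab) kernel (2 * s ^ (m + 1) * ln (4 / k)).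
Proof.
  intros Hee Hba Hran Hend.
  assert (Ha0 := alpha_pos). assert (HP := PI_RGT_0).
  apply var_bound_le with (G PI - G alpha); [apply G_ends|].
  assert (Hsin : forall t, 0 <= t <= 1 -> 0 < sin (e * (a + t * (b - a)) / 2)).
  { intros t Ht. specialize (Hran t Ht). apply sin_gt_0; lra. }
  intros eps He.
  destruct (qvar_lip_curve _ _ (arc_lip 0 s a b s_ge_0' Hab) kernel
    (fun t => e * G (e * (a + t * (b - a))))
    (fun t => (b - a) * (s ^ (m + 1) / sin (e * (a + t * (b - a)) / 2))))
    with (eps := eps) as (d & Hd & H).
  - intros t Ht. specialize (Hran t Ht).
    assert (D1 : is_derive (fun t => e * (a + t * (b - a))) t (e * (b - a)))
      by (auto_derive; [easy|ring]).
    assert (D2 := is_derive_comp G _ t _ _ (G_derive (e * (a + t * (b - a))) ltac:(lra)) D1).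
    assert (D3 := is_derive_scal _ t e _ D2).
    replace ((b - a) * (s ^ (m + 1) / sin (e * (a + t * (b - a)) / 2))) with
      (e * (e * (b - a) * (s ^ (m + 1) / sin (e * (a + t * (b - a)) / 2)))).
    + exact D3.
    + rewrite <- !Rmult_assoc, Hee. ring.
  - intros t Ht. specialize (Hsin t Ht).
    apply (ex_derive_continuous (V := R_NormedModule)). auto_derive.
    change (e * (a + t * (b + - a)) * / 2) with (e * (a + t * (b - a)) / 2). lra.
  - intros t Ht. specialize (Hsin t Ht). unfold arc_path, kernel.
    set (x := a + t * (b - a)) in *.
    assert (HE : 0 < sin (e * x / 2) <= Cmod (0 + s * cis x - 1)).
    { split; [easy|].
      assert (He1 : e = 1 \/ e = -1) by nra. destruct He1 as [->| ->].
      - replace (1 * x / 2) with (x / 2) in * by field.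
        apply circle_distance_lower. lra.
      - replace (-1 * x / 2) with (- x / 2) in * by field.
        assert (A := circle_distance_lower (- x) ltac:(lra)).
        assert (E : Cmod (0 + s * cis (- x) - 1) = Cmod (0 + s * cis x - 1)).
        { rewrite <- (Cmod_conj (0 + s * cis x - 1)). f_equal.
          unfold Cconj, cis. rewrite cos_neg, sin_neg.
          apply injective_projections; simpl; ring. }
        lra. }
    assert (Hc : Cmod (0 + s * cis x) = s).
    { replace (0 + s * cis x)%C with (RtoC s * cis x)%C by ring.
      rewrite Cmod_mult, Cmod_R, Cmod_cis, Rabs_pos_eq; lra. }
    rewrite Hc. assert (Hp := pow_lt s m ltac:(lra)). split.
    + apply Rdiv_le_0_compat; lra.
    + rewrite pow_add, pow_1. replace (s * (b - a) * (s ^ m / Cmod (0 + s * cis x - 1)))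
        with ((b - a) * (s ^ m * s / Cmod (0 + s * cis x - 1))) by (field; lra).
      apply Rmult_le_compat_l; [lra|]. apply Rmult_le_compat_l; [nra|].
      apply Rinv_le_contravar; lra.
  - easy.
  - exists d. split; [easy|]. intros N HN. specialize (H N HN). cbv beta in H.
    replace (a + 1 * (b - a)) with b in H by ring.
    replace (a + 0 * (b - a)) with a in H by ring. lra.
Qed.

Let c := (INR m + 1) / 2 * k.

Lemma c_pos : 0 < c.
Proof. unfold c. assert (A := pos_INR m). apply Rmult_lt_0_compat; lra. Qed.

Lemma exp_half_le_2 : exp (/ 2) <= 2.
Proof.
  apply pow2_le_inv; [lra|]. replace (exp (/ 2) ^ 2) with (exp (/ 2) * exp (/ 2)) by ring.
  rewrite <- exp_plus. replace (/ 2 + / 2) with 1 by field.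
  assert (A := exp_le_3). lra.
Qed.

Lemma exp_INR_mult (n : nat) (x : R) : exp x ^ n = exp (INR n * x).
Proof.
  induction n as [|n IH]; [simpl; now rewrite Rmult_0_l, exp_0|].
  rewrite S_INR. simpl. rewrite IH, <- exp_plus. f_equal. ring.
Qed.

(** The squared modulus is [1 - 2 u k + u^2 <= 1 - u k <= exp (- u k)]. Passing from [m] to [m + 1]
    in the exponent costs [exp (u k / 2) <= exp (1 / 2) <= 2]; this 2 on each of the two segments
    makes the 4 before [Ei]. *)
Lemma tangent_power_bound u x : cos x = - k -> 0 <= u <= k ->
  Cmod (1 + u * cis x) ^ m <= 2 * exp (- (c / k * (u * k))).
Proof.
  intros Hx Hu. assert (Hk1 := k_lt_1).
  assert (Hle : Cmod (1 + u * cis x) <= exp (- (u * k / 2))).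
  { apply pow2_le_inv; [left; apply exp_pos|].
    assert (E := Cmod_polar_sqr 1 u x 0 eq_refl).
    replace (1 + u * cis x - 0)%C with (1 + u * cis x)%C in E by ring.
    rewrite E, Hx, exp_INR_mult.
    replace (INR 2 * - (u * k / 2)) with (- (u * k)) by (simpl; field).
    eapply Rle_trans; [|apply exp_ineq1_le]. nra. }
  apply Rle_trans with (exp (- (u * k / 2)) ^ m).
  { apply pow_incr. split; [apply Cmod_ge_0|easy]. }
  rewrite exp_INR_mult.
  replace (INR m * - (u * k / 2)) with (u * k / 2 + - (c / k * (u * k)))
    by (unfold c; field; lra).
  rewrite exp_plus. apply Rmult_le_compat_r; [left; apply exp_pos|].
  eapply Rle_trans; [|exact exp_half_le_2].
  destruct (Rle_lt_or_eq_dec (u * k / 2) (/ 2)) as [Hlt|Heq]; [nra| |].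
  - left. now apply exp_increasing.
  - rewrite Heq. lra.
Qed.

(** The sign [e] is the direction of travel. For [r <= k] the kernel at distance [u] from 1 is at
    most [2 exp (- c u) / u], and the substitution [y = c u] produces [Ei]; for [r > k] the segment
    has length zero. *)
Lemma segment_var_bound e ua ub x P Q :
  e * e = 1 -> cos x = - cos phi -> ua + ub = r + rho1 -> e * (ub - ua) = rho1 - r ->
  (forall t, seg_path P Q t = (1 + RtoC (ua + t * (ub - ua)) * cis x)%C) ->
  var_bound (segment P Q) kernel (2 * Ei (c * r)).
Proof.
  intros Hee Hx Hsum Hdif Hpath.
  destruct rho1_range as (H1 & H2 & H3). assert (Hc := c_pos).
  set (f := fun y => exp (- y) / y).
  set (E := fun y => RInt f (c * r) y).
  assert (Hcr : 0 < c * r) by nra.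
  apply var_bound_le with (2 * (E (c * rho1) - E (c * r))).
  { apply Rmult_le_compat_l; [lra|]. unfold E.
    rewrite (RInt_point (V := R_CompleteNormedModule)).
    unfold zero; simpl. rewrite Rminus_0_r. apply Ei_ge; nra. }
  assert (He1 : e = 1 \/ e = -1) by nra.
  assert (Hu : forall t, 0 <= t <= 1 -> r <= ua + t * (ub - ua) <= rho1).
  { intros t Ht. destruct He1 as [->| ->].
    - assert (A := convex_between r rho1 t H1 Ht).
      replace (ua + t * (ub - ua)) with (r + t * (rho1 - r)) by nra. easy.
    - assert (A := convex_between r rho1 (1 - t) H1 ltac:(lra)).
      replace (ua + t * (ub - ua)) with (r + (1 - t) * (rho1 - r)) by nra. easy. }
  assert (HPQ : Cmod (Q - P) = rho1 - r).
  { assert (E0 := seg_path_0 P Q). assert (E1 := seg_path_1 P Q).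
    rewrite Hpath in E0, E1. rewrite <- E0, <- E1.
    replace (_ - _)%C with (RtoC (ub - ua) * cis x)%C.
    - rewrite Cmod_mult, Cmod_R, Cmod_cis. destruct He1 as [->| ->].
      + rewrite Rabs_pos_eq; lra.
      + rewrite Rabs_left1; lra.
    - rewrite !RtoC_plus, !RtoC_mult, RtoC_minus. ring. }
  assert (HE : forall y, 0 < y -> is_derive E y (f y)).
  { intros y Hy. apply (is_derive_RInt (V := R_NormedModule) f E (c * r)).
    - assert (Hy2 : 0 < y / 2) by lra. exists (mkposreal _ Hy2). intros w Hw.
      apply (RInt_correct (V := R_CompleteNormedModule)). apply Ei_integrand_ex; [easy|].
      change (Rabs (w - y) < y / 2) in Hw. apply Rabs_def2 in Hw. lra.
    - now apply Ei_integrand_continuous. }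
  intros eps He.
  destruct (qvar_lip_curve _ _ (seg_lip P Q) kernel
    (fun t => 2 * e * E (c * (ua + t * (ub - ua))))
    (fun t => 2 * (rho1 - r) * c * f (c * (ua + t * (ub - ua)))))
    with (eps := eps) as (d & Hd & H).
  - intros t Ht. specialize (Hu t Ht).
    assert (D1 : is_derive (fun t => c * (ua + t * (ub - ua))) t (c * (ub - ua)))
      by (auto_derive; [easy|ring]).
    assert (D2 := is_derive_comp E _ t _ _ (HE (c * (ua + t * (ub - ua))) ltac:(nra)) D1).
    assert (D3 := is_derive_scal _ t (2 * e) _ D2).
    replace (2 * (rho1 - r) * c * f (c * (ua + t * (ub - ua)))) with
      ((2 * e) * (c * (ub - ua) * f (c * (ua + t * (ub - ua))))).
    + exact D3.
    + rewrite <- Hdif. ring.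
  - intros t Ht. specialize (Hu t Ht).
    apply (ex_derive_continuous (V := R_NormedModule)). unfold f. auto_derive. nra.
  - intros t Ht. specialize (Hu t Ht). unfold kernel.
    rewrite Hpath, Cmod_polar_1, HPQ by lra. set (u := ua + t * (ub - ua)) in *.
    assert (Hp := pow_le (Cmod (1 + u * cis x)) m (Cmod_ge_0 _)). split.
    + apply Rdiv_le_0_compat; lra.
    + unfold f. replace (2 * (rho1 - r) * c * (exp (- (c * u)) / (c * u))) with
        ((rho1 - r) * (2 * exp (- (c * u)) / u)) by (field; lra).
      destruct (Rle_dec r k) as [Hrk|Hrk].
      * assert (E1 : rho1 = k) by (unfold rho1; now apply Rmax_right).
        assert (Ecp : cphi = k) by (assert (A := cphi_rho1); rewrite E1 in *; nra).
        apply Rmult_le_compat_l; [lra|].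
        apply Rmult_le_compat_r; [left; apply Rinv_0_lt_compat; lra|].
        replace (c * u) with (c / k * (u * k)) by (field; lra).
        apply tangent_power_bound; [|lra]. rewrite Hx, cos_phi, Ecp. easy.
      * assert (E1 : rho1 = r) by (unfold rho1; apply Rmax_left; lra).
        rewrite E1. lra.
  - easy.
  - exists d. split; [easy|]. intros N HN. specialize (H N HN). cbv beta in H.
    eapply Rle_trans; [exact H|]. apply Rplus_le_compat_r. right.
    replace (ua + 1 * (ub - ua)) with ub by ring.
    replace (ua + 0 * (ub - ua)) with ua by ring.
    destruct He1 as [->| ->].
    + replace ub with rho1 by lra. replace ua with r by lra. ring.
    + replace ub with r by lra. replace ua with rho1 by lra. ring.
Qed.

Lemma contour_var_bound :
  var_bound contour kernel
    (4 * s ^ (m + 1) * ln (4 / k) + 4 * Ei (c * r) + 2 * PI * (1 + r) ^ m).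
Proof.
  assert (Hphi := phi_range). assert (Ha := alpha_range). assert (HP := PI_RGT_0).
  destruct rho1_range as (H1 & H2 & H3).
  assert (B1 := outer_arc_var_bound 0 (PI - phi) up_outer_le).
  assert (B6 := outer_arc_var_bound (- (PI - phi)) 0 lo_outer_le).
  assert (B2 := segment_var_bound 1 r rho1 (PI - phi) q_up p_up ltac:(ring)
    (Rtrigo_facts.cos_pi_minus phi) ltac:(ring) ltac:(ring) seg_up_polar).
  assert (B5 := segment_var_bound (-1) rho1 r (- (PI - phi)) p_lo q_lo ltac:(ring)
    (eq_trans (cos_neg _) (Rtrigo_facts.cos_pi_minus phi)) ltac:(ring) ltac:(ring)
    seg_lo_polar).
  assert (B3 : var_bound A1u kernel (2 * s ^ (m + 1) * ln (4 / k))).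
  { apply (inner_arc_var_bound 1); [ring|ring| |].
    - intros t Ht. rewrite Rmult_1_l.
      exact (convex_between _ _ t up_inner_le Ht).
    - now rewrite !Rmult_1_l. }
  assert (B4 : var_bound A1l kernel (2 * s ^ (m + 1) * ln (4 / k))).
  { apply (inner_arc_var_bound (-1)); [ring|ring| |].
    - intros t Ht. assert (A := convex_between (- PI) (- alpha) t lo_inner_le Ht). lra.
    - replace (-1 * - alpha) with alpha by ring. replace (-1 * - PI) with PI by ring.
      ring. }
  refine (var_bound_le _ _ _ _ _ (var_bound_app _ _ _ _ _ B1 (var_bound_app _ _ _ _ _
    B2 (var_bound_app _ _ _ _ _ B3 (var_bound_app _ _ _ _ _ B4
    (var_bound_app _ _ _ _ _ B5 B6)))))).
  (* The two outer arcs have total angle [2 * (PI - phi)], which is enlarged to [2 * PI]. *)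
  assert (0 < (1 + r) ^ m) by (apply pow_lt; lra). nra.
Qed.
End Estimate.
End Contour.

(** * The contour pushed into the domain *)

Lemma index_ex (K : chain) (w : C) (d : R) : 0 < d ->
  (forall z, img K z -> d <= Cmod (z - w)) ->
  exists v : C, cint (V := C_NormedModule) K (fun z => (/ (z - w))%C) v /\
    Cmod v <= / d * len K.
Proof.
  intros Hd H.
  assert (Hne : forall z, img K z -> z <> w).
  { intros z Hz ->. specialize (H w Hz). rewrite Cminus_diag, Cmod_0 in H. lra. }
  destruct (cint_ex (V := C_NormedModule) K (fun z => (/ (z - w))%C)) as [v Hv];
    [apply norm_complete_C|now apply index_cont|].
  exists v. split; [easy|].
  refine (cint_norm (V := C_NormedModule) K _ v _ _ _ Hv).
  - left. now apply Rinv_0_lt_compat.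
  - intros z Hz. change (Cmod (/ (z - w)) <= / d).
    rewrite Cmod_inv by (apply Cminus_neq_0; auto).
    apply Rinv_le_contravar; auto.
Qed.

(** The index is constant along the ray, and length over distance bounds it by arbitrarily small
    numbers far out. *)
Lemma index_ray (K : chain) (c u : C) (s d : R) :
  closed_chain K -> 0 < d -> u <> 0 ->
  (forall t z, s <= t -> img K z -> d <= Cmod (z - (c + t * u))) ->
  cint (V := C_NormedModule) K (fun z => (/ (z - (c + s * u)))%C) (RtoC 0).
Proof.
  intros HK Hd Hu Hray.
  destruct (index_ex K (c + s * u)%C d Hd) as (v & Hv & _).
  { intros z Hz. apply Hray; [lra|easy]. }
  assert (Hb : exists b, forall z, img K z -> Cmod (z - c) <= b).
  { destruct (cont_on_bounded (V := C_NormedModule) K (fun z => (z - c)%C))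
      as (b & _ & Hb).
    - intros w _ eps He. exists eps. split; [easy|]. intros w' _ Hw.
      change (Cmod ((w' - c) - (w - c)) <= eps).
      replace ((w' - c) - (w - c))%C with (w' - w)%C by ring. lra.
    - exists b. exact Hb. }
  destruct Hb as [b Hb].
  assert (Hu' : 0 < Cmod u) by now apply Cmod_gt_0.
  assert (Hbig : forall B, 0 < B -> exists t, s <= t /\
    forall z, img K z -> B <= Cmod (z - (c + t * u))).
  { intros B HB. set (t := Rabs s + (B + Rabs b) / Cmod u).
    assert (Hq : 0 <= (B + Rabs b) / Cmod u).
    { apply Rdiv_le_0_compat; [|easy]. assert (A := Rabs_pos b). lra. }
    assert (Hs := Rabs_pos s). assert (Hs' := Rle_abs s). assert (Hb' := Rle_abs b).
    exists t. split; [unfold t; lra|]. intros z Hz. specialize (Hb z Hz).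
    assert (A := norm_minus_le (V := C_NormedModule) (z - c)%C (z - (c + t * u))%C).
    change (Cmod ((z - c) - (z - (c + t * u)))
      <= Cmod (z - c) + Cmod (z - (c + t * u))) in A.
    replace ((z - c) - (z - (c + t * u)))%C with (RtoC t * u)%C in A by ring.
    rewrite Cmod_mult, Cmod_R, Rabs_pos_eq in A by (unfold t; lra).
    assert (E : t * Cmod u = Rabs s * Cmod u + (B + Rabs b)) by (unfold t; field; lra).
    assert (0 <= Rabs s * Cmod u) by (apply Rmult_le_pos; lra). lra. }
  replace (RtoC 0) with v; [easy|].
  apply Cmod_eq_0, Rle_antisym; [|apply Cmod_ge_0]. apply le_epsilon. intros eps He.
  rewrite Rplus_0_l. assert (HL := len_ge_0 K).
  destruct (Hbig ((len K + 1) / eps)) as (t & Ht & Hfar);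
    [apply Rdiv_lt_0_compat; lra|].
  destruct (index_ex K (c + t * u)%C ((len K + 1) / eps)) as (v' & Hv' & Hn);
    [apply Rdiv_lt_0_compat; lra|easy|].
  assert (Hvt : cint (V := C_NormedModule) K (fun z => (/ (z - (c + t * u)))%C) v).
  { apply (index_constant K (c + s * u)%C _ d); [easy|easy| |easy].
    intros l z Hl Hz.
    replace (c + s * u + l * (c + t * u - (c + s * u)))%C with
      (c + RtoC (s + l * (t - s)) * u)%C
      by (rewrite RtoC_plus, RtoC_mult, RtoC_minus; ring).
    apply Hray; [|easy]. assert (0 <= l * (t - s)) by (apply Rmult_le_pos; lra). lra. }
  rewrite (cint_unique (V := C_NormedModule) _ _ _ _ Hvt Hv').
  eapply Rle_trans; [exact Hn|].
  replace (/ ((len K + 1) / eps) * len K) with (eps / (len K + 1) * len K)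
    by (field; lra).
  now apply le_scaled_eps.
Qed.

(** * The domain, its star center, and winding numbers near its boundary *)

Section Domain.
Variables s k r : R.
Hypothesis s_range : 0 < s < 1.
Hypothesis k_pos : 0 < k.
Hypothesis k_sqr : k ^ 2 = 1 - s ^ 2.
Hypothesis r_range : 0 < r < 1.

Definition dom (z : C) : Prop := Bset s z \/ Cmod (z - 1) < r.

Let c : C := RtoC (1 - r / 2).

Lemma Bset_center : Bset s c.
Proof.
  exists (1 - r / 2). split; [lra|]. unfold c. rewrite Cminus_diag, Cmod_0. nra.
Qed.

Lemma center_to_1 : Cmod (c - 1) = r / 2.
Proof. unfold c. rewrite Cmod_RtoC_minus, Rabs_left1; lra. Qed.

Lemma dom_center : dom c.
Proof. left. apply Bset_center. Qed.

Lemma dom_open : C_open dom.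
Proof.
  intros z [Hz|Hz].
  - destruct (Bset_open s z Hz) as (d & Hd & H). exists d. split; [easy|].
    intros w Hw. left. now apply H.
  - exists (r - Cmod (z - 1)). split; [lra|]. intros w Hw. right.
    assert (A := Cmod_minus_triangle z w 1). lra.
Qed.

(** The center is interior to both convex pieces, so contracting towards it
    moves their closures inside. *)
Lemma dilate_closure (mu : R) (z : C) : 0 <= mu < 1 ->
  Cmod (z - 1) <= r \/ Kset s z -> dom (dilate c mu z).
Proof.
  intros Hmu [Hz|(t & Ht & Hz)].
  - right. replace (dilate c mu z - 1)%C with
      (RtoC mu * (z - 1) + RtoC (1 - mu) * (c - 1))%C
      by (unfold dilate; rewrite RtoC_minus; ring).
    eapply Rle_lt_trans; [apply Cmod_triangle|].
    rewrite !Cmod_mult, !Cmod_R, !Rabs_pos_eq, center_to_1 by lra.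
    apply Rle_lt_trans with (mu * r + (1 - mu) * (r / 2)); [|nra].
    apply Rplus_le_compat_r, Rmult_le_compat_l; lra.
  - left. exists (mu * t + (1 - mu) * (1 - r / 2)). split; [split|].
    + apply Rplus_le_le_0_compat; apply Rmult_le_pos; lra.
    + nra.
    + replace (_ - _)%C with (RtoC mu * (z - t))%C
        by (unfold dilate, c; rewrite RtoC_plus, !RtoC_mult, !RtoC_minus; ring).
      rewrite Cmod_mult, Cmod_R, Rabs_pos_eq by lra.
      apply Rle_lt_trans with (mu * ((1 - t) * s)).
      * apply Rmult_le_compat_l; lra.
      * assert (0 < (1 - mu) * (r / 2 * s)).
        { apply Rmult_lt_0_compat; [lra|]. apply Rmult_lt_0_compat; lra. }
        nra.
Qed.

Lemma dom_star : starlike c dom.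
Proof.
  intros z t Hz Ht. destruct (Req_dec t 1) as [->|Ht1].
  - replace (c + 1 * (z - c))%C with z by ring. easy.
  - apply (dilate_closure t); [lra|]. destruct Hz as [(u & Hu & Hz)|Hz].
    + right. exists u. lra.
    + left. lra.
Qed.

Lemma dom_bounded z : dom z -> Cmod (z - c) <= 2.
Proof.
  assert (Hc : Cmod c = 1 - r / 2) by (unfold c; rewrite Cmod_R, Rabs_pos_eq; lra).
  intros [(t & Ht & Hz)|Hz].
  - assert (A := Cmod_minus_triangle t z c).
    assert (B : Cmod (t - c) <= 1).
    { unfold c. rewrite Cmod_RtoC_minus. apply Rabs_le. lra. }
    nra.
  - assert (A := Cmod_minus_triangle 1 z c). rewrite (Cmod_minus_sym 1 c), center_to_1 in A.
    lra.
Qed.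

Lemma boundary_not_dom z : on_boundary s r z -> ~ dom z.
Proof. intros (H1 & H2 & _) [H|H]; [easy|lra]. Qed.

Lemma boundary_bounded z : on_boundary s r z -> Cmod (z - c) <= 2 /\ Cmod z <= 1 + r.
Proof.
  intros (_ & _ & [H|(t & Ht & H)]).
  - assert (A := Cmod_minus_triangle 1 z c). rewrite (Cmod_minus_sym 1 c), center_to_1 in A.
    assert (B := Cmod_le_minus z 1). rewrite Cmod_1 in B. split; lra.
  - assert (A := Cmod_minus_triangle t z c).
    assert (B : Cmod (t - c) <= 1).
    { unfold c. rewrite Cmod_RtoC_minus. apply Rabs_le. lra. }
    assert (D := Cmod_le_minus z t). rewrite Cmod_R, Rabs_pos_eq in D by lra.
    split; nra.
Qed.

Lemma boundary_far_center z : on_boundary s r z -> r / 2 <= Cmod (z - c).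
Proof.
  intros (H & _). assert (A := Cmod_minus_triangle c z 1). rewrite center_to_1 in A. lra.
Qed.

Lemma dilate_boundary_near mu z : on_boundary s r z ->
  Cmod (dilate c mu z - z) <= 2 * Rabs (1 - mu).
Proof.
  intros Hz. destruct (boundary_bounded z Hz) as [H _].
  replace (dilate c mu z - z)%C with (RtoC (mu - 1) * (z - c))%C
    by (unfold dilate; rewrite RtoC_minus; ring).
  rewrite Cmod_mult, Cmod_R, Rabs_minus_sym, Rmult_comm.
  apply Rmult_le_compat_r; [apply Rabs_pos|easy].
Qed.

Lemma dilate_out mu z : 1 <= mu -> ~ dom z -> ~ dom (dilate c mu z).
Proof.
  intros Hmu Hz H. apply Hz.
  replace z with (c + RtoC (/ mu) * (dilate c mu z - c))%C.
  - apply dom_star; [easy|]. split; [left; apply Rinv_0_lt_compat; lra|].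
    rewrite <- Rinv_1. apply Rinv_le_contravar; lra.
  - replace (dilate c mu z - c)%C with (RtoC mu * (z - c))%C by (unfold dilate; ring).
    rewrite Cmult_assoc, <- RtoC_mult, Rinv_l by lra. ring.
Qed.

Lemma dilate_out_Kset mu z : 1 < mu -> on_boundary s r z ->
  ~ Kset s (dilate c mu z).
Proof.
  intros Hmu Hz H. apply (boundary_not_dom z Hz).
  replace z with (dilate c (/ mu) (dilate c mu z)).
  - apply dilate_closure; [|now right].
    assert (A : / mu < / 1) by (apply Rinv_lt_contravar; lra).
    rewrite Rinv_1 in A. split; [|easy]. left. apply Rinv_0_lt_compat. lra.
  - unfold dilate. replace (c + RtoC mu * (z - c) - c)%C with (RtoC mu * (z - c))%C by ring.
    rewrite Cmult_assoc, <- RtoC_mult, Rinv_l by lra. ring.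
Qed.

(** If [w] lay in the disc of radius [(1 - t) * s0] about [t] while [z] is outside that of radius
    [(1 - t) * s], then [(1 - t) * (s - s0) <= d]. So [t] is close to 1 and [z] comes closer to 1
    than [r]. *)
Lemma near_boundary_off_Kset s0 d z w : 0 <= s0 < s -> on_boundary s r z ->
  Cmod (w - z) <= d -> 2 * d / (s - s0) + d < r -> ~ Kset s0 w.
Proof.
  intros Hs0 (H1 & H2 & _) Hwz Hd (t & Ht & Hw).
  assert (A := Cmod_minus_triangle w z t). rewrite (Cmod_minus_sym z w) in A.
  assert (B := Cmod_minus_triangle t z 1).
  rewrite Cmod_RtoC_minus, (Rabs_left1 (t - 1)) in B by lra.
  assert (Hd0 : 0 <= d) by (assert (D := Cmod_ge_0 (w - z)); lra).
  assert (Hq : 0 <= d / (s - s0)) by (apply Rdiv_le_0_compat; lra).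
  assert (Hu : 1 - t <= d / (s - s0)).
  { destruct (Req_dec t 1) as [->|Ht1]; [lra|].
    assert (Hz : (1 - t) * s <= Cmod (z - t)).
    { apply Rnot_lt_le. intros Hlt. apply H2. exists t. split; [lra|easy]. }
    apply Rmult_le_reg_r with (s - s0); [lra|].
    unfold Rdiv. rewrite Rmult_assoc, Rinv_l by lra. lra. }
  replace (2 * d / (s - s0)) with (2 * (d / (s - s0))) in Hd by (field; lra).
  assert ((1 - t) * s0 <= (1 - t) * 1) by (apply Rmult_le_compat_l; lra). lra.
Qed.

Let K := contour s k r s_range k_pos k_sqr r_range.

(** The index at 1 is carried along segments, from 1 to [c] inside the disc of radius [r / 2] about
    1, then from [c] to [z] by starlikeness. *)
Lemma contour_index_dom (z : C) (d : R) : dom z -> 0 < d ->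
  (forall w, Cmod (w - z) < d -> dom w) ->
  cint (V := C_NormedModule) K (fun w => (/ (w - z))%C) (2 * PI * Ci)%C.
Proof.
  intros Hz Hd Hball.
  assert (Hbd : forall w, img K w -> on_boundary s r w)
    by (intros w Hw; eapply contour_boundary, Hw).
  assert (Hc : cint (V := C_NormedModule) K (fun w => (/ (w - c))%C) (2 * PI * Ci)%C).
  { apply (index_constant K 1 c (r / 2)); [apply contour_closed|lra| |
      apply contour_index_1].
    intros t w Ht Hw. destruct (Hbd w Hw) as (H1 & _).
    assert (A := Cmod_minus_triangle (1 + t * (c - 1)) w 1).
    replace (1 + t * (c - 1) - 1)%C with (RtoC t * (c - 1))%C in A by ring.
    rewrite (Cmod_mult t), Cmod_R, Rabs_pos_eq, center_to_1 in A by lra. nra. }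
  (* For [t <= r / 16] the moving point is within [r / 8] of [c], and the contour is at distance at
     least [r / 2] from [c]. For larger [t] the ball of radius [d] about [z], contracted by [t],
     stays in the domain. *)
  apply (index_constant K c z (Rmin (r / 4) (r / 16 * d))).
  - apply contour_closed.
  - apply Rmin_glb_lt; [lra|]. apply Rmult_lt_0_compat; lra.
  - intros t w Ht Hw. specialize (Hbd w Hw).
    assert (A1 := boundary_far_center w Hbd). assert (A2 := dom_bounded z Hz).
    destruct (Rle_dec t (r / 16)) as [Hs|Hs].
    + eapply Rle_trans; [apply Rmin_l|].
      assert (A := Cmod_minus_triangle (c + t * (z - c)) w c).
      replace (c + t * (z - c) - c)%C with (RtoC t * (z - c))%C in A by ring.
      rewrite (Cmod_mult t), Cmod_R, Rabs_pos_eq in A by lra. nra.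
    + eapply Rle_trans; [apply Rmin_r|]. apply Rnot_lt_le. intros Hlt.
      apply (boundary_not_dom w Hbd).
      set (w' := (c + RtoC (/ t) * (w - c))%C).
      assert (Ht0 : (RtoC t * RtoC (/ t) = 1)%C).
      { rewrite <- RtoC_mult, Rinv_r by lra. easy. }
      replace w with (c + t * (w' - c))%C.
      2:{ unfold w'. replace (c + t * (c + RtoC (/ t) * (w - c) - c))%C with
            (c + (RtoC t * RtoC (/ t)) * (w - c))%C by ring. rewrite Ht0. ring. }
      apply dom_star; [|easy]. apply Hball.
      apply Rmult_lt_reg_l with t; [lra|].
      rewrite <- (Rabs_pos_eq t) at 1 by lra. rewrite <- Cmod_R, <- Cmod_mult.
      replace (RtoC t * (w' - z))%C with (w - (c + t * (z - c)))%C.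
      2:{ unfold w'. replace (t * (c + RtoC (/ t) * (w - c) - z))%C with
            (t * (c - z) + (RtoC t * RtoC (/ t)) * (w - c))%C by ring.
          rewrite Ht0. ring. }
      eapply Rlt_le_trans; [exact Hlt|]. apply Rmult_le_compat_r; lra.
  - exact Hc.
Qed.

(** Scaling back by [/ mu] gives the index of the original contour about [z' = c + (z - c) / mu],
    which is at most [4 (1 - mu) <= d / 2] away from [z]. *)
Lemma dilated_contour_index (mu : R) Hmu (z : C) (d : R) : 0 < d -> dom z ->
  (forall w, Cmod (w - z) < d -> dom w) -> / 2 <= mu < 1 -> 8 * (1 - mu) <= d ->
  cint (V := C_NormedModule) (chain_dilate c mu Hmu K) (fun w => (/ (w - z))%C)
    (2 * PI * Ci)%C.
Proof.
  intros Hd Hz Hball Hm Hmd. apply (cint_dilate (V := C_NormedModule)).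
  set (z' := (c + RtoC (/ mu) * (z - c))%C).
  assert (Hmm : (RtoC mu * RtoC (/ mu) = 1)%C).
  { rewrite <- RtoC_mult, Rinv_r by lra. easy. }
  assert (Hmu0 : RtoC mu <> 0) by (intros E; apply RtoC_inj in E; lra).
  assert (Hnear : Cmod (z' - z) <= d / 2).
  { replace (z' - z)%C with (RtoC (/ mu - 1) * (z - c))%C
      by (unfold z'; rewrite RtoC_minus; ring).
    assert (Hi : 1 <= / mu <= 1 + 2 * (1 - mu)).
    { split.
      - rewrite <- Rinv_1 at 1. apply Rinv_le_contravar; lra.
      - apply Rmult_le_reg_r with mu; [lra|]. rewrite Rinv_l by lra. nra. }
    rewrite Cmod_mult, Cmod_R, Rabs_pos_eq by lra.
    assert (A := dom_bounded z Hz). assert (B := Cmod_ge_0 (z - c)). nra. }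
  assert (Hball' : forall w, Cmod (w - z') < d / 2 -> dom w).
  { intros w Hw. apply Hball. assert (A := Cmod_minus_triangle z' w z). lra. }
  assert (Hz' : dom z') by (apply Hball'; rewrite Cminus_diag, Cmod_0; lra).
  refine (cint_ext (V := C_NormedModule) _ _ _ _ _
    (contour_index_dom z' (d / 2) Hz' ltac:(lra) Hball')).
  intros w Hw. change (/ (w - z') = RtoC mu * / (dilate c mu w - z))%C.
  assert (Hne : (w - z')%C <> 0).
  { apply Cminus_neq_0. intros ->.
    apply (boundary_not_dom z'); [|easy]. eapply contour_boundary, Hw. }
  replace (dilate c mu w - z)%C with (RtoC mu * (w - z'))%C.
  2:{ unfold z', dilate.
      replace (mu * (w - (c + RtoC (/ mu) * (z - c))))%C with
        (mu * (w - c) - (RtoC mu * RtoC (/ mu)) * (z - c))%C by ring.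
      rewrite Hmm. ring. }
  field. split; [exact Hne|exact Hmu0].
Qed.

(** The contracted point escapes to infinity along the ray from [c] through [w]. From [w] onwards
    the ray is outside the domain, hence [d] away from [G]; before [w] it is within
    [2 (1 - mu) <= d / 2] of [w]. *)
Lemma boundary_outside_index (G : chain) (d mu : R) (w : C) :
  closed_chain G -> 0 < d ->
  (forall z u, img G z -> Cmod (u - z) < d -> dom u) ->
  on_boundary s r w -> mu < 1 -> 4 * (1 - mu) <= d ->
  (forall z, img G z -> d / 2 <= Cmod (dilate c mu w - z)) /\
  cint (V := C_NormedModule) G (fun z => (/ (z - dilate c mu w))%C) (RtoC 0).
Proof.
  intros HG Hd Hball Hw Hmu Hmd.
  assert (Hfar : forall t z, mu <= t -> img G z -> d / 2 <= Cmod (z - dilate c t w)).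
  { intros t z Ht Hz. rewrite Cmod_minus_sym. destruct (Rle_dec 1 t) as [H1|H1].
    - assert (d <= Cmod (dilate c t w - z)); [|lra].
      apply Rnot_lt_le. intros Hlt.
      apply (dilate_out t w H1 (boundary_not_dom w Hw)). now apply (Hball z).
    - assert (A : d <= Cmod (w - z)).
      { apply Rnot_lt_le. intros Hlt. apply (boundary_not_dom w Hw).
        now apply (Hball z). }
      assert (B := dilate_boundary_near t w Hw). rewrite Rabs_pos_eq in B by lra.
      assert (E := Cmod_minus_triangle (dilate c t w) w z).
      rewrite (Cmod_minus_sym w (dilate c t w)) in E. lra. }
  split.
  - intros z Hz. rewrite Cmod_minus_sym. apply Hfar; [lra|easy].
  - apply (index_ray G c (w - c)%C mu (d / 2)); [easy|lra| |].
    + apply Cmod_pos_neq. assert (A := boundary_far_center w Hw). lra.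
    + intros t z Ht Hz. now apply Hfar.
Qed.

End Domain.

(** * The norm estimate *)

Lemma pow_lipschitz (m : nat) (b : R) : 0 <= b ->
  exists l, 0 <= l /\ forall x y h, 0 <= x <= b -> 0 <= y <= x + h -> 0 <= h <= 1 ->
    y ^ m <= x ^ m + h * l.
Proof.
  intros Hb. induction m as [|m (l & Hl & IH)].
  - exists 0. split; [lra|]. intros. simpl. lra.
  - exists (b ^ m + (b + 1) * l). assert (Hbm := pow_le b m Hb). split; [nra|].
    intros x y h Hx Hy Hh. simpl. specialize (IH x y h Hx Hy Hh).
    assert (Hxm : 0 <= x ^ m <= b ^ m).
    { split; [apply pow_le; lra|apply pow_incr; lra]. }
    assert (Hym := pow_le y m (proj1 Hy)).
    apply Rle_trans with ((x + h) * (x ^ m + h * l)).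
    + apply Rmult_le_compat; lra.
    + assert (h * x ^ m <= h * b ^ m) by (apply Rmult_le_compat_l; lra).
      assert ((x + h) * (h * l) <= (b + 1) * (h * l)).
      { apply Rmult_le_compat_r; [apply Rmult_le_pos|]; lra. }
      lra.
Qed.

Lemma Cmod_2PIi : Cmod (2 * PI * Ci) = 2 * PI.
Proof.
  assert (A := PI_RGT_0).
  rewrite !Cmod_mult, Cmod_Ci, !Cmod_R, !Rabs_pos_eq by lra. ring.
Qed.

Lemma neq_0_2PIi : (2 * PI * Ci)%C <> 0.
Proof. apply Cmod_pos_neq. rewrite Cmod_2PIi. assert (A := PI_RGT_0). lra. Qed.

Section MainEstimate.
Context {X : NormedModule C_AbsRing}.
Hypothesis X_complete : norm_complete X.
Hypothesis X_nontrivial : exists x : X, x <> zero.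
Variable T : X -> X.
Hypothesis T_TR : Tadmor_Ritt T.
Variables (m : nat) (r eta : R).
Hypothesis r_range : 0 < r < 1.
Hypothesis eta_range : theta T < eta < PI / 2.

Let s := sin eta.
Let k := cos eta.
Let st := sin (theta T).
Let E := real (C_eta eta T).
Let c : C := RtoC (1 - r / 2).

Lemma eta_s_range : 0 < s < 1.
Proof. apply (sin_theta_lt X_nontrivial T T_TR eta eta_range). Qed.

Lemma eta_k_pos : 0 < k.
Proof.
  destruct (cos_theta X_nontrivial T T_TR) as [H _]. apply cos_gt_0; lra.
Qed.

Lemma eta_k_sqr : k ^ 2 = 1 - s ^ 2.
Proof.
  assert (A := sin2_cos2 eta). unfold Rsqr in A. unfold k, s. lra.
Qed.

Let K := contour s k r eta_s_range eta_k_pos eta_k_sqr r_range.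

Lemma E_ge_0 : 0 <= E.
Proof. apply (C_eta_bound X_complete X_nontrivial T T_TR eta eta_range). Qed.

Variables (s0 M : R).
Hypothesis s0_range : st < s0 < s.
Hypothesis M_ge_1 : 1 <= M.
Hypothesis off_s0 : forall z, ~ Kset s0 z ->
  is_resolvent T z (resolvent z T) /\
  forall x, Cmod (z - 1) * norm (resolvent z T x) <= M * norm x.

Lemma s0_ge_0 : 0 <= s0.
Proof. assert (A := sin_theta_lt X_nontrivial T T_TR eta eta_range). unfold st in *. lra. Qed.

(** The resolvent at the contracted point is compared with the one at the
    point expanded by the same amount, where [C_eta] is available. *)
Lemma resolvent_near_boundary : exists Q h0, 0 <= Q /\ 0 < h0 <= / 2 /\
  forall h w x, 0 < h <= h0 -> on_boundary s r w ->
    ~ Kset s0 (dilate c (1 - h) w) /\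
    Cmod (dilate c (1 - h) w) ^ m * norm (resolvent (dilate c (1 - h) w) T x)
      <= (E * (Cmod w ^ m / Cmod (w - 1)) + h * Q) * norm x.
Proof.
  assert (HE := E_ge_0). assert (Hs := eta_s_range). assert (Hs0 := s0_ge_0).
  destruct (pow_lipschitz m 2) as (l & Hl & Hpow); [lra|].
  set (M1 := 2 * M / r). assert (HM1 : 0 <= M1) by (apply Rdiv_le_0_compat; lra).
  (* The first term comes from comparing [/ Cmod (w2 - 1)] with [/ Cmod (w - 1)], the second from
     the resolvent identity between two points at distance at most [4 * h]. *)
  set (A := 4 * E / r ^ 2 + 4 * M1 ^ 2).
  assert (Hr2 : 0 < r ^ 2) by (apply pow_lt; lra).
  assert (HA : 0 <= A).
  { unfold A. assert (0 <= 4 * E / r ^ 2) by (apply Rdiv_le_0_compat; lra).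
    assert (B := pow2_ge_0 M1). lra. }
  assert (H2m : 0 < 2 ^ m) by (apply pow_lt; lra).
  set (Q := 2 * l * (E / r) + 2 * l * A + 2 ^ m * A).
  assert (HEr : 0 <= E / r) by (apply Rdiv_le_0_compat; lra).
  assert (HQ : 0 <= Q).
  { unfold Q. assert (0 <= l * (E / r)) by now apply Rmult_le_pos.
    assert (0 <= l * A) by now apply Rmult_le_pos.
    assert (0 <= 2 ^ m * A) by (apply Rmult_le_pos; lra). lra. }
  (* Keeps points within [2 * h] of the boundary off [Kset s0]: the condition there is
     [h * (4 / (s - s0) + 2) < r]. *)
  set (h1 := r / (2 * (4 / (s - s0) + 2))).
  assert (Hq4 : 0 < 4 / (s - s0)) by (apply Rdiv_lt_0_compat; lra).
  assert (Hh1 : 0 < h1) by (apply Rdiv_lt_0_compat; lra).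
  exists Q, (Rmin (r / 4) h1). split; [easy|].
  assert (B1 := Rmin_l (r / 4) h1). assert (B2 := Rmin_r (r / 4) h1).
  split; [split; [apply Rmin_glb_lt; lra|lra]|].
  intros h w x Hh Hw.
  assert (Hnear : forall mu, Rabs (1 - mu) = h ->
    Cmod (dilate c mu w - w) <= 2 * h /\ ~ Kset s0 (dilate c mu w) /\
    r / 2 <= Cmod (dilate c mu w - 1)).
  { intros mu Hmu. assert (N := dilate_boundary_near s k r Hs eta_k_sqr r_range mu w Hw).
    fold c in N. rewrite Hmu in N. split; [easy|]. split.
    - apply (near_boundary_off_Kset s r Hs s0 (2 * h) w); [lra|easy|easy|].
      replace (2 * (2 * h) / (s - s0) + 2 * h) with (h * (4 / (s - s0) + 2))
        by (field; lra).
      apply Rle_lt_trans with (h1 * (4 / (s - s0) + 2)).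
      + apply Rmult_le_compat_r; lra.
      + replace (h1 * (4 / (s - s0) + 2)) with (r / 2)
          by (unfold h1; field; lra). lra.
    - destruct Hw as (Hw1 & _). assert (D := Cmod_minus_triangle (dilate c mu w) w 1).
      rewrite (Cmod_minus_sym w (dilate c mu w)) in D. lra. }
  destruct (Hnear (1 - h)) as (N1 & O1 & F1).
  { replace (1 - (1 - h)) with h by ring. apply Rabs_pos_eq. lra. }
  destruct (Hnear (1 + h)) as (N2 & O2 & F2).
  { replace (1 - (1 + h)) with (- h) by ring. rewrite Rabs_Ropp. apply Rabs_pos_eq. lra. }
  assert (O3 : ~ Kset s (dilate c (1 + h) w)).
  { apply (dilate_out_Kset s r Hs r_range); [lra|easy]. }
  set (w1 := dilate c (1 - h) w) in *. set (w2 := dilate c (1 + h) w) in *.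
  split; [easy|].
  destruct (off_s0 w1 O1) as [R1 S1]. destruct (off_s0 w2 O2) as [R2 S2].
  destruct (proj2 (C_eta_bound X_complete X_nontrivial T T_TR eta eta_range) w2 x O3)
    as [_ S3]. fold E in S3.
  assert (HM : forall u y, r / 2 <= Cmod (u - 1) ->
    Cmod (u - 1) * norm (resolvent u T y) <= M * norm y ->
    norm (resolvent u T y) <= M1 * norm y).
  { intros u y Hu Hy. assert (Hn := norm_ge_0 (resolvent u T y)).
    unfold M1. apply Rmult_le_reg_l with (r / 2); [lra|].
    replace (r / 2 * (2 * M / r * norm y)) with (M * norm y) by (field; lra).
    eapply Rle_trans; [|exact Hy]. now apply Rmult_le_compat_r. }
  assert (Hx := norm_ge_0 x).
  destruct Hw as (Hw1 & Hw2 & Hw3).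
  assert (Hw0 : on_boundary s r w) by easy.
  assert (I : 0 <= / Cmod (w - 1) <= / r).
  { split; [left; apply Rinv_0_lt_compat; lra|apply Rinv_le_contravar; lra]. }
  assert (Hinv : / Cmod (w2 - 1) <= / Cmod (w - 1) + 4 * h / r ^ 2).
  { assert (D := Cmod_minus_triangle w2 w 1). rewrite (Cmod_minus_sym w w2) in D.
    assert (I2 : 0 <= / Cmod (w2 - 1) <= / (r / 2)).
    { split; [left; apply Rinv_0_lt_compat; lra|apply Rinv_le_contravar; lra]. }
    assert (Eq : / Cmod (w2 - 1) - / Cmod (w - 1)
      = (Cmod (w - 1) - Cmod (w2 - 1)) * (/ Cmod (w2 - 1) * / Cmod (w - 1)))
      by (field; lra).
    assert (Hp : / Cmod (w2 - 1) * / Cmod (w - 1) <= / (r / 2) * / r)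
      by (apply Rmult_le_compat; lra).
    assert (Hp0 : 0 <= / Cmod (w2 - 1) * / Cmod (w - 1)) by (apply Rmult_le_pos; lra).
    assert ((Cmod (w - 1) - Cmod (w2 - 1)) * (/ Cmod (w2 - 1) * / Cmod (w - 1))
      <= 2 * h * (/ (r / 2) * / r)).
    { apply Rle_trans with (2 * h * (/ Cmod (w2 - 1) * / Cmod (w - 1))).
      - apply Rmult_le_compat_r; lra.
      - apply Rmult_le_compat_l; lra. }
    replace (2 * h * (/ (r / 2) * / r)) with (4 * h / r ^ 2) in H by (field; lra).
    lra. }
  assert (HR2 : norm (resolvent w2 T x) <= E * / Cmod (w2 - 1) * norm x).
  { apply Rmult_le_reg_l with (Cmod (w2 - 1)); [lra|].
    replace (Cmod (w2 - 1) * (E * / Cmod (w2 - 1) * norm x)) with (E * norm x)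
      by (field; lra). easy. }
  assert (HR1 : norm (resolvent w1 T x) <= (E * / Cmod (w - 1) + h * A) * norm x).
  { eapply Rle_trans; [apply (norm_le_minus _ (resolvent w2 T x))|].
    rewrite (resolvent_identity T _ _ w1 w2 x R1 R2), norm_scal_C.
    assert (D1 : Cmod (w2 - w1) <= 4 * h).
    { assert (D := Cmod_minus_triangle w w2 w1). rewrite (Cmod_minus_sym w w1) in D. lra. }
    assert (D2 : norm (resolvent w1 T (resolvent w2 T x)) <= M1 * (M1 * norm x)).
    { eapply Rle_trans; [apply HM; [easy|apply S1]|].
      apply Rmult_le_compat_l; [easy|]. apply HM; [easy|apply S2]. }
    assert (D3 : Cmod (w2 - w1) * norm (resolvent w1 T (resolvent w2 T x))
      <= 4 * h * (M1 * (M1 * norm x))).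
    { apply Rmult_le_compat; [apply Cmod_ge_0|apply norm_ge_0|easy|easy]. }
    assert (D4 : E * / Cmod (w2 - 1) * norm x
      <= E * (/ Cmod (w - 1) + 4 * h / r ^ 2) * norm x).
    { apply Rmult_le_compat_r; [easy|]. now apply Rmult_le_compat_l. }
    replace ((E * / Cmod (w - 1) + h * A) * norm x) with
      (E * (/ Cmod (w - 1) + 4 * h / r ^ 2) * norm x + 4 * h * (M1 * (M1 * norm x)))
      by (unfold A; field; lra).
    lra. }
  destruct (boundary_bounded s k r Hs eta_k_sqr r_range w Hw0) as [_ Hwb].
  assert (Hpw : Cmod w1 ^ m <= Cmod w ^ m + 2 * h * l).
  { apply Hpow.
    - split; [apply Cmod_ge_0|lra].
    - split; [apply Cmod_ge_0|]. assert (D := Cmod_le_minus w1 w). lra.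
    - lra. }
  assert (Hwm : 0 <= Cmod w ^ m <= 2 ^ m).
  { split; [apply pow_le, Cmod_ge_0|]. apply pow_incr. split; [apply Cmod_ge_0|lra]. }
  assert (Hw1m := pow_le (Cmod w1) m (Cmod_ge_0 w1)).
  eapply Rle_trans.
  { apply Rmult_le_compat; [easy|apply norm_ge_0|exact Hpw|exact HR1]. }
  rewrite <- Rmult_assoc. apply Rmult_le_compat_r; [easy|].
  assert (T1 : 2 * h * l * (E * / Cmod (w - 1)) <= h * (2 * l * (E / r))).
  { replace (h * (2 * l * (E / r))) with (2 * h * l * (E * / r)) by (field; lra).
    apply Rmult_le_compat_l.
    - apply Rmult_le_pos; lra.
    - apply Rmult_le_compat_l; lra. }
  assert (T2 : 2 * h * l * (h * A) <= h * (2 * l * A)).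
  { replace (2 * h * l * (h * A)) with (h * (h * (2 * l * A))) by ring.
    apply Rmult_le_compat_l; [lra|].
    assert (0 <= 2 * l * A) by (apply Rmult_le_pos; lra). nra. }
  assert (T3 : Cmod w ^ m * (h * A) <= h * (2 ^ m * A)).
  { replace (h * (2 ^ m * A)) with (2 ^ m * (h * A)) by ring.
    apply Rmult_le_compat_r; [apply Rmult_le_pos; lra|lra]. }
  unfold Q, Rdiv in *. lra.
Qed.

Variables (G : chain) (F : C -> C) (b : R).
Hypothesis G_closed : closed_chain G.
Hypothesis G_dom : forall z, img G z -> dom s r z.
Hypothesis G_off : forall z, img G z -> ~ Kset s0 z.
Hypothesis G_index : cint (V := C_NormedModule) G (fun z => (/ (z - 0))%C) (2 * PI * Ci)%C.
Hypothesis F_holo : holo_on (dom s r) F.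
Hypothesis b_ge_0 : 0 <= b.
Hypothesis F_bound : forall z, dom s r z -> Cmod (F z) <= b * Cmod z ^ m.

(** [u] is compared with a single Riemann sum over the contracted contour, to which the bound on
    arc-length sums of the uncontracted contour applies. *)
Lemma integral_estimate (x u : X) :
  cint G (fun z => scal (F z) (resolvent z T x)) u ->
  norm u <= E * calC r m eta * b * norm x.
Proof.
  intros Hu. assert (HE := E_ge_0). assert (Hs := eta_s_range).
  assert (Hs0 := s0_ge_0). assert (Hx := norm_ge_0 x). assert (HL := len_ge_0 K).
  destruct resolvent_near_boundary as (Q & h0 & HQ & Hh0 & Hnear).
  destruct (chain_open_distance G (dom s r) (dom_open s r) G_dom)
    as (d & Hd & Hball).
  apply le_epsilon. intros eps He.
  (* Collects the errors in units of [e1]: the slack of the length estimate, the contraction (as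
     [h <= e1]), and 1 for the Riemann sum. *)
  set (W := b * norm x * (E + Q * len K) + 1).
  assert (HW : 1 <= W).
  { unfold W. assert (0 <= Q * len K) by now apply Rmult_le_pos.
    assert (0 <= b * norm x) by now apply Rmult_le_pos.
    assert (0 <= b * norm x * (E + Q * len K)) by (apply Rmult_le_pos; lra). lra. }
  set (e1 := eps / W). assert (He1 : 0 < e1) by (apply Rdiv_lt_0_compat; lra).
  (* [h0] is for the resolvent estimate and [d / 8] for both winding numbers. *)
  set (h := Rmin h0 (Rmin (d / 8) e1)).
  assert (Hh : 0 < h) by (repeat apply Rmin_glb_lt; lra).
  assert (Hhh0 : h <= h0) by apply Rmin_l.
  assert (Hhd : h <= d / 8) by (eapply Rle_trans; [apply Rmin_r|apply Rmin_l]).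
  assert (Hhe : h <= e1) by (eapply Rle_trans; [apply Rmin_r|apply Rmin_r]).
  set (mu := 1 - h). assert (Hmu : 0 < mu) by (unfold mu; lra).
  set (L := chain_dilate c mu Hmu K).
  assert (Hbd : forall w, img K w -> on_boundary s r w)
    by (intros w Hw; eapply contour_boundary, Hw).
  assert (HimgL : forall z, img L z -> exists w, on_boundary s r w /\ z = dilate c mu w).
  { intros z (w & Hw & ->). exists w. split; [now apply Hbd|easy]. }
  assert (HLd : forall z, img L z -> dom s r z).
  { intros z Hz. destruct (HimgL z Hz) as (w & (_ & _ & Hw) & ->).
    apply dilate_closure; [easy|easy|unfold mu; lra|easy]. }
  assert (HuL : cint L (fun z => scal (F z) (resolvent z T x)) u).
  { apply (contour_deformation X_complete T s0 M (proj1 T_TR) Hs0 M_ge_1 off_s0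
      G L (dom s r) c F (2 * PI * Ci)%C) with (e := d / 2); try easy.
    - apply closed_chain_dilate, contour_closed.
    - apply dom_open.
    - now apply dom_star.
    - now apply dom_center.
    - intros z Hz. destruct (HimgL z Hz) as (w & Hw & ->). now apply (Hnear h w x).
    - apply neq_0_2PIi.
    - intros z Hz. destruct (HimgL z Hz) as (w & Hw & ->).
      apply (boundary_outside_index s k r Hs eta_k_sqr r_range G d mu w); try easy;
        unfold mu; lra.
    - intros z Hz. apply (dilated_contour_index s k r eta_s_range eta_k_pos eta_k_sqr r_range
        mu Hmu z d); [easy|now apply G_dom| |unfold mu; lra|unfold mu; lra].
      intros w Hw. now apply (Hball z).
    - lra.
    - intros z w Hz Hw. destruct (HimgL w Hw) as (w' & Hw' & ->).
      apply (boundary_outside_index s k r Hs eta_k_sqr r_range G d mu w'); try easy;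
        unfold mu; lra. }
  destruct (contour_var_bound s k r eta_s_range eta_k_pos eta_k_sqr r_range m e1 He1)
    as (d1 & Hd1 & Hvar).
  destruct (HuL e1 He1) as (d2 & Hd2 & Hsum).
  destruct (nodes_ex K (Rmin d1 d2)) as [N HN]; [now apply Rmin_glb_lt|].
  specialize (Hvar N (nodes_mono K _ _ N (Rmin_l _ _) HN)).
  assert (HN2 := nodes_mono K _ _ N (Rmin_r _ _) HN).
  specialize (Hsum (dilate_nodes c mu N) (ex_intro _ N (conj HN2 eq_refl))).
  rewrite norm_minus_sym in Hsum.
  eapply Rle_trans; [apply (norm_le_minus u (qsum (dilate_nodes c mu N)
    (fun z => scal (F z) (resolvent z T x))))|].
  assert (Hq : norm (qsum (dilate_nodes c mu N)
      (fun z => scal (F z) (resolvent z T x)))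
    <= b * norm x * (E * (calC r m eta + e1) + h * Q * len K)).
  { eapply Rle_trans; [apply norm_qsum|]. rewrite qvar_dilate by lra.
    set (kf := fun z : C => Cmod z ^ m / Cmod (z - 1)) in *.
    apply Rle_trans with (qvar N (fun w => b * norm x * (E * kf w + h * Q))).
    - set (f1 := fun z : C => norm (scal (F (dilate c mu z))
        (resolvent (dilate c mu z) T x))).
      assert (Hf1 : qvar N (fun _ => 0) <= qvar N f1).
      { apply qvar_le. intros. apply norm_ge_0. }
      rewrite qvar_const, Rmult_0_l in Hf1.
      (* The contraction multiplies the weights by [mu <= 1], a gain that is given away. *)
      apply Rle_trans with (qvar N f1); [unfold mu; nra|].
      apply qvar_le. intros a w Hw.
      assert (Hwb : on_boundary s r w).
      { apply Hbd. eapply nodes_img; eassumption. }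
      unfold f1. rewrite norm_scal_C.
      assert (Hdw : dom s r (dilate c mu w)).
      { destruct Hwb as (_ & _ & Hw'). apply dilate_closure; [easy|easy|unfold mu; lra|easy]. }
      destruct (Hnear h w x ltac:(lra) Hwb) as [_ Hk].
      fold mu in Hk.
      apply Rle_trans with (b * (Cmod (dilate c mu w) ^ m
        * norm (resolvent (dilate c mu w) T x))).
      + rewrite <- Rmult_assoc. apply Rmult_le_compat_r; [apply norm_ge_0|].
        now apply F_bound.
      + replace (b * norm x * (E * kf w + h * Q)) with
          (b * ((E * kf w + h * Q) * norm x)) by ring.
        apply Rmult_le_compat_l; easy.
    - rewrite qvar_scal, qvar_plus, qvar_scal, qvar_const.
      apply Rmult_le_compat_l; [now apply Rmult_le_pos|].
      apply Rplus_le_compat.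
      + apply Rmult_le_compat_l; [easy|]. unfold calC.
        replace (r * ((INR m + 1) / 2) * cos eta) with ((INR m + 1) / 2 * k * r)
          by (unfold k; ring). exact Hvar.
      + apply Rmult_le_compat_l; [apply Rmult_le_pos; lra|].
        eapply nodes_len; exact HN2. }
  apply Rle_trans with (E * calC r m eta * b * norm x + e1 * W).
  - assert (Hbx : 0 <= b * norm x) by now apply Rmult_le_pos.
    assert (Hhq : h * Q * len K <= e1 * Q * len K).
    { apply Rmult_le_compat_r; [easy|]. apply Rmult_le_compat_r; lra. }
    assert (b * norm x * (h * Q * len K) <= b * norm x * (e1 * Q * len K))
      by now apply Rmult_le_compat_l.
    unfold W. lra.
  - unfold e1. right. field. lra.
Qed.
End MainEstimate.

(** * Riemann-Stieltjes sums along a rectifiable curve *)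

Lemma RS_sum_qsum {V : NormedModule C_AbsRing} (F : C -> V) (g : R -> C) (ptd : SF_seq) :
  RS_sum F g ptd = qsum (knots g (SF_h ptd) (SF_t ptd)) F.
Proof.
  destruct ptd as [a l]. unfold RS_sum, SF_h, SF_t.
  change (knots g a l) with (knots g (fst (a, 0)) l). generalize (a, 0).
  induction l as [|[y xi] l IH]; intros p; simpl; [easy|].
  now rewrite IH.
Qed.

Lemma pointed_subdiv_fine (d a b : R) (l : list (R * R)) :
  pointed_subdiv (mkSF_seq a l) -> seq.last a (SF_lx (mkSF_seq a l)) = b ->
  seq_step (SF_lx (mkSF_seq a l)) < d -> fine d a l b.
Proof.
  unfold pointed_subdiv, SF_lx, SF_ly, SF_size, seq_step; simpl.
  revert a. induction l as [|[y xi] l IH]; simpl; intros a Hp Hl Hd; [easy|].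
  assert (H0 := Hp 0%nat ltac:(lia)). simpl in H0.
  assert (D1 := Rmax_l (Rabs (y - a)) (seq.foldr Rmax 0
    (seq.pairmap (fun x y : R => Rabs (y - x)) y (seq.unzip1 l)))).
  assert (D2 := Rmax_r (Rabs (y - a)) (seq.foldr Rmax 0
    (seq.pairmap (fun x y : R => Rabs (y - x)) y (seq.unzip1 l)))).
  rewrite Rabs_pos_eq in D1, D2, Hd by lra.
  split; [easy|]. split; [lra|]. apply IH; [|easy|lra].
  intros i Hi. apply (Hp (S i)). lia.
Qed.

Lemma Riemann_fine_intro (d : R) (P : SF_seq -> Prop) : 0 < d ->
  (forall l, fine d 0 l 1 -> P (mkSF_seq 0 l)) -> Riemann_fine 0 1 P.
Proof.
  intros Hd H. exists (mkposreal d Hd). intros [a l] Hs (Hp & Ha & Hl).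
  rewrite Rmin_left in Ha by lra. rewrite Rmax_right in Hl by lra.
  simpl in Ha. subst a. apply H. now apply pointed_subdiv_fine.
Qed.

Lemma rectifiable_var (g : R -> C) : rectifiable g -> exists v : R -> R,
  forall a b, 0 <= a -> a <= b -> b <= 1 -> Cmod (g b - g a) <= v b - v a.
Proof.
  intros (M & HM).
  set (E := fun t y => exists n p, 0 <= p 0%nat /\ p (S n) <= t /\
    (forall i : nat, (i <= n)%nat -> p i <= p (S i)) /\
    y = sum_f_R0 (fun i => Cmod (g (p (S i)) - g (p i))%C) n).
  exists (fun t => real (Lub_Rbar (E t))). intros a b Ha Hab Hb.
  assert (HE0 : E a 0).
  { exists 0%nat, (fun _ => a). split; [easy|]. split; [lra|]. split; [intros; lra|].
    simpl. replace (g a - g a)%C with (RtoC 0) by ring. now rewrite Cmod_0. }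
  assert (HEM : forall t y, t <= 1 -> E t y -> y <= M).
  { intros t y Ht (n & p & H1 & H2 & H3 & ->). apply HM; [easy|lra|easy]. }
  assert (Hext : forall y, E a y ->
    exists y', E b y' /\ y + Cmod (g b - g a) <= y').
  { intros y (n & p & H1 & H2 & H3 & ->).
    set (q := fun i : nat => if le_lt_dec i (S n) then p i else
      if Nat.eq_dec i (S (S n)) then a else b).
    assert (Q1 : forall i, (i <= S n)%nat -> q i = p i).
    { intros i Hi. unfold q. destruct (le_lt_dec i (S n)); [easy|lia]. }
    assert (Q2 : q (S (S n)) = a).
    { unfold q. destruct (le_lt_dec (S (S n)) (S n)); [lia|].
      now destruct (Nat.eq_dec (S (S n)) (S (S n))). }
    assert (Q3 : q (S (S (S n))) = b).
    { unfold q. destruct (le_lt_dec (S (S (S n))) (S n)); [lia|].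
      destruct (Nat.eq_dec (S (S (S n))) (S (S n))); [lia|easy]. }
    eexists. split.
    - exists (S (S n)), q. rewrite Q1 by lia. split; [easy|].
      rewrite Q3. split; [lra|]. split; [|reflexivity].
      intros i Hi. destruct (le_lt_dec i n) as [Hi'|Hi'].
      + rewrite !Q1 by lia. now apply H3.
      + destruct (Nat.eq_dec i (S n)) as [->|Hn].
        * rewrite Q2, Q1 by lia. lra.
        * replace i with (S (S n)) by lia. rewrite Q2, Q3. lra.
    - rewrite !tech5, Q3, Q2.
      replace (sum_f_R0 (fun i => Cmod (g (q (S i)) - g (q i))%C) n)
        with (sum_f_R0 (fun i => Cmod (g (p (S i)) - g (p i))%C) n).
      + assert (A := Cmod_ge_0 (g a - g (q (S n)))%C). lra.
      + apply sum_eq. intros i Hi. now rewrite !Q1 by lia. }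
  assert (Fa : is_finite (Lub_Rbar (E a))).
  { apply Lub_Rbar_finite with 0 M; [easy|]. intros y. apply HEM. lra. }
  assert (Fb : is_finite (Lub_Rbar (E b))).
  { destruct (Hext 0 HE0) as (y & Hy & _).
    apply Lub_Rbar_finite with y M; [easy|]. intros z. now apply HEM. }
  enough (A : real (Lub_Rbar (E a)) <= real (Lub_Rbar (E b)) + - Cmod (g b - g a)) by lra.
  destruct (Lub_Rbar_correct (E a)) as [_ HL].
  specialize (HL (Finite (real (Lub_Rbar (E b)) + - Cmod (g b - g a)))).
  rewrite <- Fa in HL. apply HL. intros y Hy.
  destruct (Hext y Hy) as (y' & Hy' & Hyy). simpl.
  assert (A := Lub_Rbar_ge _ _ Fb Hy'). lra.
Qed.

Lemma continuous_on_eps (g : R -> C) : continuous_on (fun t => 0 <= t <= 1) g ->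
  forall t, 0 <= t <= 1 -> forall eps, 0 < eps -> exists d, 0 < d /\
    forall s, 0 <= s <= 1 -> Rabs (s - t) < d -> Cmod (g s - g t) < eps.
Proof.
  intros H t Ht eps He.
  destruct (H t Ht (fun w => Cmod (w - g t) < eps)) as [d Hd].
  - now apply locally_C_ball with eps.
  - exists d. split; [apply cond_pos|]. intros s Hs Hst. now apply Hd.
Qed.

Lemma cint_contour_integral (g : R -> C) (v : R -> R) g_var g_cont (F : C -> C) (l : C) :
  cint (V := C_NormedModule) (curve g v g_var g_cont) F l -> is_contour_integral F g l.
Proof.
  intros H P HP. apply locally_C_elim in HP. destruct HP as (d & Hd & HP).
  destruct (H (d / 2)) as (d1 & Hd1 & H1); [lra|].
  apply Riemann_fine_intro with d1; [easy|]. intros t Ht. apply HP.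
  specialize (H1 (knots g 0 t) (ex_intro _ t (conj Ht eq_refl))).
  rewrite (RS_sum_qsum (V := C_NormedModule)).
  eapply Rle_lt_trans; [exact H1|]. lra.
Qed.

Lemma contour_integral_cint (g : R -> C) (v : R -> R) g_var g_cont (F : C -> C) (l l' : C) :
  is_contour_integral F g l ->
  cint (V := C_NormedModule) (curve g v g_var g_cont) F l' -> l = l'.
Proof.
  intros H H'. apply cint_contour_integral in H'.
  exact (filterlim_locally_unique (V := C_NormedModule) (F := Riemann_fine 0 1)
    (RS_sum F g) l l' H H').
Qed.

Lemma opnorm_ge_0 {X : NormedModule C_AbsRing} (S : X -> X) : 0 <= opnorm S.
Proof.
  unfold opnorm.
  destruct (Lub_Rbar_correct (fun y => exists x : X, norm x <= 1 /\ y = norm (S x)))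
    as [H _].
  assert (H0 : norm (zero : X) <= 1) by (rewrite norm_zero; lra).
  specialize (H _ (ex_intro _ zero (conj H0 eq_refl))).
  assert (A := norm_ge_0 (S zero)).
  destruct (Lub_Rbar _); simpl in *; lra.
Qed.

Section OperatorIntegral.
Context {X : NormedModule C_AbsRing}.
Hypothesis X_complete : norm_complete X.
Variables (T : X -> X) (s M d : R) (K : chain) (F : C -> C).
Hypothesis M_ge_1 : 1 <= M.
Hypothesis d_pos : 0 < d.
Hypothesis T_resolvent : forall z, ~ Kset s z ->
  is_resolvent T z (resolvent z T) /\
  forall x, Cmod (z - 1) * norm (resolvent z T x) <= M * norm x.
Hypothesis K_off : forall z, img K z -> ~ Kset s z.
Hypothesis K_far : forall z w, img K z -> Kset s w -> d <= Cmod (z - w).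
Hypothesis F_cont : cont_on (V := C_NormedModule) (img K) F.

Let h (x : X) (z : C) : X := scal (F z) (resolvent z T x).

Lemma resolvent_chain_bound z x : img K z -> norm (resolvent z T x) <= M / d * norm x.
Proof.
  intros Hz. destruct (T_resolvent z (K_off z Hz)) as [_ B].
  specialize (B x). assert (D := K_far z 1 Hz (Kset_one s)).
  assert (Hn := norm_ge_0 (resolvent z T x)).
  apply Rmult_le_reg_l with d; [easy|].
  replace (d * (M / d * norm x)) with (M * norm x) by (field; lra).
  eapply Rle_trans; [|exact B]. now apply Rmult_le_compat_r.
Qed.

(** By the resolvent identity the modulus is proportional to [norm x], so one mesh serves all
    vectors and convergence holds in operator norm. *)
Lemma integrand_near_constant eps : 0 < eps -> exists rho, 0 < rho /\
  forall x, near_constant (img K) rho (eps * norm x) (h x).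
Proof.
  intros He. set (N := M / d). assert (HN : 0 <= N) by (apply Rdiv_le_0_compat; lra).
  destruct (cont_on_bounded K F F_cont) as (B & HB & HF).
  assert (HBN : 0 <= B * (N * N)) by (apply Rmult_le_pos; [lra|now apply Rmult_le_pos]).
  destruct (le_scaled_eps N (eps / 2)) as [E1 E2]; [easy|lra|].
  destruct (le_scaled_eps (B * (N * N)) (eps / 2)) as [E3 E4]; [easy|lra|].
  destruct (cont_on_unif K F F_cont _ E1) as (rho & Hrho & Hnc).
  exists (Rmin rho (eps / 2 / (B * (N * N) + 1))).
  split; [now apply Rmin_glb_lt|]. intros x w w' Hw Hw' Hd.
  assert (R1 := Rmin_l rho (eps / 2 / (B * (N * N) + 1))).
  assert (R2 := Rmin_r rho (eps / 2 / (B * (N * N) + 1))).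
  assert (Hx := norm_ge_0 x).
  assert (Hc : Cmod (F w' - F w) <= eps / 2 / (N + 1)) by (apply Hnc; [easy|easy|lra]).
  replace (minus (h x w') (h x w)) with
    (plus (scal (F w' - F w)%C (resolvent w' T x))
       (scal (F w) (minus (resolvent w' T x) (resolvent w T x))))
    by (unfold h; lin_ring).
  rewrite (resolvent_identity T _ _ w' w x (proj1 (T_resolvent w' (K_off w' Hw')))
    (proj1 (T_resolvent w (K_off w Hw)))).
  eapply Rle_trans; [apply norm_plus_le|]. rewrite !norm_scal_C.
  assert (A1 : norm (resolvent w' T x) <= N * norm x) by now apply resolvent_chain_bound.
  assert (A2 : norm (resolvent w' T (resolvent w T x)) <= N * (N * norm x)).
  { eapply Rle_trans; [now apply resolvent_chain_bound|].
    apply Rmult_le_compat_l; [easy|]. now apply resolvent_chain_bound. }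
  assert (B1 : Cmod (F w' - F w) * norm (resolvent w' T x) <= eps / 2 * norm x).
  { apply Rle_trans with (eps / 2 / (N + 1) * (N * norm x)).
    - apply Rmult_le_compat; [apply Cmod_ge_0|apply norm_ge_0|easy|easy].
    - rewrite <- Rmult_assoc. now apply Rmult_le_compat_r. }
  assert (B2 : Cmod (F w) * (Cmod (w - w') * norm (resolvent w' T (resolvent w T x)))
    <= eps / 2 * norm x).
  { apply Rle_trans with (B * (eps / 2 / (B * (N * N) + 1) * (N * (N * norm x)))).
    - apply Rmult_le_compat; [apply Cmod_ge_0| |now apply HF|].
      + apply Rmult_le_pos; [apply Cmod_ge_0|apply norm_ge_0].
      + apply Rmult_le_compat; [apply Cmod_ge_0|apply norm_ge_0| |easy].
        rewrite Cmod_minus_sym. lra.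
    - replace (B * (eps / 2 / (B * (N * N) + 1) * (N * (N * norm x))))
        with (eps / 2 / (B * (N * N) + 1) * (B * (N * N)) * norm x) by ring.
      now apply Rmult_le_compat_r. }
  lra.
Qed.

(** The integral is chosen vector by vector; linearity follows from uniqueness. *)
Lemma operator_integral_ex : exists S : X -> X, is_linear S /\
  (forall x, cint K (h x) (S x)) /\
  forall eps, 0 < eps -> exists d', 0 < d' /\ forall N, nodes K d' N ->
    forall x, norm (minus (qsum N (h x)) (S x)) <= eps * norm x.
Proof.
  destruct (choice (fun x u => cint K (h x) u)) as [S HS].
  { intros x. apply cint_ex; [easy|]. intros w Hw eps He.
    destruct (le_scaled_eps (norm x) eps) as [E1 E2]; [apply norm_ge_0|easy|].
    destruct (integrand_near_constant _ E1) as (rho & Hrho & H).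
    exists rho. split; [easy|]. intros w' Hw' Hd.
    eapply Rle_trans; [apply (H x w w' Hw Hw' Hd)|exact E2]. }
  assert (Hlin : forall z, img K z -> is_linear (resolvent z T))
    by (intros z Hz; apply (T_resolvent z (K_off z Hz))).
  destruct (cont_on_bounded K F F_cont) as (B & HB & HF).
  exists S. split; [|split; [easy|]].
  - apply linear_bounded_by with (B * (M / d) * len K).
    + intros x y. apply (cint_unique K (h (plus x y))); [easy|].
      apply cint_ext with (fun z => plus (h x z) (h y z)); [|now apply cint_plus].
      intros z Hz. unfold h. rewrite (linear_plus _ (Hlin z Hz)). lin_ring.
    + intros a x. apply (cint_unique K (h (scal a x))); [easy|].
      apply cint_ext with (fun z => scal a (h x z)); [|now apply cint_scal].
      intros z Hz. unfold h. rewrite (linear_scal _ (Hlin z Hz)). lin_ring.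
    + intros x. replace (B * (M / d) * len K * norm x)
        with (B * (M / d * norm x) * len K) by ring.
      apply cint_norm with (h := h x); [| |easy].
      * apply Rmult_le_pos; [lra|]. apply Rmult_le_pos; [|apply norm_ge_0].
        apply Rdiv_le_0_compat; lra.
      * intros z Hz. unfold h. rewrite norm_scal_C.
        apply Rmult_le_compat; [apply Cmod_ge_0|apply norm_ge_0|now apply HF|].
        now apply resolvent_chain_bound.
  - intros eps He.
    destruct (le_scaled_eps (len K) eps) as [E1 E2]; [apply len_ge_0|easy|].
    destruct (integrand_near_constant _ E1) as (rho & Hrho & H).
    destruct (cint_uniform (V := X) K rho Hrho) as (d' & Hd' & H').
    exists d'. split; [easy|]. intros N HN x.
    eapply Rle_trans; [apply (H' N HN (h x) (S x) _ (H x) (HS x))|].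
    replace (eps / (len K + 1) * norm x * len K)
      with (eps / (len K + 1) * len K * norm x) by ring.
    apply Rmult_le_compat_r; [apply norm_ge_0|exact E2].
Qed.
End OperatorIntegral.

(** [epsilon] is pinned down by uniqueness of the limit: both candidates are close to the same sum.
    Linearity of the sums is what lets [opnorm] control their values. *)
Lemma op_contour_integral_spec {X : NormedModule C_AbsRing} (F : C -> X -> X)
    (g : R -> C) (v : R -> R) g_var g_cont (S : X -> X) :
  (forall t, 0 <= t <= 1 -> is_linear (F (g t))) -> is_linear S ->
  (forall eps, 0 < eps -> exists d, 0 < d /\ forall N, nodes (curve g v g_var g_cont) d N ->
    forall x, norm (minus (qsum N (fun z => F z x)) (S x)) <= eps * norm x) ->
  epsilon (inhabits (fun x : X => x)) (is_op_contour_integral F g) = S.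
Proof.
  intros HF HS Hint.
  assert (Hsum : forall eps, 0 < eps -> exists d, 0 < d /\ forall l, fine d 0 l 1 ->
    forall x, norm (minus (RS_sum (fun z => F z x) g (mkSF_seq 0 l)) (S x))
      <= eps * norm x).
  { intros eps He. destruct (Hint eps He) as (d & Hd & H). exists d. split; [easy|].
    intros l Hl x. rewrite RS_sum_qsum. apply H. now exists l. }
  assert (Hlin : forall d l (S' : X -> X), fine d 0 l 1 -> is_linear S' ->
    is_linear (fun x => minus (RS_sum (fun z => F z x) g (mkSF_seq 0 l)) (S' x))).
  { intros d l S' Hl HS'. apply is_linear_minus_fun; [|easy].
    replace (fun x => RS_sum (fun z => F z x) g (mkSF_seq 0 l))
      with (fun x => qsum (knots g 0 l) (fun z => F z x))
      by (extensionality x; now rewrite RS_sum_qsum).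
    apply is_linear_qsum. intros w z Hz.
    destruct (knots_In g d 0 l 1 w z ltac:(lra) ltac:(lra) Hl Hz) as (t & Ht & ->).
    now apply HF. }
  assert (Hex : is_op_contour_integral F g S).
  { split; [easy|]. intros P [eps HP].
    destruct (Hsum (eps / 2)) as (d & Hd & H); [apply is_pos_div_2|].
    apply Riemann_fine_intro with d; [easy|]. intros l Hl. apply HP.
    assert (He := cond_pos eps).
    assert (A : opnorm (fun x => minus (RS_sum (fun z => F z x) g (mkSF_seq 0 l)) (S x))
      <= eps / 2).
    { apply opnorm_le; [lra|]. intros x Hx. eapply Rle_trans; [now apply H|].
      rewrite <- (Rmult_1_r (eps / 2)) at 2. apply Rmult_le_compat_l; lra. }
    change (Rabs (opnorm (fun x => minus (RS_sum (fun z => F z x) g (mkSF_seq 0 l)) (S x))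
      - 0) < eps).
    rewrite Rminus_0_r, Rabs_pos_eq; [lra|]. apply opnorm_ge_0. }
  assert (HI := epsilon_spec (inhabits (fun x : X => x)) (is_op_contour_integral F g)
    (ex_intro _ S Hex)).
  revert HI. generalize (epsilon (inhabits (fun x : X => x)) (is_op_contour_integral F g)).
  intros I HI. destruct HI as [HI Hlim]. extensionality x.
  apply norm_minus_eq_0. apply le_epsilon. intros e He. rewrite Rplus_0_l.
  destruct (le_scaled_eps (2 * norm x) e) as [E1 E2];
    [assert (A := norm_ge_0 x); lra|easy|].
  set (eps := e / (2 * norm x + 1)) in *.
  destruct (Hsum eps E1) as (d & Hd & H).
  assert (Hloc : locally 0 (fun y => Rabs (y - 0) < eps))
    by now exists (mkposreal eps E1).
  assert (Hlim' := Hlim _ Hloc). unfold filtermap in Hlim'.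
  assert (Hf : Riemann_fine 0 1 (fun ptd => exists l, fine d 0 l 1 /\ ptd = mkSF_seq 0 l)).
  { apply Riemann_fine_intro with d; [easy|]. intros l Hl. now exists l. }
  destruct (filter_ex (F := Riemann_fine 0 1) _ (filter_and _ _ Hlim' Hf))
    as (ptd & Hop & l & Hl & ->).
  rewrite Rminus_0_r in Hop. apply Rabs_def2 in Hop.
  assert (B1 := opnorm_bound _ x (Hlin d l I Hl HI)). cbv beta in B1.
  assert (B2 := H l Hl x).
  eapply Rle_trans;
    [apply (norm_minus_triangle (RS_sum (fun z => F z x) g (mkSF_seq 0 l)))|].
  rewrite norm_minus_sym.
  assert (B3 : opnorm (fun x => minus (RS_sum (fun z => F z x) g (mkSF_seq 0 l)) (I x))
    * norm x <= eps * norm x) by (apply Rmult_le_compat_r; [apply norm_ge_0|lra]).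
  apply Rle_trans with (eps * norm x + eps * norm x); [|lra].
  apply Rplus_le_compat; [exact (Rle_trans _ _ _ B1 B3)|exact B2].
Qed.

(** * Bounded holomorphic functions and the final estimate *)

Lemma calC_ge_0 (r eta : R) (m : nat) : 0 < r < 1 -> 0 < eta < PI / 2 ->
  0 <= calC r m eta.
Proof.
  intros Hr He. unfold calC.
  assert (Hc : 0 < cos eta) by (apply cos_gt_0; lra).
  assert (Hs : 0 < sin eta) by (apply sin_gt_0; lra).
  assert (Hc1 := COS_bound eta). assert (Hpi := PI_RGT_0).
  assert (L : 0 <= ln (4 / cos eta)).
  { rewrite <- ln_1. apply ln_le; [lra|].
    apply Rmult_le_reg_r with (cos eta); [easy|].
    replace (4 / cos eta * cos eta) with 4 by (field; lra). lra. }
  assert (Hm := pos_INR m).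
  assert (A1 : 0 <= sin eta ^ (m + 1) * ln (4 / cos eta)).
  { apply Rmult_le_pos; [apply pow_le; lra|easy]. }
  assert (A2 : 0 <= Ei (r * ((INR m + 1) / 2) * cos eta)).
  { apply Ei_ge_0. apply Rmult_lt_0_compat; [|easy]. apply Rmult_lt_0_compat; lra. }
  assert (A3 : 0 <= PI * (1 + r) ^ m).
  { apply Rmult_le_pos; [lra|apply pow_le; lra]. }
  lra.
Qed.

Section Hinfty.
Variables (Om : C -> Prop) (f : C -> C).
Hypothesis f_Hinfty : Hinfty Om f.

Lemma supnorm_bound z : Om z -> Cmod (f z) <= supnorm Om f.
Proof.
  intros Hz. destruct f_Hinfty as [_ [M HM]]. apply Lub_Rbar_ge; [|now exists z].
  apply Lub_Rbar_finite with (Cmod (f z)) M; [now exists z|].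
  intros y (w & Hw & ->). now apply HM.
Qed.

Lemma holo_mult_pow m : holo_on Om (fun z => f z * tau m z)%C.
Proof.
  intros z Hz. destruct (ex_derive_cdiff f z (proj1 f_Hinfty z Hz)) as [l Hl].
  destruct (cdiff_pow m z) as [l' Hl']. eexists. exact (cdiff_mult _ _ z l l' Hl Hl').
Qed.
End Hinfty.

Lemma Omega_dom (eta r : R) (z : C) : 0 < sin eta -> Omega eta r z <-> dom (sin eta) r z.
Proof.
  intros Hs. unfold Omega, dom. rewrite B_Bset by easy. reflexivity.
Qed.

Lemma holo_calc_estimate {X : NormedModule C_AbsRing} (T : X -> X) (m : nat) (r eta : R)
    (f : C -> C) (Gamma : R -> C) :
  norm_complete X -> (exists x : X, x <> zero) -> Tadmor_Ritt T ->
  0 < r < 1 -> theta T < eta < PI / 2 -> Hinfty (Omega eta r) f ->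
  encircling_contour (Omega eta r) (closedB (theta T)) Gamma ->
  opnorm (holo_calc Gamma (fun z => f z * tau m z)%C T)
    <= real (C_eta eta T) / (2 * PI) * calC r m eta * supnorm (Omega eta r) f.
Proof.
  intros HX HX0 HT Hr Heta Hf ((Gcont & Gclosed & _) & Grect & Gimg & Gind).
  destruct (cos_theta HX0 T HT) as [Hth _].
  destruct (sin_theta_lt HX0 T HT eta Heta) as [Hst Hs].
  destruct (C_eta_bound HX HX0 T HT eta Heta) as [HE _].
  assert (HcalC := calC_ge_0 r eta m Hr ltac:(lra)). assert (Hpi := PI_RGT_0).
  destruct (rectifiable_var Gamma Grect) as [v Gvar].
  set (G := curve Gamma v Gvar (continuous_on_eps Gamma Gcont)).
  assert (G_closed : closed_chain G).
  { intros V P. simpl. rewrite Gclosed. lin_ring. }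
  assert (G_dom : forall z, img G z -> dom (sin eta) r z).
  { intros z (t & Ht & ->). apply Omega_dom; [easy|]. now apply Gimg. }
  assert (G_off_theta : forall z, img G z -> ~ Kset (sin (theta T)) z).
  { intros z (t & Ht & ->). rewrite <- closedB_Kset by easy. now apply Gimg. }
  destruct (chain_Kset_distance G (sin (theta T)) (proj1 Hst) G_off_theta)
    as (d0 & Hd0 & G_far_theta).
  (* Above [sin theta], so that a uniform resolvent bound exists; below [sin eta]; and within
     [d0 / 2] of [sin theta], so that [Gamma] stays outside [Kset s0]. *)
  set (s0 := sin (theta T) + Rmin (d0 / 2) ((sin eta - sin (theta T)) / 2)).
  assert (Hm1 := Rmin_l (d0 / 2) ((sin eta - sin (theta T)) / 2)).
  assert (Hm2 := Rmin_r (d0 / 2) ((sin eta - sin (theta T)) / 2)).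
  assert (Hm0 : 0 < Rmin (d0 / 2) ((sin eta - sin (theta T)) / 2))
    by (apply Rmin_glb_lt; lra).
  assert (Hs0 : sin (theta T) < s0 < sin eta) by (unfold s0; lra).
  assert (G_off : forall z, img G z -> ~ Kset s0 z).
  { intros z Hz H.
    destruct (Kset_near (sin (theta T)) s0 z ltac:(lra) H) as (w & Hw & Hzw).
    assert (A := G_far_theta z w Hz Hw). unfold s0 in Hzw. lra. }
  destruct (resolvent_off_Kset HX HX0 T HT s0 ltac:(lra)) as (M & HM & off_s0).
  destruct (chain_Kset_distance G s0 ltac:(lra) G_off) as (d & Hd & G_far).
  assert (K0 : Kset s0 0) by (apply Kset_disc; rewrite Cmod_0; lra).
  assert (G_index : cint (V := C_NormedModule) G (fun z => (/ (z - 0))%C) (2 * PI * Ci)%C).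
  { destruct (index_ex G 0 d Hd) as (l & Hl & _); [intros z Hz; now apply G_far|].
    (* The chain integral exists with some value [l]; uniqueness of limits identifies it with the
       winding number prescribed for [Gamma]. *)
    assert (E : (2 * PI * Ci)%C = l); [|now rewrite E].
    eapply contour_integral_cint; [|exact Hl].
    apply Gind, closedB_Kset; [easy|]. apply Kset_disc. rewrite Cmod_0. lra. }
  set (F := fun z => (f z * tau m z)%C).
  assert (F_holo : holo_on (dom (sin eta) r) F).
  { intros z Hz. apply (holo_mult_pow (Omega eta r)); [easy|]. now apply Omega_dom. }
  assert (F_cont : cont_on (V := C_NormedModule) (img G) F).
  { intros z Hz eps He. destruct (F_holo z (G_dom z Hz)) as [l Hl].
    destruct (cdiff_ccont F z l Hl eps He) as (e & He' & H).
    exists e. split; [easy|]. intros w _ Hw. now apply H. }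
  set (b := supnorm (Omega eta r) f).
  assert (b_ge_0 : 0 <= b).
  { eapply Rle_trans; [apply (Cmod_ge_0 (f (Gamma 0)))|].
    apply supnorm_bound; [easy|]. apply Gimg. lra. }
  assert (F_bound : forall z, dom (sin eta) r z -> Cmod (F z) <= b * Cmod z ^ m).
  { intros z Hz. unfold F, tau. rewrite Cmod_mult, Cmod_pow.
    apply Rmult_le_compat_r; [apply pow_le, Cmod_ge_0|].
    apply supnorm_bound; [easy|]. now apply Omega_dom. }
  destruct (operator_integral_ex HX T s0 M d G F HM Hd off_s0 G_off G_far F_cont)
    as (S & HS & S_int & S_unif).
  unfold holo_calc.
  rewrite (op_contour_integral_spec _ Gamma v Gvar (continuous_on_eps Gamma Gcont) S);
    [|intros t Ht|easy|easy].
  2:{ apply is_linear_scal_fun. apply (off_s0 (Gamma t)), G_off. now exists t. }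
  apply opnorm_le.
  - apply Rmult_le_pos; [|easy]. apply Rmult_le_pos; [|easy].
    apply Rdiv_le_0_compat; lra.
  - intros x Hx. rewrite norm_scal_C, Cmod_inv, Cmod_2PIi by apply neq_0_2PIi.
    assert (A := integral_estimate HX HX0 T HT m r eta Hr Heta s0 M Hs0 HM off_s0
      G F b G_closed G_dom G_off G_index F_holo b_ge_0 F_bound x (S x) (S_int x)).
    apply Rmult_le_reg_l with (2 * PI); [lra|].
    rewrite <- Rmult_assoc, Rinv_r, Rmult_1_l by lra.
    eapply Rle_trans; [exact A|].
    replace (2 * PI * (real (C_eta eta T) / (2 * PI) * calC r m eta * b))
      with (real (C_eta eta T) * calC r m eta * b * 1) by (field; lra).
    apply Rmult_le_compat_l; [|easy].
    apply Rmult_le_pos; [|easy]. now apply Rmult_le_pos.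
Qed.

Theorem theorem2p3 :
  forall (X : CompleteNormedModule C_AbsRing),
  (exists x : X, x <> zero) ->
  forall (T : X -> X), Tadmor_Ritt T ->
  forall (m : nat) (r eta : R),
  0 < r < 1 ->
  theta T < eta < PI / 2 ->
  exists c : R,
    c <= real (C_eta eta T) / (2 * PI) * calC r m eta /\
    forall f : C -> C, Hinfty (Omega eta r) f ->
    forall Gamma : R -> C,
      encircling_contour (Omega eta r) (closedB (theta T)) Gamma ->
      opnorm (holo_calc Gamma (fun z => f z * tau m z)%C T)
        <= c * supnorm (Omega eta r) f.
Proof.
  intros X HX0 T HT m r eta Hr Heta.
  exists (real (C_eta eta T) / (2 * PI) * calC r m eta). split; [apply Rle_refl|].
  intros f Hf Gamma HG.
  exact (holo_calc_estimate (X := X) T m r eta f Gamma (complete_norm_complete X)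
    HX0 HT Hr Heta Hf HG).
Qed.
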